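(* Let $\beta>-1$. The minimal value of the modulus of a zero of an optimal approximant in $\mathcal{A}^2_\beta$ (over all $f\in\mathcal{A}^2_\beta$ with $f(0)\ne0$, all orders $n$, and all zeros of the optimal approximant $p_n$ to $1/f$) is $\frac{2\sqrt{\beta+2}}{\beta+3}$, and it is attained by the optimal approximant of degree $1$ to $1/f^*$, where $$f^*(z)=\left(1-\frac{z}{\sqrt{\beta+2}}\right)^{-(\beta+3)}.$$ In particular, for the classical Bergman space ($\beta=0$), the minimal modulus of a zero of an optimal approximant is $\frac23\sqrt2$ and the extremal function $f^*(z)$ is given by $\frac{2\sqrt2}{(\sqrt2-z)^3}$. Furthermore, with $$t_m:=\frac{2m+\beta+3}{\sqrt{(m+1)(m+\beta+2)}},\qquad m=0,1,2,\dots,$$ one has $\sigma(\mathcal{J}_\omega)\cap(2,\infty)=\{t_m\}_{m=0}^\infty$, and for each $m\in\mathbb{N}\cup\{0\}$ the solution $f(z;t_m)$ of the differential equation $$\frac{f'(z;t_m)}{f(z;t_m)}=\frac{t_m-(3+\beta)z}{1-t_mz+z^2},$$ normalized so that $f(0;t_m)=1$, is given by $$f(z;t_m)=\left(1-\frac{z\sqrt{m+\beta+2}}{\sqrt{m+1}}\right)^m\left(1-\frac{z\sqrt{m+1}}{\sqrt{m+\beta+2}}\right)^{-m-(3+\beta)}.$$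
   Context: For a sequence $\omega=\{\omega_n\}_{n\ge0}$ of positive reals, $H^2_\omega$ is the Hilbert space of functions $f(z)=\sum_{n\ge0}a_nz^n$ analytic in the open unit disk with $\|f\|_\omega^2=\sum|a_n|^2\omega_n<\infty$. $\mathcal{A}^2_\beta$ is $H^2_\omega$ for $\omega_n=\binom{\beta+n+1}{n}^{-1}$, where $\binom{\beta+n+1}{n}=\prod_{j=1}^n\frac{\beta+1+j}{j}$. The optimal approximant of order $n$ to $1/f$ is the unique polynomial $p_n$ of degree at most $n$ minimizing $\|pf-1\|_\omega$ among all polynomials $p$ of degree at most $n$. $\mathcal{J}_\omega$ is the infinite matrix (indices $1,2,\dots$) with $(\mathcal{J}_\omega)_{j,j+1}=(\mathcal{J}_\omega)_{j+1,j}=\sqrt{\omega_j/\omega_{j+1}}$ for $j\ge1$ and all other entries zero, viewed as a bounded self-adjoint operator on $\ell^2$ with spectrum $\sigma(\mathcal{J}_\omega)$. Powers use the principal branch; $f'$ denotes the derivative in $z$. *)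

(* Defs.v *)
From Stdlib Require Import Reals.
From Coquelicot Require Export Coquelicot.

Open Scope R_scope.

(** ** Weighted spaces of analytic functions in the unit disk *)

Definition in_disk (z : C) : Prop := Cmod z < 1.

(* A function on the disk is represented by a total function [C -> C]; its
   values outside the open unit disk are never inspected by the notions below
   (except for polynomials, which are functions on the whole plane). *)
Definition has_taylor (f : C -> C) (a : nat -> C) : Prop :=
  forall z : C, in_disk z -> @is_pseries C_AbsRing C_NormedModule a z (f z).

Definition in_H2 (omega : nat -> R) (f : C -> C) : Prop :=
  exists a : nat -> C, has_taylor f a /\
    ex_series (fun n => (Cmod (a n))^2 * omega n).

(* [f] belongs to H^2_omega and its norm is [N]. *)
Definition is_H2norm (omega : nat -> R) (f : C -> C) (N : R) : Prop :=
  0 <= N /\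
  exists a : nat -> C, has_taylor f a /\
    is_series (fun n => (Cmod (a n))^2 * omega n) (N^2).

(** ** Optimal approximants *)

Definition is_poly (n : nat) (p : C -> C) : Prop :=
  exists c : nat -> C, forall z : C,
    p z = @sum_n C_AbelianMonoid (fun k => (c k * z^k)%C) n.

(* [is_poly n] means degree at most [n]; this is degree exactly one. *)
Definition is_poly_deg1 (p : C -> C) : Prop := is_poly 1 p /\ ~ is_poly 0 p.

(* [p] minimizes the norm of [q f - 1] over all polynomials [q] of degree at
   most [n]; only those [q] for which [q f - 1] has finite norm compete, which
   is every [q] when [f] is in a space preserved by multiplication by [z]. *)
Definition is_optimal_approximant
    (omega : nat -> R) (f : C -> C) (n : nat) (p : C -> C) : Prop :=
  is_poly n p /\
  exists N : R, is_H2norm omega (fun z => p z * f z - 1)%C N /\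
    forall (q : C -> C) (M : R), is_poly n q ->
      is_H2norm omega (fun z => q z * f z - 1)%C M -> N <= M.

(* Moduli of the zeros of all optimal approximants. *)
Definition OA_zero_modulus (omega : nat -> R) (r : R) : Prop :=
  exists (f : C -> C) (n : nat) (p : C -> C) (z : C),
    in_H2 omega f /\ f 0%C <> 0%C /\
    is_optimal_approximant omega f n p /\ p z = 0%C /\ r = Cmod z.

Definition is_minimum (A : R -> Prop) (r : R) : Prop :=
  A r /\ forall s : R, A s -> r <= s.

(* The optimal approximant of order 1 to [1/f] has degree exactly one and
   vanishes at a point of modulus [r]. *)
Definition OA1_attains (omega : nat -> R) (f : C -> C) (r : R) : Prop :=
  in_H2 omega f /\ f 0%C <> 0%C /\
  exists p : C -> C,
    is_optimal_approximant omega f 1 p /\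
    (forall q : C -> C, is_optimal_approximant omega f 1 q ->
       forall z : C, q z = p z) /\
    is_poly_deg1 p /\
    exists z : C, p z = 0%C /\ Cmod z = r.

(** ** The Bergman-type weights *)

(* binomial(beta+n+1, n) = prod_{j=1}^n (beta+1+j)/j *)
Fixpoint gbinom (beta : R) (n : nat) : R :=
  match n with
  | O => 1
  | S k => gbinom beta k * ((beta + 1 + INR (S k)) / INR (S k))
  end.

Definition bergman (beta : R) (n : nat) : R := / gbinom beta n.

(** ** The Jacobi matrix and its spectrum *)

Definition in_l2 (x : nat -> C) : Prop := ex_series (fun n => (Cmod (x n))^2).

Definition l2norm (x : nat -> C) : R := sqrt (Series (fun n => (Cmod (x n))^2)).

Definition bounded_linear_l2 (T : (nat -> C) -> (nat -> C)) : Prop :=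
  (forall x, in_l2 x -> in_l2 (T x)) /\
  (forall x y, in_l2 x -> in_l2 y ->
     forall n, T (fun k => x k + y k)%C n = (T x n + T y n)%C) /\
  (forall (a : C) x, in_l2 x ->
     forall n, T (fun k => a * x k)%C n = (a * T x n)%C) /\
  (exists K : R, forall x, in_l2 x -> l2norm (T x) <= K * l2norm x).

(* Spectrum of a bounded operator [T] on the complex space l^2: those [lambda]
   for which [T - lambda] has no bounded two-sided inverse. *)
Definition spectrum (T : (nat -> C) -> (nat -> C)) (lambda : C) : Prop :=
  ~ exists S : (nat -> C) -> (nat -> C),
      bounded_linear_l2 S /\
      (forall x, in_l2 x ->
         forall n, S (fun k => T x k - lambda * x k)%C n = x n) /\
      (forall x, in_l2 x ->
         forall n, (T (S x) n - lambda * S x n)%C = x n).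

(* Entries for row and column indices starting from 1. *)
Definition jacobi_entry (omega : nat -> R) (j k : nat) : R :=
  if Nat.eqb k (S j) then sqrt (omega j / omega k)
  else if Nat.eqb j (S k) then sqrt (omega k / omega j)
  else 0.

(* Coordinate [n] of a vector [nat -> C] carries the matrix index [n+1].  The
   row with matrix index [n+1] vanishes beyond column [n+2], so the finite sum
   below is the full matrix-vector product. *)
Definition jacobi (omega : nat -> R) (x : nat -> C) (n : nat) : C :=
  @sum_n C_AbelianMonoid
    (fun k => RtoC (jacobi_entry omega (S n) (S k)) * x k)%C (S n).

(** ** Principal powers *)

Definition Cexp (z : C) : C := (exp (Re z) * cos (Im z), exp (Re z) * sin (Im z)).

(* Principal argument, in (-PI, PI], of a nonzero complex number. *)
Definition Carg (z : C) : R :=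
  if Rle_dec 0 (Im z) then acos (Re z / Cmod z) else - acos (Re z / Cmod z).

Definition Clog (z : C) : C := (ln (Cmod z), Carg z).

(* Only meaningful for [z <> 0]. *)
Definition Cpower (z : C) (s : R) : C := Cexp (RtoC s * Clog z)%C.

(** ** Extremal functions and the differential equation *)

Definition fstar (beta : R) (z : C) : C :=
  Cpower (1 - z / RtoC (sqrt (beta + 2)))%C (- (beta + 3)).

Definition t_ (beta : R) (m : nat) : R :=
  (2 * INR m + beta + 3) / sqrt ((INR m + 1) * (INR m + beta + 2)).

(* [f] is analytic in the unit disk and f'/f equals the given rational
   function wherever the latter is finite (at such points f'/f is required to
   be finite too, that is [f z <> 0]). *)
Definition solves_ode (beta t : R) (f : C -> C) : Prop :=
  (forall z : C, in_disk z -> @ex_derive C_AbsRing C_NormedModule f z) /\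
  (forall z : C, in_disk z -> (1 - RtoC t * z + z^2)%C <> 0%C ->
     f z <> 0%C /\
     (C_derive f z / f z)%C =
     ((RtoC t - RtoC (3 + beta) * z) / (1 - RtoC t * z + z^2))%C).

Definition f_ (beta : R) (m : nat) (z : C) : C :=
  ((1 - z * RtoC (sqrt (INR m + beta + 2)) / RtoC (sqrt (INR m + 1)))^m *
   Cpower (1 - z * RtoC (sqrt (INR m + 1)) / RtoC (sqrt (INR m + beta + 2)))
     (- INR m - (3 + beta)))%C.

(* Main.v *)
Require Import Defs.
From Stdlib Require Import Reals Arith Lra Lia Psatz Classical FunctionalExtensionality.
From Coquelicot Require Import Coquelicot.

(* Zeros.  If an optimal approximant [p] to [1/f] vanishes at [z0], write
   [p = (z - z0) q] and [g = q f].  Optimality against the perturbations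
   [((1 - e) z - z0) q] bounds [|z0|] from below by the reciprocal of the supremum
   of [|<g, z g>| / |z g|^2], which is half the norm of the Jacobi matrix; AM-GM with the Taylor coefficients of [fstar], a positive eigenvector,
   gives this norm, and [fstar] itself realises equality.

   Spectrum.  For [t = l + 1/l > 2] the eigenvector recurrence is the coefficient
   recurrence of [(1 - l z)^(-A) (1 - z/l)^B].  Its regular solution either grows
   geometrically, and then reduction of order produces a decaying solution and a
   bounded Green kernel inverting [J - t], or decays.  In the second case the
   differential equation at [z = l] shows that [1 - z/l] can be divided out, each
   time lowering [B] by one; this is impossible once [B < 0], so [B] is a natural
   number, which means that [t] is one of the [t_m]. *)

(** * Geometric sums and the Green kernel on l^2 *)

(** The two halves meet at m = 0: the extremal modulus is 2 / t_0, and [fstar] is the solution for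
    t_0. Multiplied by square roots of the weights, its coefficients form the eigenvector of the
    Jacobi matrix at t_0. The threshold 2 comes from the entries of J tending to 1: the eigenvector
    recurrence approaches x(n+2) = t x(n+1) - x(n), whose characteristic roots l and 1/l are real
    and distinct for t > 2. This is what forces either geometric growth or geometric decay. For a
    given l the exponents are not free: A = B + 3 + beta, and comparing the recurrences leaves l^2
    (B + beta + 2) = B + 1. A natural value B = m in this relation is the same as t = t_m. The
    obstacle in the decaying case is that B is real, so the local behaviour at z = l is that of (1 -
    z/l)^B. It is handled on coefficients only: a bounded solution must vanish at l when B is
    nonzero, its quotient by 1 - z/l again has bounded coefficients, and a negative B makes all
    coefficients positive, which excludes vanishing at l. *)

Lemma sum_n_SR (a : nat -> R) (n : nat) : sum_n a (S n) = sum_n a n + a (S n).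
Proof. now rewrite sum_Sn. Qed.

Lemma sum_n_ext_R (a b : nat -> R) (n : nat) :
  (forall k, a k = b k) -> sum_n a n = sum_n b n.
Proof. exact (sum_n_ext (G := R_AbelianMonoid) a b n). Qed.

Lemma sum_n_plus_R (a b : nat -> R) (n : nat) :
  sum_n (fun k => a k + b k) n = sum_n a n + sum_n b n.
Proof. exact (sum_n_plus (G := R_AbelianMonoid) a b n). Qed.

Lemma sum_n_scal_R (r : R) (a : nat -> R) (n : nat) :
  sum_n (fun k => r * a k) n = r * sum_n a n.
Proof. exact (sum_n_mult_l (K := R_Ring) r a n). Qed.

Lemma sum_n_le_R (a b : nat -> R) (n : nat) :
  (forall k, a k <= b k) -> sum_n a n <= sum_n b n.
Proof. intros H. now apply sum_n_m_le. Qed.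

Lemma sum_n_nonneg_le_Series (a : nat -> R) (N : nat) :
  (forall n, 0 <= a n) -> ex_series a -> sum_n a N <= Series a.
Proof.
  intros Ha Hex.
  assert (H := Series_correct a Hex).
  apply (is_lim_seq_incr_compare (sum_n a) (Series a)); [exact H|].
  intros n. rewrite sum_n_SR. specialize (Ha (S n)). lra.
Qed.

Lemma bounded_sums_ex_series (a : nat -> R) (M : R) :
  (forall n, 0 <= a n) -> (forall N, sum_n a N <= M) ->
  ex_series a /\ Series a <= M.
Proof.
  intros Ha HM.
  assert (Hex : ex_finite_lim_seq (sum_n a)).
  { apply ex_finite_lim_seq_incr with M; [|exact HM].
    intros n. rewrite sum_n_SR. specialize (Ha (S n)). lra. }
  destruct Hex as [l Hl].
  assert (Hs : is_series a l) by exact Hl.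
  split; [now exists l|].
  rewrite (is_series_unique a l Hs).
  apply (is_lim_seq_le (sum_n a) (fun _ => M) l M HM Hl).
  apply is_lim_seq_const.
Qed.

Lemma term_le_Series (a : nat -> R) (n : nat) :
  (forall n, 0 <= a n) -> ex_series a -> a n <= Series a.
Proof.
  intros Ha Hex.
  apply Rle_trans with (sum_n a n); [|now apply sum_n_nonneg_le_Series].
  destruct n; [rewrite sum_O; lra|]. rewrite sum_n_SR.
  assert (0 <= sum_n a n); [|lra].
  clear Hex. induction n; [rewrite sum_O; apply Ha|].
  rewrite sum_n_SR. specialize (Ha (S n)). lra.
Qed.

(* Convexity with weights [th] and [1 - th]. *)
Lemma sqr_combination_le (th p y : R) : 0 <= th < 1 ->
  (th * p + y) ^ 2 <= th * p ^ 2 + y ^ 2 / (1 - th).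
Proof.
  intros Hth.
  assert (E : th * p ^ 2 + y ^ 2 / (1 - th) - (th * p + y) ^ 2
    = th * ((1 - th) * p - y) ^ 2 / (1 - th)) by (field; lra).
  assert (0 <= th * ((1 - th) * p - y) ^ 2 / (1 - th)); [|lra].
  apply Rdiv_le_0_compat; [|lra]. apply Rmult_le_pos; [lra|apply pow2_ge_0].
Qed.

(** Convolution with a one-sided geometric kernel, sum over k <= n of th^(n-k) y k. The recursive
    form lets the l^2 estimate be an induction. *)
Fixpoint geom_past (th : R) (y : nat -> R) (n : nat) : R :=
  match n with
  | O => y O
  | S k => th * geom_past th y k + y (S k)
  end.

(** The mirror convolution over k > n. The diagonal term belongs to [geom_past], so the two together
    count it once. *)
Definition geom_future (th : R) (y : nat -> R) (n : nat) : R :=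
  Series (fun j => th ^ S j * y (n + S j)%nat).

Lemma geom_past_sum_sqr (th : R) (y : nat -> R) (N : nat) : 0 <= th < 1 ->
  (1 - th) * sum_n (fun n => geom_past th y n ^ 2) N
    <= sum_n (fun n => y n ^ 2) N / (1 - th).
Proof.
  intros Hth.
  (* The extra term on the left pays for the multiple of the last square that the convexity
     inequality produces at the next index. *)
  assert (H : (1 - th) * sum_n (fun n => geom_past th y n ^ 2) N
    + th * geom_past th y N ^ 2 <= sum_n (fun n => y n ^ 2) N / (1 - th)).
  { induction N as [|N IH].
    - rewrite !sum_O. simpl geom_past.
      assert (E : y 0%nat ^ 2 / (1 - th) - y 0%nat ^ 2 = th * y 0%nat ^ 2 / (1 - th))
        by (field; lra).
      assert (0 <= th * y 0%nat ^ 2 / (1 - th)); [|lra].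
      apply Rdiv_le_0_compat; [|lra]. apply Rmult_le_pos; [lra|apply pow2_ge_0].
    - rewrite !sum_n_SR.
      assert (H := sqr_combination_le th (geom_past th y N) (y (S N)) Hth).
      change (th * geom_past th y N + y (S N)) with (geom_past th y (S N)) in H.
      unfold Rdiv in *. rewrite Rmult_plus_distr_r. lra. }
  assert (0 <= th * geom_past th y N ^ 2).
  { apply Rmult_le_pos; [lra|apply pow2_ge_0]. }
  lra.
Qed.

Lemma Rabs_le_sqrt_Series (y : nat -> R) (n : nat) :
  ex_series (fun n => y n ^ 2) -> Rabs (y n) <= sqrt (Series (fun n => y n ^ 2)).
Proof.
  intros Hex. rewrite <- (sqrt_pow2 (Rabs (y n))) by apply Rabs_pos.
  apply sqrt_le_1_alt. rewrite pow2_abs.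
  apply (term_le_Series (fun n => y n ^ 2)); [|exact Hex].
  intros k; apply pow2_ge_0.
Qed.

Lemma ex_series_geom_bounded (th M : R) (y : nat -> R) (k : nat) : 0 <= th < 1 ->
  (forall n, Rabs (y n) <= M) -> ex_series (fun j => th ^ (j + k) * y j).
Proof.
  intros Hth HM.
  apply (@ex_series_le R_AbsRing R_CompleteNormedModule _ (fun j => M * th ^ j)).
  - intros j. change (norm (th ^ (j + k) * y j)) with (Rabs (th ^ (j + k) * y j)).
    rewrite Rabs_mult, (Rabs_pos_eq (th ^ _)) by (apply pow_le; lra).
    rewrite pow_add, Rmult_comm.
    assert (0 <= th ^ j) by (apply pow_le; lra).
    assert (0 <= th ^ k <= 1).
    { split; [apply pow_le; lra|]. rewrite <- (pow1 k). apply pow_incr. lra. }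
    apply Rmult_le_compat; try nra; [apply Rabs_pos|apply HM].
  - apply (ex_series_scal_l M (fun j => th ^ j)). apply ex_series_geom. rewrite Rabs_pos_eq; lra.
Qed.

(** The recursion runs towards smaller indices. Read with th = l, it later says that minus
    [geom_future] gives the coefficients of the quotient by 1 - z/l. *)
Lemma geom_future_rec (th M : R) (y : nat -> R) (n : nat) : 0 <= th < 1 ->
  (forall n, Rabs (y n) <= M) ->
  geom_future th y n = th * geom_future th y (S n) + th * y (S n).
Proof.
  intros Hth HM. unfold geom_future.
  assert (Hex : ex_series (fun j => th ^ S j * y (n + S j)%nat)).
  { eapply ex_series_ext;
      [|apply (ex_series_geom_bounded th M (fun j => y (n + S j)%nat) 1 Hth)].
    - intros j. cbv beta. now rewrite Nat.add_1_r.
    - intros j. apply HM. }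
  rewrite (Series_incr_1 _ Hex), <- Series_scal_l.
  rewrite Rplus_comm. f_equal.
  - apply Series_ext. intros j. replace (n + S (S j))%nat with (S n + S j)%nat by lia.
    simpl; ring.
  - rewrite Nat.add_1_r. ring.
Qed.

Lemma geom_future_abs (th M : R) (y : nat -> R) (n : nat) : 0 <= th < 1 ->
  (forall n, 0 <= y n <= M) -> 0 <= geom_future th y n <= M / (1 - th).
Proof.
  intros Hth HM. unfold geom_future.
  assert (Hg : is_series (fun j => M * th ^ j) (M / (1 - th))).
  { apply (is_series_scal_l M (fun j => th ^ j)). apply is_series_geom.
    rewrite Rabs_pos_eq; lra. }
  assert (Hb : forall j, 0 <= th ^ S j * y (n + S j)%nat <= M * th ^ j).
  { intros j. specialize (HM (n + S j)%nat).
    assert (0 <= th ^ j) by (apply pow_le; lra). simpl.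
    split; [apply Rmult_le_pos; [apply Rmult_le_pos|]; lra|].
    rewrite Rmult_assoc. rewrite (Rmult_comm M).
    assert (th ^ j * y (n + S j)%nat <= th ^ j * M) by (apply Rmult_le_compat_l; lra).
    assert (0 <= th ^ j * y (n + S j)%nat) by (apply Rmult_le_pos; lra). nra. }
  split.
  - rewrite <- (Rmult_0_l (Series (fun _ => 0))), <- Series_scal_l.
    apply Series_le; [intros k; rewrite Rmult_0_l; split; [lra|apply Hb]|].
    apply (ex_series_le (K := R_AbsRing) (V := R_CompleteNormedModule) _ (fun j => M * th ^ j)); [|eexists; apply Hg].
    intros j. change (Rabs (th ^ S j * y (n + S j)%nat) <= M * th ^ j).
    rewrite Rabs_pos_eq; apply Hb.
  - rewrite <- (is_series_unique _ _ Hg). apply Series_le; [exact Hb|]. eexists; apply Hg.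
Qed.

(** The same convexity argument as for the past sums, but it telescopes away from 0 and leaves a
    square at index N + 1. That square is controlled by the sup bound; it accounts for the factor 2
    and the extra power of 1 - th. *)
Lemma geom_future_sum_sqr (th : R) (y : nat -> R) (N : nat) : 0 <= th < 1 ->
  (forall n, 0 <= y n) -> ex_series (fun n => y n ^ 2) ->
  (1 - th) * sum_n (fun n => geom_future th y n ^ 2) N
    <= 2 * Series (fun n => y n ^ 2) / (1 - th) ^ 2.
Proof.
  intros Hth Hy Hex. set (Y := Series (fun n => y n ^ 2)).
  assert (HY : forall n, 0 <= y n <= sqrt Y).
  { intros n. split; [apply Hy|]. rewrite <- (Rabs_pos_eq (y n)) by apply Hy.
    now apply Rabs_le_sqrt_Series. }
  assert (HY' : forall n, Rabs (y n) <= sqrt Y).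
  { intros n. rewrite Rabs_pos_eq; apply HY. }
  assert (HY0 : 0 <= Y).
  { apply Rle_trans with (y 0%nat ^ 2); [apply pow2_ge_0|].
    apply (term_le_Series (fun n => y n ^ 2)); [intros; apply pow2_ge_0|exact Hex]. }
  assert (H : (1 - th) * sum_n (fun n => geom_future th y n ^ 2) N
    + y 0%nat ^ 2 / (1 - th)
    <= th * geom_future th y (S N) ^ 2 + sum_n (fun n => y n ^ 2) (S N) / (1 - th)).
  { assert (Hs : forall n, geom_future th y n ^ 2 <=
      th * geom_future th y (S n) ^ 2 + y (S n) ^ 2 / (1 - th)).
    { intros n. rewrite (geom_future_rec th (sqrt Y) y n Hth HY').
      eapply Rle_trans; [apply sqr_combination_le, Hth|].
      apply Rplus_le_compat_l. apply Rmult_le_compat_r.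
      - apply Rlt_le, Rinv_0_lt_compat. lra.
      - rewrite Rpow_mult_distr. assert (0 <= y (S n) ^ 2) by apply pow2_ge_0.
        assert (th ^ 2 <= 1) by nra. nra. }
    induction N as [|N IH].
    - rewrite sum_n_SR, !sum_O. specialize (Hs 0%nat).
      assert (0 <= th * geom_future th y 0 ^ 2) by (apply Rmult_le_pos; [lra|apply pow2_ge_0]).
      unfold Rdiv in *. lra.
    - rewrite (sum_n_SR (fun n => geom_future th y n ^ 2)), (sum_n_SR _ (S N)).
      specialize (Hs (S N)).
      unfold Rdiv in *. rewrite (Rmult_plus_distr_r (sum_n _ _)). lra. }
  assert (H1 : 0 <= y 0%nat ^ 2 / (1 - th)).
  { apply Rdiv_le_0_compat; [apply pow2_ge_0|lra]. }
  assert (H2 : sum_n (fun n => y n ^ 2) (S N) <= Y).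
  { apply sum_n_nonneg_le_Series; [intros; apply pow2_ge_0|exact Hex]. }
  assert (H3 := geom_future_abs th (sqrt Y) y (S N) Hth HY).
  assert (H4 : geom_future th y (S N) ^ 2 <= Y / (1 - th) ^ 2).
  { rewrite <- (pow2_sqrt Y) at 1 by exact HY0.
    replace (sqrt Y ^ 2 / (1 - th) ^ 2) with ((sqrt Y / (1 - th)) ^ 2) by (field; lra).
    apply pow_incr. exact H3. }
  assert (H5 : Y / (1 - th) <= Y / (1 - th) ^ 2).
  { apply Rmult_le_compat_l; [exact HY0|]. apply Rinv_le_contravar; [nra|nra]. }
  assert (H6 : sum_n (fun n => y n ^ 2) (S N) / (1 - th) <= Y / (1 - th)).
  { apply Rmult_le_compat_r; [apply Rlt_le, Rinv_0_lt_compat; lra|exact H2]. }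
  assert (0 <= geom_future th y (S N) ^ 2) by apply pow2_ge_0.
  replace (2 * Y / (1 - th) ^ 2) with (Y / (1 - th) ^ 2 + Y / (1 - th) ^ 2) by (field; lra).
  nra.
Qed.

(** * The tridiagonal operator and its Green kernel *)

Definition tri (c x : nat -> R) (n : nat) : R :=
  c n * x (S n) + match n with O => 0 | S m => c m * x m end.

(** The kernel is v(min(n,k)) u(max(n,k)), the usual inverse of J - t built from the solution [v]
    regular at 0 and the solution [u] decaying at infinity. *)
Definition green (u v y : nat -> R) (n : nat) : R :=
  u n * sum_n (fun k => v k * y k) n
  + v n * Series (fun j => u (S (n + j)) * y (S (n + j))).

(** Row 0 is imposed on [v] only; the Wronskian is normalised to 1. The decay is required of the
    product, since [v] may grow as fast as [u] decays. *)
Definition green_pair (c : nat -> R) (t K th : R) (u v : nat -> R) : Prop :=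
  0 <= th < 1 /\ v 0%nat = 1 /\
  (forall n, tri c v n = t * v n) /\
  (forall n, tri c u (S n) = t * u (S n)) /\
  (forall n, c n * (v n * u (S n) - u n * v (S n)) = 1) /\
  (forall n k, Rabs (v n * u (n + k)%nat) <= K * th ^ k).

Lemma l2_bounded (y : nat -> R) : ex_series (fun n => y n ^ 2) ->
  exists M, forall n, Rabs (y n) <= M.
Proof.
  intros Hy. eexists. intros n. now apply Rabs_le_sqrt_Series.
Qed.


(** The factor [v n] is kept inside because only the product with [u] is controlled. Taking n = 0,
    where [v] is 1, gives the tails of [u] alone. *)
Lemma green_summand_ex (c : nat -> R) (t K th : R) (u v y : nat -> R) (n m : nat) :
  green_pair c t K th u v -> ex_series (fun n => y n ^ 2) ->
  ex_series (fun j => Rabs (v n * (u (n + m + j)%nat * y (n + m + j)%nat))).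
Proof.
  intros (Hth & _ & _ & _ & _ & HK) Hy.
  destruct (l2_bounded y Hy) as [M HM].
  apply (@ex_series_le R_AbsRing R_CompleteNormedModule _ (fun j => K * (th ^ (j + m) * Rabs (y (n + m + j)%nat)))).
  - intros j.
    change (Rabs (Rabs (v n * (u (n + m + j)%nat * y (n + m + j)%nat)))
      <= K * (th ^ (j + m) * Rabs (y (n + m + j)%nat))).
    rewrite Rabs_Rabsolu.
    replace (v n * (u (n + m + j)%nat * y (n + m + j)%nat))
      with (v n * u (n + (m + j))%nat * y (n + m + j)%nat)
      by (rewrite Nat.add_assoc; ring).
    rewrite Rabs_mult, <- Rmult_assoc. apply Rmult_le_compat_r; [apply Rabs_pos|].
    rewrite (Nat.add_comm j m). apply HK.
  - apply (ex_series_scal_l K (fun j => th ^ (j + m) * Rabs (y (n + m + j)%nat))).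
    apply (ex_series_geom_bounded th M (fun j => Rabs (y (n + m + j)%nat))); [exact Hth|].
    intros j. rewrite Rabs_Rabsolu. apply HM.
Qed.

Lemma green_tail_ex (c : nat -> R) (t K th : R) (u v y : nat -> R) (n : nat) :
  green_pair c t K th u v -> ex_series (fun n => y n ^ 2) ->
  ex_series (fun j => u (n + j)%nat * y (n + j)%nat).
Proof.
  intros H Hy. assert (Hv : v 0%nat = 1) by apply H.
  apply ex_series_Rabs.
  eapply ex_series_ext; [|apply (green_summand_ex c t K th u v y 0 n H Hy)].
  intros j. cbv beta. now rewrite Hv, Rmult_1_l.
Qed.

Lemma green_plus (c : nat -> R) (t K th : R) (u v y z : nat -> R) (n : nat) :
  green_pair c t K th u v ->
  ex_series (fun n => y n ^ 2) -> ex_series (fun n => z n ^ 2) ->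
  green u v (fun k => y k + z k) n = green u v y n + green u v z n.
Proof.
  intros H Hy Hz. unfold green.
  assert (E1 : sum_n (fun k => v k * (y k + z k)) n
    = sum_n (fun k => v k * y k) n + sum_n (fun k => v k * z k) n).
  { rewrite <- sum_n_plus_R. apply sum_n_ext_R. intros k. ring. }
  assert (E2 : Series (fun j => u (S (n + j)) * (y (S (n + j)) + z (S (n + j))))
    = Series (fun j => u (S (n + j)) * y (S (n + j)))
      + Series (fun j => u (S (n + j)) * z (S (n + j)))).
  { rewrite <- Series_plus.
    - apply Series_ext. intros k. ring.
    - apply (green_tail_ex c t K th u v y (S n) H Hy).
    - apply (green_tail_ex c t K th u v z (S n) H Hz). }
  rewrite E1, E2. ring.
Qed.

Lemma green_scal (u v y : nat -> R) (a : R) (n : nat) :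
  green u v (fun k => a * y k) n = a * green u v y n.
Proof.
  unfold green.
  assert (E1 : sum_n (fun k => v k * (a * y k)) n = a * sum_n (fun k => v k * y k) n).
  { rewrite <- sum_n_scal_R. apply sum_n_ext_R. intros k. ring. }
  assert (E2 : Series (fun j => u (S (n + j)) * (a * y (S (n + j))))
    = a * Series (fun j => u (S (n + j)) * y (S (n + j)))).
  { rewrite <- Series_scal_l. apply Series_ext. intros k. ring. }
  rewrite E1, E2. ring.
Qed.

(** Moving from one index to the next transfers one term from the tail Q to the partial sum P. The
    homogeneous equations cancel P and Q, and the Wronskian is the coefficient left in front of
    [y n]. *)
Lemma green_solves (c : nat -> R) (t K th : R) (u v y : nat -> R) (n : nat) :
  green_pair c t K th u v -> ex_series (fun n => y n ^ 2) ->
  tri c (green u v y) n - t * green u v y n = y n.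
Proof.
  intros H Hy.
  set (P := fun n => sum_n (fun k => v k * y k) n).
  set (Q := fun n => Series (fun j => u (S (n + j)) * y (S (n + j)))).
  assert (HQ : forall n, Q n = u (S n) * y (S n) + Q (S n)).
  { intros k. unfold Q.
    rewrite (Series_incr_1 (fun j => u (S (k + j)) * y (S (k + j))))
      by apply (green_tail_ex c t K th u v y (S k) H Hy).
    rewrite !Nat.add_0_r. f_equal. apply Series_ext. intros j.
    now replace (k + S j)%nat with (S k + j)%nat by lia. }
  assert (HP : forall n, P (S n) = P n + v (S n) * y (S n)).
  { intros k. unfold P. now rewrite sum_n_SR. }
  destruct H as (_ & Hv0 & Hv & Hu & HW & _).
  assert (Hg : forall n, green u v y n = u n * P n + v n * Q n) by reflexivity.
  unfold tri. destruct n as [|n].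
  - rewrite !Hg, HP, (HQ 0%nat).
    specialize (Hv 0%nat). specialize (HW 0%nat). unfold tri in Hv.
    assert (HP0 : P 0%nat = y 0%nat).
    { unfold P. rewrite sum_O, Hv0. apply Rmult_1_l. }
    rewrite HP0. rewrite Hv0 in Hv, HW. rewrite Hv0.
    (* In row 0 the solution [u] misses the eigenvalue equation by exactly 1, by the Wronskian; this
       defect produces [y 0]. *)
    assert (E1 : c 0%nat * v 1%nat = t) by lra.
    assert (E2 : c 0%nat * u 1%nat = 1 + t * u 0%nat) by (rewrite <- E1; lra).
    transitivity (c 0%nat * u 1%nat * y 0%nat + (c 0%nat * v 1%nat) * (u 1%nat * y 1%nat + Q 1%nat) + 0 - t * (u 0%nat * y 0%nat + 1 * (u 1%nat * y 1%nat + Q 1%nat))); [ring|].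
    rewrite E1, E2. ring.
  - rewrite !Hg, !HP, (HQ n), (HQ (S n)).
    specialize (Hv (S n)). specialize (Hu n). specialize (HW n).
    unfold tri in Hv, Hu.
    transitivity ((c (S n) * u (S (S n)) + c n * u n) * P n
      + (c (S n) * v (S (S n)) + c n * v n) * (u (S (S n)) * y (S (S n)) + Q (S (S n)))
      - t * (u (S n) * (P n + v (S n) * y (S n)) + v (S n) * (u (S (S n)) * y (S (S n)) + Q (S (S n))))
      + c (S n) * u (S (S n)) * v (S n) * y (S n) + c n * v n * u (S n) * y (S n)); [ring|].
    rewrite Hu, Hv.
    assert (E : c (S n) * u (S (S n)) = t * u (S n) - c n * u n) by lra.
    rewrite E.
    transitivity (y (S n) * (c n * (v n * u (S n) - u n * v (S n)))); [ring|].
    rewrite HW. ring.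
Qed.

Lemma green_le (c : nat -> R) (t K th : R) (u v y : nat -> R) (n : nat) :
  green_pair c t K th u v -> ex_series (fun n => y n ^ 2) ->
  Rabs (green u v y n) <= K * (geom_past th (fun k => Rabs (y k)) n
    + geom_future th (fun k => Rabs (y k)) n).
Proof.
  intros H Hy. assert (H' := H). destruct H' as (Hth & Hv0 & _ & _ & _ & HK).
  destruct (l2_bounded y Hy) as [M HM].
  unfold green. eapply Rle_trans; [apply Rabs_triang|].
  rewrite Rmult_plus_distr_l. apply Rplus_le_compat.
  (* Stated with [u] at n + k: a step of the induction on n uses the previous bound with k + 1,
     which yields the factor th of [geom_past]. *)
  - assert (Hp : forall k, Rabs (u (n + k)%nat) * Rabs (sum_n (fun k => v k * y k) n)
      <= K * th ^ k * geom_past th (fun k => Rabs (y k)) n).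
    { induction n as [|n IH]; intros k.
      - rewrite sum_O. simpl geom_past. rewrite Hv0, Rmult_1_l.
        apply Rmult_le_compat_r; [apply Rabs_pos|].
        specialize (HK 0%nat k). now rewrite Hv0, Rmult_1_l in HK.
      - rewrite sum_n_SR.
        apply Rle_trans with (Rabs (u (n + S k)%nat) * Rabs (sum_n (fun k => v k * y k) n)
          + Rabs (v (S n) * u (S n + k)%nat) * Rabs (y (S n))).
        { replace (n + S k)%nat with (S n + k)%nat by lia.
          rewrite <- Rabs_mult, <- Rabs_mult, <- Rabs_mult.
          eapply Rle_trans; [|apply Rabs_triang]. apply Req_le. f_equal. ring. }
        assert (E1 := IH (S k)). assert (E2 := HK (S n) k).
        simpl geom_past. simpl pow in E1.
        assert (Rabs (v (S n) * u (S n + k)%nat) * Rabs (y (S n)) <= K * th ^ k * Rabs (y (S n))).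
        { apply Rmult_le_compat_r; [apply Rabs_pos|exact E2]. }
        lra. }
    specialize (Hp 0%nat). rewrite Nat.add_0_r, pow_O, Rmult_1_r in Hp.
    now rewrite Rabs_mult.
  - rewrite <- Series_scal_l. eapply Rle_trans; [apply Series_Rabs|].
    + eapply ex_series_ext; [|apply (green_summand_ex c t K th u v y n 1 H Hy)].
      intros j. cbv beta. now replace (n + 1 + j)%nat with (S (n + j)) by lia.
    + unfold geom_future. rewrite <- Series_scal_l. apply Series_le.
      * intros j. split; [apply Rabs_pos|].
        replace (S (n + j)) with (n + S j)%nat by lia.
        rewrite <- Rmult_assoc, Rabs_mult, <- Rmult_assoc.
        apply Rmult_le_compat_r; [apply Rabs_pos|apply HK].
      * apply (ex_series_scal_l K (fun j => th ^ S j * Rabs (y (n + S j)%nat))).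
        eapply ex_series_ext;
          [|apply (ex_series_geom_bounded th M (fun j => Rabs (y (n + S j)%nat)) 1 Hth)].
        -- intros j. cbv beta. now rewrite Nat.add_1_r.
        -- intros j. rewrite Rabs_Rabsolu. apply HM.
Qed.

Lemma green_bounded (c : nat -> R) (t K th : R) (u v : nat -> R) :
  green_pair c t K th u v ->
  exists B, 0 <= B /\ forall y, ex_series (fun n => y n ^ 2) ->
    ex_series (fun n => green u v y n ^ 2) /\
    Series (fun n => green u v y n ^ 2) <= B * Series (fun n => y n ^ 2).
Proof.
  intros H. assert (H' := H). destruct H' as (Hth & _).
  (* From (p + q)^2 <= 2 p^2 + 2 q^2 and the bounds 1 / (1 - th)^2 for the past and 2 / (1 - th)^3
     for the future. *)
  exists (2 * K ^ 2 * (/ (1 - th) ^ 2 + 2 / (1 - th) ^ 3)).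
  assert (HK2 : 0 <= 2 * K ^ 2) by (assert (H1 := pow2_ge_0 K); lra).
  split.
  { assert (0 < / (1 - th) ^ 2) by (apply Rinv_0_lt_compat, pow_lt; lra).
    assert (0 < 2 / (1 - th) ^ 3) by (apply Rdiv_lt_0_compat; [lra|apply pow_lt; lra]).
    apply Rmult_le_pos; lra. }
  intros y Hy. set (z := fun k => Rabs (y k)).
  assert (Hz : forall k, z k ^ 2 = y k ^ 2) by (intros; apply pow2_abs).
  assert (Hzs : ex_series (fun n => z n ^ 2)).
  { apply ex_series_ext with (2 := Hy). intros k. symmetry. apply Hz. }
  assert (HzS : Series (fun n => z n ^ 2) = Series (fun n => y n ^ 2)).
  { apply Series_ext, Hz. }
  apply bounded_sums_ex_series; [intros; apply pow2_ge_0|]. intros N.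
  apply Rle_trans with (2 * K ^ 2 * (sum_n (fun n => geom_past th z n ^ 2) N
    + sum_n (fun n => geom_future th z n ^ 2) N)).
  { rewrite <- sum_n_plus_R, <- sum_n_scal_R. apply sum_n_le_R. intros n.
    assert (E := green_le c t K th u v y n H Hy). fold z in E.
    rewrite <- pow2_abs.
    apply Rle_trans with ((K * (geom_past th z n + geom_future th z n)) ^ 2).
    - apply pow_incr. split; [apply Rabs_pos|exact E].
    - rewrite Rpow_mult_distr.
      assert (0 <= (geom_past th z n - geom_future th z n) ^ 2) by apply pow2_ge_0.
      assert (0 <= K ^ 2) by apply pow2_ge_0. nra. }
  rewrite (Rmult_assoc (2 * K ^ 2)). apply Rmult_le_compat_l; [exact HK2|].
  assert (E1 := geom_past_sum_sqr th z N Hth).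
  assert (E2 := geom_future_sum_sqr th z N Hth (fun k => Rabs_pos _) Hzs).
  rewrite HzS in E2.
  assert (E3 : sum_n (fun n => z n ^ 2) N <= Series (fun n => y n ^ 2)).
  { rewrite <- HzS. apply sum_n_nonneg_le_Series; [intros; apply pow2_ge_0|exact Hzs]. }
  set (Y := Series (fun n => y n ^ 2)) in *.
  rewrite Rmult_plus_distr_r. apply Rplus_le_compat.
  - apply Rmult_le_reg_l with (1 - th); [lra|].
    eapply Rle_trans; [exact E1|].
    apply Rle_trans with (Y / (1 - th)).
    + apply Rmult_le_compat_r; [apply Rlt_le, Rinv_0_lt_compat; lra|exact E3].
    + apply Req_le. field. lra.
  - apply Rmult_le_reg_l with (1 - th); [lra|].
    eapply Rle_trans; [exact E2|]. apply Req_le. field. lra.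
Qed.

(** * Three-term recurrences *)

Fixpoint three_term (c : nat -> R) (t x0 x1 : R) (n : nat) : R :=
  match n with
  | O => x0
  | S O => x1
  | S (S k as m) => (t * three_term c t x0 x1 m - c k * three_term c t x0 x1 k) / c m
  end.

(** The two initial values encode row 0 of the eigenvalue equation with first coordinate 1. *)
Definition regular_sol (c : nat -> R) (t : R) : nat -> R := three_term c t 1 (t / c 0%nat).

Lemma three_term_SS (c : nat -> R) (t x0 x1 : R) (n : nat) :
  three_term c t x0 x1 (S (S n))
  = (t * three_term c t x0 x1 (S n) - c n * three_term c t x0 x1 n) / c (S n).
Proof. reflexivity. Qed.

Lemma tri_three_term (c : nat -> R) (t x0 x1 : R) (n : nat) : (forall n, 0 < c n) ->
  tri c (three_term c t x0 x1) (S n) = t * three_term c t x0 x1 (S n).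
Proof.
  intros Hc. unfold tri. rewrite three_term_SS. field. apply Rgt_not_eq, Hc.
Qed.

Lemma tri_regular_sol (c : nat -> R) (t : R) (n : nat) : (forall n, 0 < c n) ->
  tri c (regular_sol c t) n = t * regular_sol c t n.
Proof.
  intros Hc. destruct n; [|now apply tri_three_term].
  unfold tri, regular_sol. simpl. field. apply Rgt_not_eq, Hc.
Qed.

Lemma tri_eigen_unique (c : nat -> R) (t : R) (x : nat -> R) (n : nat) :
  (forall n, 0 < c n) -> (forall n, tri c x n = t * x n) ->
  x n = x 0%nat * regular_sol c t n.
Proof.
  intros Hc Hx.
  assert (H : x n = x 0%nat * regular_sol c t n /\
    x (S n) = x 0%nat * regular_sol c t (S n)); [|apply H].
  induction n as [|n [IH1 IH2]].
  - specialize (Hx 0%nat). unfold tri in Hx. specialize (Hc 0%nat).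
    unfold regular_sol; simpl. split; [ring|].
    apply Rmult_eq_reg_l with (c 0%nat); [|lra].
    replace (c 0%nat * x 1%nat) with (t * x 0%nat) by lra. field. lra.
  - split; [exact IH2|].
    specialize (Hx (S n)). unfold tri in Hx.
    assert (Hc' := Hc (S n)).
    unfold regular_sol in *. rewrite three_term_SS.
    apply Rmult_eq_reg_l with (c (S n)); [|lra].
    replace (c (S n) * x (S (S n))) with (t * x (S n) - c n * x n) by lra.
    rewrite IH2, IH1. field. lra.
Qed.

Lemma wronskian_three_term (c : nat -> R) (t x0 x1 y0 y1 : R) (n : nat) :
  (forall n, 0 < c n) ->
  c n * (three_term c t x0 x1 n * three_term c t y0 y1 (S n)
    - three_term c t y0 y1 n * three_term c t x0 x1 (S n))
  = c 0%nat * (x0 * y1 - y0 * x1).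
Proof.
  intros Hc. induction n as [|n IH]; [reflexivity|].
  rewrite <- IH, !three_term_SS. field. apply Rgt_not_eq, Hc.
Qed.

Lemma bounded_initial (x : nat -> R) (M : nat) :
  exists D, 0 <= D /\ forall i, (i <= M)%nat -> Rabs (x i) <= D.
Proof.
  induction M as [|M (D & HD & IH)].
  - exists (Rabs (x 0%nat)). split; [apply Rabs_pos|]. intros i Hi.
    replace i with 0%nat by lia. lra.
  - exists (Rmax D (Rabs (x (S M)))). split.
    + eapply Rle_trans; [exact HD|apply Rmax_l].
    + intros i Hi. destruct (Nat.eq_dec i (S M)) as [->|Hne]; [apply Rmax_r|].
      eapply Rle_trans; [apply IH; lia|apply Rmax_l].
Qed.

Lemma pow_growth (C : R) (v : nat -> R) (M : nat) : 1 < C ->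
  (forall n, (M <= n)%nat -> C * Rabs (v n) <= Rabs (v (S n))) ->
  forall n k, (M <= n)%nat -> C ^ k * Rabs (v n) <= Rabs (v (n + k)%nat).
Proof.
  intros HC Hg n k Hn. induction k as [|k IH].
  - rewrite Nat.add_0_r. simpl. lra.
  - rewrite Nat.add_succ_r. eapply Rle_trans; [|apply Hg; lia].
    simpl. rewrite Rmult_assoc. apply Rmult_le_compat_l; lra.
Qed.

(* Reduction of order: if [v] grows geometrically, then
   [v n * sum_{k >= n} 1 / (c k * v k * v (k+1))] is a decaying solution. *)
Lemma green_pair_of_growth (c : nat -> R) (t C : R) (M : nat) :
  (forall n, 1 <= c n) -> 1 < C -> regular_sol c t M <> 0 ->
  (forall n, (M <= n)%nat ->
     C * Rabs (regular_sol c t n) <= Rabs (regular_sol c t (S n))) ->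
  exists K u, green_pair c t K (/ C) u (regular_sol c t).
Proof.
  intros Hc1 HC HvM Hg. set (v := regular_sol c t) in *.
  assert (Hc : forall n, 0 < c n) by (intros n; specialize (Hc1 n); lra).
  (* A second solution, with initial values that make its Wronskian with [v] equal to 1. *)
  set (p := three_term c t 0 (/ c 0%nat)).
  assert (HW : forall n, c n * (v n * p (S n) - p n * v (S n)) = 1).
  { intros n. unfold v, p, regular_sol. rewrite wronskian_three_term by exact Hc.
    field. apply Rgt_not_eq, Hc. }
  assert (Hgk := pow_growth C v M HC Hg).
  assert (Hth : 0 < / C < 1).
  { split; [apply Rinv_0_lt_compat; lra|]. rewrite <- Rinv_1.
    apply Rinv_lt_contravar; lra. }
  assert (HthC : forall k, (/ C) ^ k * C ^ k = 1).
  { intros k. rewrite <- Rpow_mult_distr, Rinv_l, pow1; lra. }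
  assert (Hpow : forall k, 0 < (/ C) ^ k) by (intros; apply pow_lt; lra).
  assert (Hgk' : forall n k, (M <= n)%nat ->
    Rabs (v n) <= (/ C) ^ k * Rabs (v (n + k)%nat)).
  { intros n k Hn. rewrite <- (Rmult_1_l (Rabs (v n))), <- (HthC k), Rmult_assoc.
    apply Rmult_le_compat_l; [apply Rlt_le, Hpow|]. now apply Hgk. }
  assert (Hv0 : forall n, (M <= n)%nat -> 0 < Rabs (v n)).
  { intros n Hn. replace n with (M + (n - M))%nat by lia.
    eapply Rlt_le_trans; [|apply Hgk; lia].
    apply Rmult_lt_0_compat; [apply pow_lt; lra|now apply Rabs_pos_lt]. }
  assert (Hv0' : forall n, (M <= n)%nat -> v n <> 0).
  { intros n Hn E. specialize (Hv0 n Hn). rewrite E, Rabs_R0 in Hv0. lra. }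
  (* By the Wronskian, [d n] is the increment of p / v from n to n + 1. *)
  set (d := fun n => / (c n * v n * v (S n))).
  assert (Hd : forall n j, (M <= n)%nat -> Rabs (d (n + j)%nat) <= / (v n ^ 2) * (/ C) ^ j).
  { intros n j Hn. unfold d.
    rewrite Rabs_inv, <- pow_inv, <- (pow2_abs (/ v n)), Rabs_inv.
    assert (H1 := Hv0 n Hn). assert (H2 := Hgk n j Hn). assert (H3 := Hg (n + j)%nat ltac:(lia)).
    assert (HCj : 1 <= C ^ j) by (apply pow_R1_Rle; lra).
    assert (H4 := Hc1 (n + j)%nat).
    rewrite !pow_inv, <- Rinv_mult. apply Rinv_le_contravar.
    - apply Rmult_lt_0_compat; apply pow_lt; lra.
    - rewrite !Rabs_mult, (Rabs_pos_eq (c _)) by lra.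
      set (a := Rabs (v n)) in *. set (b := Rabs (v (n + j)%nat)) in *.
      set (e := Rabs (v (S (n + j)))) in *.
      assert (a <= C ^ j * a) by nra. assert (a <= e) by nra.
      assert (a ^ 2 * C ^ j <= b * e) by nra.
      assert (0 <= b * e) by (apply Rmult_le_pos; apply Rabs_pos). nra. }
  assert (Hdex : forall n, (M <= n)%nat -> ex_series (fun j => d (n + j)%nat) /\
    Rabs (Series (fun j => d (n + j)%nat)) <= / (v n ^ 2) * / (1 - / C)).
  { intros n Hn.
    assert (Hgs : is_series (fun j => / (v n ^ 2) * (/ C) ^ j) (/ (v n ^ 2) * / (1 - / C))).
    { apply (is_series_scal_l (/ (v n ^ 2)) (fun j => (/ C) ^ j)), is_series_geom.
      rewrite Rabs_pos_eq; lra. }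
    assert (Hex : ex_series (fun j => Rabs (d (n + j)%nat))).
    { apply (@ex_series_le R_AbsRing R_CompleteNormedModule _
        (fun j => / (v n ^ 2) * (/ C) ^ j)); [|eexists; exact Hgs].
      intros j. change (Rabs (Rabs (d (n + j)%nat)) <= / (v n ^ 2) * (/ C) ^ j).
      rewrite Rabs_Rabsolu. now apply Hd. }
    split; [now apply ex_series_Rabs|].
    eapply Rle_trans; [apply Series_Rabs, Hex|].
    rewrite <- (is_series_unique _ _ Hgs).
    apply Series_le; [|eexists; exact Hgs]. intros j. split; [apply Rabs_pos|now apply Hd]. }
  (* This is the limit of p / v: a value plus the sum of all later increments, hence the same from
     every starting index. *)
  set (L := p M / v M + Series (fun j => d (M + j)%nat)).
  assert (HL : forall n, (M <= n)%nat -> L = p n / v n + Series (fun j => d (n + j)%nat)).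
  { intros n Hn. replace n with (M + (n - M))%nat by lia.
    induction (n - M)%nat as [|k IH].
    - now rewrite Nat.add_0_r.
    - rewrite IH. set (q := (M + k)%nat). replace (M + S k)%nat with (S q) by (unfold q; lia).
      assert (Hq : (M <= q)%nat) by (unfold q; lia).
      rewrite (Series_incr_1 (fun j => d (q + j)%nat)) by now apply Hdex.
      rewrite Nat.add_0_r, <- Rplus_assoc. f_equal.
      + assert (Hw := HW q). assert (Hq1 := Hv0' q Hq). assert (Hq2 := Hv0' (S q) ltac:(lia)).
        assert (Hcq := Hc q). unfold d.
        apply Rmult_eq_reg_l with (c q * v q * v (S q)).
        2:{ apply Rmult_integral_contrapositive; split; [|exact Hq2].
            apply Rmult_integral_contrapositive; split; [lra|exact Hq1]. }
        transitivity (c q * p q * v (S q) + 1); [field; repeat split; lra|].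
        transitivity (c q * v q * p (S q)); [lra|field; lra].
      + apply Series_ext. intros j. f_equal. lia. }
  (* Subtracting the limit removes the growing part: [u n] is minus [v n] times the tail of the
     increments. *)
  set (u := fun n => p n - L * v n).
  assert (Huv : forall n, (M <= n)%nat -> Rabs (v n * u n) <= / (1 - / C)).
  { intros n Hn. unfold u. rewrite (HL n Hn).
    replace (v n * (p n - (p n / v n + Series (fun j => d (n + j)%nat)) * v n))
      with (- (v n ^ 2 * Series (fun j => d (n + j)%nat))) by (field; now apply Hv0').
    assert (Hv2 : 0 < v n ^ 2) by (rewrite <- pow2_abs; apply pow_lt; now apply Hv0).
    rewrite Rabs_Ropp, Rabs_mult, (Rabs_pos_eq (v n ^ 2)) by lra.
    destruct (Hdex n Hn) as [_ HS].
    apply Rle_trans with (v n ^ 2 * (/ v n ^ 2 * / (1 - / C))).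
    - apply Rmult_le_compat_l; lra.
    - apply Req_le. field. assert (v n <> 0) by now apply Hv0'. split; lra. }
  destruct (bounded_initial v M) as (D & HD0 & HD).
  destruct (bounded_initial u M) as (U & HU0 & HU).
  assert (HCM : 1 <= C ^ M) by (apply pow_R1_Rle; lra).
  (* Growth is known only from M on. [D] bounds the values up to M and [C ^ M] makes up for the
     powers of C missing before M, so [B] makes the estimate uniform in the first index. *)
  set (B := D * C ^ M / Rabs (v M)).
  assert (HvMp := Hv0 M (Nat.le_refl M)).
  assert (HB1 : 1 <= B).
  { unfold B. apply Rmult_le_reg_r with (Rabs (v M)); [exact HvMp|].
    specialize (HD M (Nat.le_refl M)).
    replace (D * C ^ M / Rabs (v M) * Rabs (v M)) with (D * C ^ M) by (field; lra). nra. }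
  assert (HvB : forall n k, (M <= n + k)%nat ->
    Rabs (v n) <= B * (/ C) ^ k * Rabs (v (n + k)%nat)).
  { intros n k Hnk. destruct (le_lt_dec M n) as [Hn|Hn].
    - eapply Rle_trans; [apply (Hgk' n k Hn)|]. rewrite Rmult_assoc.
      assert (0 <= (/ C) ^ k * Rabs (v (n + k)%nat)).
      { apply Rmult_le_pos; [apply Rlt_le, Hpow|apply Rabs_pos]. }
      nra.
    - eapply Rle_trans; [apply HD; lia|].
      assert (H1 := Hgk' M (n + k - M)%nat (Nat.le_refl M)).
      replace (M + (n + k - M))%nat with (n + k)%nat in H1 by lia.
      assert (H2 : (/ C) ^ (n + k - M) <= C ^ M * (/ C) ^ k).
      { apply Rmult_le_reg_l with ((/ C) ^ M); [apply Hpow|].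
        rewrite <- pow_add, <- Rmult_assoc, HthC, Rmult_1_l.
        replace (M + (n + k - M))%nat with (n + k)%nat by lia.
        rewrite pow_add. rewrite <- (Rmult_1_l ((/ C) ^ k)) at 2.
        apply Rmult_le_compat_r; [apply Rlt_le, Hpow|].
        rewrite <- (pow1 n). apply pow_incr. lra. }
      unfold B.
      apply Rle_trans with (D / Rabs (v M) * ((/ C) ^ (n + k - M) * Rabs (v (n + k)%nat))).
      + apply Rle_trans with (D / Rabs (v M) * Rabs (v M)); [apply Req_le; field; lra|].
        apply Rmult_le_compat_l; [|exact H1]. apply Rdiv_le_0_compat; lra.
      + replace (D * C ^ M / Rabs (v M) * (/ C) ^ k * Rabs (v (n + k)%nat))
          with (D / Rabs (v M) * (C ^ M * (/ C) ^ k * Rabs (v (n + k)%nat))) by (field; lra).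
        apply Rmult_le_compat_l; [apply Rdiv_le_0_compat; lra|].
        apply Rmult_le_compat_r; [apply Rabs_pos|exact H2]. }
  (* The first summand serves the pairs with n + k >= M, the second the finitely many remaining
     ones. *)
  exists (B * / (1 - / C) + D * U * C ^ M), u.
  assert (HK1 : 0 <= B * / (1 - / C)).
  { apply Rmult_le_pos; [lra|]. apply Rlt_le, Rinv_0_lt_compat. lra. }
  assert (HK2 : 0 <= D * U * C ^ M) by (apply Rmult_le_pos; [apply Rmult_le_pos|]; lra).
  split; [lra|]. split; [reflexivity|].
  split; [intros n; now apply tri_regular_sol|].
  split.
  { intros n. assert (H1 := tri_three_term c t 0 (/ c 0%nat) n Hc).
    assert (H2 := tri_regular_sol c t (S n) Hc). fold p in H1. fold v in H2.
    unfold tri in *. unfold u.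
    transitivity (c (S n) * p (S (S n)) + c n * p n - L * (c (S n) * v (S (S n)) + c n * v n));
      [ring|]. rewrite H1, H2. ring. }
  split.
  { intros n. rewrite <- (HW n). unfold u. ring. }
  intros n k. rewrite Rabs_mult. specialize (Hpow k).
  destruct (le_lt_dec M (n + k)) as [Hn|Hn].
  - apply Rle_trans with (B * (/ C) ^ k * Rabs (v (n + k)%nat) * Rabs (u (n + k)%nat)).
    { apply Rmult_le_compat_r; [apply Rabs_pos|now apply HvB]. }
    rewrite Rmult_assoc, <- Rabs_mult.
    apply Rle_trans with (B * (/ C) ^ k * / (1 - / C)).
    { apply Rmult_le_compat_l; [|now apply Huv]. apply Rmult_le_pos; lra. }
    nra.
  - apply Rle_trans with (D * U).
    { apply Rmult_le_compat; try apply Rabs_pos; [apply HD|apply HU]; lia. }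
    apply Rle_trans with (D * U * C ^ M * (/ C) ^ k); [|nra].
    rewrite Rmult_assoc. rewrite <- (Rmult_1_r (D * U)) at 1.
    apply Rmult_le_compat_l; [now apply Rmult_le_pos|].
    replace M with (M - k + k)%nat by lia. rewrite pow_add.
    rewrite Rmult_assoc, (Rmult_comm (C ^ k)), HthC, Rmult_1_r.
    apply pow_R1_Rle. lra.
Qed.

(** Past N, a single step with |v n| <= |v (n+1)| gives C |v (n+2)| >= (t - C) |v (n+1)| >= C^2 |v
    (n+1)|, so growth by the factor C starts and perpetuates itself. If no such step occurs, |v|
    decreases, and the same estimate read in the other direction gives decay by the factor C. *)
Lemma growth_alternative (c : nat -> R) (t C : R) (N : nat) :
  (forall n, 1 <= c n) -> 1 < C -> C ^ 2 + C <= t ->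
  (forall n, (N <= n)%nat -> c n <= C) ->
  (exists M, regular_sol c t M <> 0 /\ forall n, (M <= n)%nat ->
     C * Rabs (regular_sol c t n) <= Rabs (regular_sol c t (S n))) \/
  (forall n, (N < n)%nat ->
     C * Rabs (regular_sol c t (S n)) <= Rabs (regular_sol c t n)).
Proof.
  intros Hc1 HC Ht HN. set (v := regular_sol c t).
  assert (Hc : forall n, 0 < c n) by (intros n; specialize (Hc1 n); lra).
  assert (Hrec : forall n, c (S n) * v (S (S n)) = t * v (S n) - c n * v n).
  { intros n. assert (H := tri_regular_sol c t (S n) Hc). unfold tri in H.
    fold v in H. lra. }
  destruct (classic (exists n, (N <= n)%nat /\ Rabs (v n) <= Rabs (v (S n)))) as [[n [Hn Hv]]|Hno].
  - left. exists (S n). split.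
    (* Two consecutive zeros of [v] would annihilate its Wronskian with the solution starting from 0
       and 1 / c 0, which equals 1. *)
    { intros E. assert (H := wronskian_three_term c t 1 (t / c 0%nat) 0 (/ c 0%nat) n Hc).
      change (three_term c t 1 (t / c 0%nat)) with v in H. fold v in E.
      rewrite E, Rabs_R0 in Hv.
      assert (E0 : v n = 0).
      { assert (H0 := Rabs_pos (v n)). destruct (Req_dec (v n) 0) as [|Hne]; [assumption|].
        apply Rabs_pos_lt in Hne. lra. }
      rewrite E, E0 in H. specialize (Hc 0%nat).
      rewrite Rmult_0_l, Rmult_0_r in H. field_simplify in H; lra. }
    assert (Hstep : forall k, (N <= k)%nat -> Rabs (v k) <= Rabs (v (S k)) ->
      C * Rabs (v (S k)) <= Rabs (v (S (S k)))).
    { intros k Hk Hvk. assert (Hk1 := HN k Hk). assert (Hk2 := HN (S k) ltac:(lia)).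
      assert (H1 : Rabs (c (S k) * v (S (S k))) = Rabs (t * v (S k) - c k * v k))
        by now rewrite Hrec.
      rewrite Rabs_mult, (Rabs_pos_eq (c (S k))) in H1 by (specialize (Hc (S k)); lra).
      assert (H2 := Rabs_triang_inv (t * v (S k)) (c k * v k)).
      rewrite !Rabs_mult, (Rabs_pos_eq t), (Rabs_pos_eq (c k)) in H2
        by (try (specialize (Hc k)); nra).
      assert (Hp := Rabs_pos (v k)). assert (Hp1 := Rabs_pos (v (S k))).
      assert (Hp2 := Rabs_pos (v (S (S k)))). assert (Hck := Hc k).
      set (a0 := Rabs (v k)) in *. set (a1 := Rabs (v (S k))) in *.
      set (a2 := Rabs (v (S (S k)))) in *.
      assert (c k * a0 <= C * a1) by nra.
      assert (c (S k) * a2 <= C * a2) by nra.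
      assert (C ^ 2 * a1 <= C * a2) by nra.
      apply Rmult_le_reg_l with C; [lra|]. nra. }
    intros m Hm. replace m with (S (n + (m - S n)))%nat by lia.
    induction (m - S n)%nat as [|j IH].
    + rewrite Nat.add_0_r. apply Hstep; [exact Hn|exact Hv].
    + apply Hstep; [lia|]. rewrite Nat.add_succ_r. fold v in IH.
      assert (0 <= Rabs (v (S (n + j)))) by apply Rabs_pos. nra.
  - right. intros n Hn. fold v.
    assert (Hlt : forall k, (N <= k)%nat -> Rabs (v (S k)) < Rabs (v k)).
    { intros k Hk. apply Rnot_le_lt. intros H. apply Hno. now exists k. }
    assert (H1 : Rabs (c n * v n) = Rabs (t * v (S n) - c (S n) * v (S (S n)))).
    { f_equal. rewrite Hrec. ring. }
    assert (Hk1 := HN n ltac:(lia)). assert (Hk2 := HN (S n) ltac:(lia)).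
    rewrite Rabs_mult, (Rabs_pos_eq (c n)) in H1 by (specialize (Hc n); lra).
    assert (H2 := Rabs_triang_inv (t * v (S n)) (c (S n) * v (S (S n)))).
    rewrite !Rabs_mult, (Rabs_pos_eq t), (Rabs_pos_eq (c (S n))) in H2
        by (try (specialize (Hc (S n))); nra).
    assert (H3 := Hlt (S n) ltac:(lia)).
    assert (Hp := Rabs_pos (v n)). assert (Hp1 := Rabs_pos (v (S n))).
    assert (Hp2 := Rabs_pos (v (S (S n)))). assert (Hcn := Hc (S n)).
    set (a0 := Rabs (v n)) in *. set (a1 := Rabs (v (S n))) in *.
    set (a2 := Rabs (v (S (S n)))) in *.
    assert (c n * a0 <= C * a0) by nra.
    assert (c (S n) * a2 <= C * a1) by nra.
    apply Rmult_le_reg_l with C; [lra|]. nra.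
Qed.

(** * The recurrence of a function with two singular points *)

Lemma is_lim_seq_INR_ratio (a b : R) :
  is_lim_seq (fun n => (INR n + a) / (INR n + b)) 1.
Proof.
  assert (Hinf : is_lim_seq (fun n => INR n + b) p_infty).
  { eapply is_lim_seq_plus; [apply is_lim_seq_INR|apply is_lim_seq_const|reflexivity]. }
  assert (Hinv : is_lim_seq (fun n => / (INR n + b)) 0).
  { apply (is_lim_seq_inv _ p_infty Hinf). discriminate. }
  assert (H : is_lim_seq (fun n => 1 + (a - b) * / (INR n + b)) (1 + (a - b) * 0)).
  { apply is_lim_seq_plus'; [apply is_lim_seq_const|].
    apply is_lim_seq_mult'; [apply is_lim_seq_const|exact Hinv]. }
  replace (1 + (a - b) * 0) with 1 in H by ring.
  apply is_lim_seq_ext_loc with (2 := H).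
  apply is_lim_seq_spec in Hinf. specialize (Hinf 0).
  destruct Hinf as [N HN]. exists N. intros n Hn. specialize (HN n Hn).
  field. lra.
Qed.

Lemma ex_series_of_ratio (x : nat -> R) (k : R) : k < 1 -> (forall n, 0 < x n) ->
  is_lim_seq (fun n => x (S n) / x n) k -> ex_series x.
Proof.
  intros Hk Hx Hl.
  apply ex_series_ext with (fun n => Rabs (x n)).
  { intros n. apply Rabs_pos_eq, Rlt_le, Hx. }
  apply ex_series_DAlembert with k; [exact Hk|intros n; apply Rgt_not_eq, Hx|].
  apply is_lim_seq_ext with (2 := Hl). intros n. symmetry. apply Rabs_pos_eq.
  apply Rlt_le, Rdiv_lt_0_compat; apply Hx.
Qed.

Lemma is_lim_seq_INR_pow (l : R) : 0 < l < 1 ->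
  is_lim_seq (fun n => INR (S n) * l ^ n) 0.
Proof.
  intros Hl. apply ex_series_lim_0. apply ex_series_of_ratio with l; [lra| |].
  - intros n. apply Rmult_lt_0_compat; [apply lt_0_INR; lia|apply pow_lt; lra].
  - assert (H := is_lim_seq_INR_ratio 2 1).
    apply (is_lim_seq_scal_l _ l) in H. simpl in H. rewrite Rmult_1_r in H.
    apply is_lim_seq_ext with (2 := H). intros n. rewrite !S_INR. simpl pow.
    assert (0 <= INR n) by apply pos_INR. assert (0 < l ^ n) by (apply pow_lt; lra).
    field. split; lra.
Qed.

(* Coefficient recurrence of [(1 - l z)^(-A) (1 - z / l)^B]. *)
Definition two_point_rec (A B l : R) (a : nat -> R) : Prop :=
  a 1%nat = (A * l - B / l) * a 0%nat /\
  forall n, (INR n + 2) * a (S (S n))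
    = ((l + / l) * (INR n + 1) + A * l - B / l) * a (S n) - (INR n + A - B) * a n.

(* The recurrence is summed against [l ^ n], i.e. the differential equation is
   evaluated at the singular point [l]. *)
Lemma two_point_rec_sum (A B l : R) (a : nat -> R) (N : nat) : 0 < l ->
  two_point_rec A B l a ->
  (INR N + 1) * l ^ N * a (S N) - INR N * l ^ S N * a N
  = B * (l - / l) * sum_n (fun n => a n * l ^ n) N + (A - B) * l ^ S N * a N.
Proof.
  intros Hl [H0 H]. induction N as [|N IH].
  - rewrite sum_O. simpl. rewrite H0. field. lra.
  - rewrite sum_n_SR, Rmult_plus_distr_l.
    assert (E : B * (l - / l) * sum_n (fun n => a n * l ^ n) N
      = (INR N + 1) * l ^ N * a (S N) - INR N * l ^ S N * a N - (A - B) * l ^ S N * a N) by lra.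
    rewrite E, S_INR. specialize (H N).
    replace (INR N + 1 + 1) with (INR N + 2) by ring.
    replace ((INR N + 2) * l ^ S N * a (S (S N))) with (l ^ S N * ((INR N + 2) * a (S (S N)))) by ring.
    rewrite H. simpl. field. lra.
Qed.

(** Bounded coefficients make the boundary terms of [two_point_rec_sum] tend to 0, since n l^n does;
    B and l - 1/l are nonzero, so the power series vanishes at l. *)
Lemma two_point_rec_sum_zero (A B l M : R) (a : nat -> R) : 0 < l < 1 -> B <> 0 ->
  two_point_rec A B l a -> (forall n, Rabs (a n) <= M) ->
  Series (fun n => a n * l ^ n) = 0.
Proof.
  intros Hl HB Ha HM.
  assert (Hex : ex_series (fun n => a n * l ^ n)).
  { eapply ex_series_ext; [|apply (ex_series_geom_bounded l M a 0); [lra|exact HM]].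
    intros n. cbv beta. rewrite Nat.add_0_r. apply Rmult_comm. }
  assert (Hlim := Series_correct _ Hex).
  assert (Hp := is_lim_seq_INR_pow l Hl).
  assert (Hm : forall b : nat -> R, (forall n, Rabs (b n) <= M) ->
    is_lim_seq (fun n => INR (S n) * l ^ n * b n) 0).
  { intros b Hb. apply is_lim_seq_abs_0.
    apply is_lim_seq_le_le with (fun _ => 0) (fun n => M * (INR (S n) * l ^ n)).
    - intros n. split; [apply Rabs_pos|]. rewrite Rabs_mult, Rmult_comm.
      assert (0 <= INR (S n) * l ^ n).
      { apply Rmult_le_pos; [apply pos_INR|apply pow_le; lra]. }
      rewrite (Rabs_pos_eq (INR _ * _)) by assumption.
      apply Rmult_le_compat_r; [assumption|apply Hb].
    - apply is_lim_seq_const.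
    - apply (is_lim_seq_scal_l _ M) in Hp. simpl in Hp. now rewrite Rmult_0_r in Hp. }
  assert (H1 := Hm (fun n => a (S n)) (fun n => HM (S n))).
  assert (H2 := Hm a HM).
  assert (H3 : is_lim_seq (fun n => a n * l ^ n) 0) by now apply ex_series_lim_0.
  (* The boundary terms gathered on one side; their limit is computed once from boundedness and once
     from the summed recurrence. *)
  set (f := fun n => (INR n + 1) * l ^ n * a (S n) - INR n * l ^ S n * a n
    - (A - B) * l ^ S n * a n).
  assert (Hf0 : is_lim_seq f 0).
  { apply is_lim_seq_ext with (fun n => INR (S n) * l ^ n * a (S n)
      - l * (INR (S n) * l ^ n * a n) + (l * (1 - (A - B))) * (a n * l ^ n)).
    - intros n. unfold f. rewrite S_INR. simpl. ring.
    - replace 0 with (0 - l * 0 + (l * (1 - (A - B))) * 0) by ring.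
      apply is_lim_seq_plus'; [apply is_lim_seq_minus'; [exact H1|]|].
      + apply is_lim_seq_mult'; [apply is_lim_seq_const|exact H2].
      + apply is_lim_seq_mult'; [apply is_lim_seq_const|exact H3]. }
  assert (Hf1 : is_lim_seq f (B * (l - / l) * Series (fun n => a n * l ^ n))).
  { apply is_lim_seq_ext with (fun N => B * (l - / l) * sum_n (fun n => a n * l ^ n) N).
    - intros n. unfold f. rewrite (two_point_rec_sum A B l a n); [ring|lra|exact Ha].
    - apply is_lim_seq_mult'; [apply is_lim_seq_const|exact Hlim]. }
  assert (E : B * (l - / l) * Series (fun n => a n * l ^ n) = 0).
  { apply is_lim_seq_unique in Hf0. apply is_lim_seq_unique in Hf1.
    rewrite Hf0 in Hf1. now injection Hf1. }
  apply Rmult_integral in E. destruct E as [E|E]; [|exact E].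
  apply Rmult_integral in E. destruct E as [E|E]; [contradiction|].
  assert (1 < / l) by (rewrite <- Rinv_1; apply Rinv_lt_contravar; lra). lra.
Qed.

Lemma geom_future_Rabs_le (th M : R) (y : nat -> R) (n : nat) : 0 <= th < 1 ->
  (forall n, Rabs (y n) <= M) -> Rabs (geom_future th y n) <= M / (1 - th).
Proof.
  intros Hth HM.
  apply Rle_trans with (geom_future th (fun k => Rabs (y k)) n).
  - unfold geom_future. eapply Rle_trans; [apply Series_Rabs|].
    + apply ex_series_ext with (fun j => th ^ (j + 1) * Rabs (y (n + S j)%nat)).
      { intros j. rewrite Nat.add_1_r, Rabs_mult, (Rabs_pos_eq (th ^ _)); [easy|apply pow_le; lra]. }
      apply (ex_series_geom_bounded th M (fun j => Rabs (y (n + S j)%nat))); [exact Hth|].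
      intros j. rewrite Rabs_Rabsolu. apply HM.
    + apply Req_le, Series_ext. intros j.
      rewrite Rabs_mult, (Rabs_pos_eq (th ^ _)); [easy|apply pow_le; lra].
  - apply geom_future_abs; [exact Hth|]. intros k. split; [apply Rabs_pos|apply HM].
Qed.

(** With a = (1 - z/l) b, the residuals of the two recurrences are related by the same factor: the
    residual of [a] at n + 1 is that of [b] at n + 1 minus 1/l times that of [b] at n. They vanish
    one after the other. *)
Lemma two_point_rec_of_factor (A B l : R) (a b : nat -> R) : 0 < l ->
  a 0%nat = b 0%nat -> (forall n, a (S n) = b (S n) - b n / l) ->
  two_point_rec A (B + 1) l a -> two_point_rec A B l b.
Proof.
  intros Hl H0 HS [Ha0 Ha].
  assert (Hb0 : b 1%nat = (A * l - B / l) * b 0%nat).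
  { rewrite HS, H0 in Ha0.
    replace (b 1%nat) with (b 1%nat - b 0%nat / l + b 0%nat / l) by ring.
    rewrite Ha0. field. lra. }
  split; [exact Hb0|].
  intros n. apply Rminus_diag_uniq.
  induction n as [|n IH].
  - specialize (Ha 0%nat). rewrite !HS, H0 in Ha.
    apply Rminus_diag_eq in Ha. rewrite <- Ha, Hb0. simpl. field. lra.
  - specialize (Ha (S n)). rewrite !HS in Ha.
    apply Rminus_diag_eq in Ha.
    replace 0 with (0 + 0 / l) by (field; lra).
    rewrite <- IH at 2; rewrite <- Ha, S_INR. field. lra.
Qed.

Lemma two_point_rec_mul_factor (A B l : R) (a b : nat -> R) : 0 < l ->
  a 0%nat = b 0%nat -> (forall n, a (S n) = b (S n) - b n / l) ->
  two_point_rec A B l b -> two_point_rec A (B + 1) l a.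
Proof.
  intros Hl H0 HS [Hb0 Hb]. split.
  - rewrite HS, H0, Hb0. field. lra.
  - intros n. apply Rminus_diag_uniq. destruct n as [|n].
    + rewrite !HS, H0. assert (Hb' := Hb 0%nat). apply Rminus_diag_eq in Hb'.
      replace 0 with (0 + 0 / l) by (field; lra).
      rewrite <- Hb' at 1. rewrite Hb0. simpl. field. lra.
    + rewrite !HS. assert (H1 := Hb n). assert (H2 := Hb (S n)).
      apply Rminus_diag_eq in H1. apply Rminus_diag_eq in H2.
      replace 0 with (0 - 0 / l) by (field; lra).
      rewrite <- H2 at 1. rewrite <- H1. rewrite S_INR. field. lra.
Qed.

(** For B < 0 the factor (1 - z/l)^B has positive coefficients too. The induction carries a ratio
    bound: consecutive coefficients grow at least as fast as those of (1 - l z)^(-A), for which it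
    is an equality. *)
Lemma two_point_rec_pos (A B l : R) (a : nat -> R) (n : nat) : 0 < l < 1 -> B < 0 -> 1 <= A ->
  two_point_rec A B l a -> a 0%nat = 1 -> 0 < a n.
Proof.
  intros Hl HB HA [H0 H] Ha0.
  assert (Hli : 0 < / l) by (apply Rinv_0_lt_compat; lra).
  assert (Hn : 0 < a n /\ l * (INR n + A) * a n <= (INR n + 1) * a (S n)); [|apply Hn].
  induction n as [|n [IH1 IH2]].
  - rewrite Ha0 in *. rewrite H0. simpl. split; [lra|]. unfold Rdiv. nra.
  - assert (Hn0 := pos_INR n).
    assert (HaS : 0 < a (S n)).
    { apply Rmult_lt_reg_l with (INR n + 1); [lra|]. rewrite Rmult_0_r.
      eapply Rlt_le_trans; [|exact IH2]. apply Rmult_lt_0_compat; [|exact IH1].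
      apply Rmult_lt_0_compat; lra. }
    split; [exact HaS|].
    rewrite S_INR. replace (INR n + 1 + 1) with (INR n + 2) by ring. rewrite H.
    assert (Hk : (INR n + A - B) * a n <= (INR n + 1 - B) * (/ l * a (S n))).
    { apply Rmult_le_reg_l with (l * (INR n + A)); [apply Rmult_lt_0_compat; lra|].
      apply Rle_trans with ((INR n + A - B) * ((INR n + 1) * a (S n))).
      - replace (l * (INR n + A) * ((INR n + A - B) * a n))
          with ((INR n + A - B) * (l * (INR n + A) * a n)) by ring.
        apply Rmult_le_compat_l; lra.
      - replace (l * (INR n + A) * ((INR n + 1 - B) * (/ l * a (S n))))
          with ((INR n + A) * (INR n + 1 - B) * a (S n)) by (field; lra).
        (* The remaining polynomial inequality has difference - B (A - 1), nonnegative because B < 0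
           and A >= 1. *)
        rewrite <- Rmult_assoc. apply Rmult_le_compat_r; [lra|]. nra. }
    unfold Rdiv in *. lra.
Qed.

(** Since B is real, the induction is on an integer bound for B. A stays fixed under division, while
    the bound M and the sequence change and so are quantified inside. *)
Lemma two_point_rec_bounded_exponent (A l : R) (k : nat) : 0 < l < 1 -> 1 <= A ->
  forall B M a, B < INR k -> two_point_rec A B l a -> a 0%nat = 1 ->
  (forall n, Rabs (a n) <= M) -> exists m : nat, B = INR m.
Proof.
  intros Hl HA. induction k as [|k IH]; intros B M a HB Ha Ha0 HM.
  - exfalso. simpl in HB.
    assert (E := two_point_rec_sum_zero A B l M a Hl ltac:(lra) Ha HM).
    assert (Hex : ex_series (fun n => a n * l ^ n)).
    { eapply ex_series_ext; [|apply (ex_series_geom_bounded l M a 0); [lra|exact HM]].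
      intros n. cbv beta. rewrite Nat.add_0_r. apply Rmult_comm. }
    assert (H : a 0%nat * l ^ 0 <= Series (fun n => a n * l ^ n)).
    { apply (term_le_Series (fun n => a n * l ^ n)); [|exact Hex]. intros n.
      apply Rmult_le_pos; [|apply pow_le; lra]. apply Rlt_le.
      now apply (two_point_rec_pos A B l). }
    rewrite E, Ha0 in H. simpl in H. lra.
  - destruct (Req_dec B 0) as [->|HB0]; [now exists 0%nat|].
    assert (E := two_point_rec_sum_zero A B l M a Hl HB0 Ha HM).
    assert (Hex : ex_series (fun n => a n * l ^ n)).
    { eapply ex_series_ext; [|apply (ex_series_geom_bounded l M a 0); [lra|exact HM]].
      intros n. cbv beta. rewrite Nat.add_0_r. apply Rmult_comm. }
    (* The quotient by 1 - z/l, written through tails. Vanishing at l makes the tail form start at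
       [a 0], and this form shows that the quotient is bounded. *)
    set (b := fun n => - geom_future l a n).
    assert (Hb0 : a 0%nat = b 0%nat).
    { rewrite (Series_incr_1 _ Hex), pow_O, Rmult_1_r in E. unfold b, geom_future.
      rewrite (Series_ext _ (fun k => a (S k) * l ^ S k)); [lra|].
      intros n. rewrite Nat.add_0_l. apply Rmult_comm. }
    assert (HbS : forall n, a (S n) = b (S n) - b n / l).
    { intros n. unfold b. rewrite (geom_future_rec l M a n); [field; lra|lra|exact HM]. }
    destruct (IH (B - 1) (M / (1 - l)) b) as [m Hm].
    + rewrite S_INR in HB. lra.
    + apply two_point_rec_of_factor with a; [lra|exact Hb0|exact HbS|].
      now replace (B - 1 + 1) with B by ring.
    + now rewrite <- Hb0.
    + intros n. unfold b. rewrite Rabs_Ropp. apply geom_future_Rabs_le; [lra|exact HM].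
    + exists (S m). rewrite S_INR. lra.
Qed.

(** * The Jacobi matrix of the Bergman weights *)

Lemma gbinom_pos (beta : R) (n : nat) : -1 < beta -> 0 < gbinom beta n.
Proof.
  intros Hb. induction n as [|n IH]; [simpl; lra|].
  change (0 < gbinom beta n * ((beta + 1 + INR (S n)) / INR (S n))).
  assert (0 < INR (S n)) by (apply lt_0_INR; lia).
  apply Rmult_lt_0_compat; [exact IH|]. apply Rdiv_lt_0_compat; lra.
Qed.

Lemma bergman_pos (beta : R) (n : nat) : -1 < beta -> 0 < bergman beta n.
Proof. intros Hb. now apply Rinv_0_lt_compat, gbinom_pos. Qed.

Lemma bergman_S (beta : R) (n : nat) : -1 < beta ->
  bergman beta (S n) = bergman beta n * ((INR n + 1) / (INR n + beta + 2)).
Proof.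
  intros Hb. unfold bergman.
  change (gbinom beta (S n)) with (gbinom beta n * ((beta + 1 + INR (S n)) / INR (S n))).
  assert (Hg := gbinom_pos beta n Hb). assert (Hn := pos_INR n).
  rewrite S_INR. field. repeat split; lra.
Qed.

Lemma bergman_0 (beta : R) : bergman beta 0 = 1.
Proof. unfold bergman. simpl. lra. Qed.

Lemma bergman_S_le (beta : R) (n : nat) : -1 < beta -> bergman beta (S n) <= bergman beta n.
Proof.
  intros Hb. rewrite bergman_S by exact Hb. assert (Hn := pos_INR n).
  rewrite <- (Rmult_1_r (bergman beta n)) at 2.
  apply Rmult_le_compat_l; [now apply Rlt_le, bergman_pos|].
  apply Rmult_le_reg_r with (INR n + beta + 2); [lra|].
  unfold Rdiv. rewrite Rmult_assoc, Rinv_l; lra.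
Qed.

Lemma bergman_le_1 (beta : R) (n : nat) : -1 < beta -> bergman beta n <= 1.
Proof.
  intros Hb. induction n as [|n IH]; [rewrite bergman_0; lra|].
  eapply Rle_trans; [now apply bergman_S_le|exact IH].
Qed.

(** The entry linking coordinates n and n + 1, that is matrix indices n + 1 and n + 2, with the
    ratio of weights in closed form. *)
Definition jacobi_weight (beta : R) (n : nat) : R := sqrt ((INR n + beta + 3) / (INR n + 2)).

Lemma jacobi_weight_sqr (beta : R) (n : nat) : -1 < beta ->
  jacobi_weight beta n ^ 2 = (INR n + beta + 3) / (INR n + 2).
Proof.
  intros Hb. unfold jacobi_weight. apply pow2_sqrt. assert (Hn := pos_INR n).
  apply Rlt_le, Rdiv_lt_0_compat; lra.
Qed.

Lemma jacobi_weight_ge_1 (beta : R) (n : nat) : -1 < beta -> 1 <= jacobi_weight beta n.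
Proof.
  intros Hb. unfold jacobi_weight. rewrite <- sqrt_1 at 1. apply sqrt_le_1_alt.
  assert (Hn := pos_INR n). apply Rmult_le_reg_r with (INR n + 2); [lra|].
  unfold Rdiv. rewrite Rmult_assoc, Rinv_l; lra.
Qed.

Lemma bergman_ratio (beta : R) (n : nat) : -1 < beta ->
  bergman beta (S n) / bergman beta (S (S n)) = (INR n + beta + 3) / (INR n + 2).
Proof.
  intros Hb. rewrite (bergman_S beta (S n) Hb), S_INR.
  assert (Hp := bergman_pos beta (S n) Hb). assert (Hn := pos_INR n).
  field. repeat split; lra.
Qed.

Lemma jacobi_weight_sqrt (beta : R) (n : nat) : -1 < beta ->
  jacobi_weight beta n * sqrt (bergman beta (S (S n))) = sqrt (bergman beta (S n)).
Proof.
  intros Hb. unfold jacobi_weight. rewrite <- bergman_ratio by exact Hb.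
  assert (H1 := bergman_pos beta (S n) Hb). assert (H2 := bergman_pos beta (S (S n)) Hb).
  rewrite <- sqrt_mult.
  - f_equal. field. lra.
  - apply Rlt_le. now apply Rdiv_lt_0_compat.
  - lra.
Qed.

Lemma sum_n_C_zero (f : nat -> C) (n : nat) :
  (forall k, (k <= n)%nat -> f k = RtoC 0) -> @sum_n C_AbelianMonoid f n = RtoC 0.
Proof.
  intros Hf. induction n as [|n IH].
  - rewrite sum_O. apply Hf. lia.
  - rewrite sum_Sn, IH, Hf by (intros; try apply Hf; lia). apply Cplus_0_l.
Qed.

Lemma jacobi_eq (beta : R) (x : nat -> C) (n : nat) : -1 < beta ->
  jacobi (bergman beta) x n =
  (RtoC (jacobi_weight beta n) * x (S n)
   + match n with O => 0 | S m => RtoC (jacobi_weight beta m) * x m end)%C.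
Proof.
  intros Hb. unfold jacobi.
  assert (Hup : forall m, jacobi_entry (bergman beta) (S m) (S (S m)) = jacobi_weight beta m).
  { intros m. unfold jacobi_entry. rewrite Nat.eqb_refl. unfold jacobi_weight.
    now rewrite bergman_ratio. }
  assert (Hdown : forall m, jacobi_entry (bergman beta) (S (S m)) (S m) = jacobi_weight beta m).
  { intros m. unfold jacobi_entry. rewrite (proj2 (Nat.eqb_neq (S m) (S (S (S m))))) by lia.
    rewrite Nat.eqb_refl. unfold jacobi_weight. now rewrite bergman_ratio. }
  assert (Hz : forall i j, j <> S i -> i <> S j -> jacobi_entry (bergman beta) i j = 0).
  { intros i j H1 H2. unfold jacobi_entry.
    now rewrite (proj2 (Nat.eqb_neq _ _) H1), (proj2 (Nat.eqb_neq _ _) H2). }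
  destruct n as [|n].
  - rewrite sum_Sn, sum_O, Hup, Hz by lia. rewrite Cmult_0_l, Cplus_0_r. apply Cplus_0_l.
  - rewrite sum_Sn, sum_Sn, Hup. rewrite (Hz (S (S n)) (S (S n))) by lia.
    assert (E : @sum_n C_AbelianMonoid
      (fun k => RtoC (jacobi_entry (bergman beta) (S (S n)) (S k)) * x k)%C n
      = (RtoC (jacobi_weight beta n) * x n)%C).
    { destruct n as [|n]; [now rewrite sum_O, Hdown|].
      rewrite sum_Sn, sum_n_C_zero, Hdown.
      - apply Cplus_0_l.
      - intros k Hk. rewrite Hz by lia. apply Cmult_0_l. }
    rewrite E.
    change (RtoC (jacobi_weight beta n) * x n + RtoC 0 * x (S n)
      + RtoC (jacobi_weight beta (S n)) * x (S (S n))
      = RtoC (jacobi_weight beta (S n)) * x (S (S n)) + RtoC (jacobi_weight beta n) * x n)%C.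
    ring.
Qed.

Lemma Re_jacobi (beta : R) (x : nat -> C) (n : nat) : -1 < beta ->
  Re (jacobi (bergman beta) x n) = tri (jacobi_weight beta) (fun k => Re (x k)) n.
Proof.
  intros Hb. rewrite jacobi_eq by exact Hb. unfold tri, Re, Im. destruct n; cbn -[jacobi_weight INR]; ring.
Qed.

Lemma Im_jacobi (beta : R) (x : nat -> C) (n : nat) : -1 < beta ->
  Im (jacobi (bergman beta) x n) = tri (jacobi_weight beta) (fun k => Im (x k)) n.
Proof.
  intros Hb. rewrite jacobi_eq by exact Hb. unfold tri, Re, Im. destruct n; cbn -[jacobi_weight INR]; ring.
Qed.

(* In the coordinates [v n = a n * sqrt (w (n+1))] the eigenvalue equation of the
   Jacobi matrix is the coefficient recurrence of the differential equation. *)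
Lemma tri_weighted (beta : R) (a : nat -> R) (n : nat) : -1 < beta ->
  tri (jacobi_weight beta) (fun k => a k * sqrt (bergman beta (S k))) n
  = sqrt (bergman beta (S n)) *
    (a (S n) + match n with O => 0 | S m => (INR m + beta + 3) / (INR m + 2) * a m end).
Proof.
  intros Hb. unfold tri.
  replace (jacobi_weight beta n * (a (S n) * sqrt (bergman beta (S (S n)))))
    with (a (S n) * (jacobi_weight beta n * sqrt (bergman beta (S (S n))))) by ring.
  rewrite jacobi_weight_sqrt by exact Hb.
  destruct n as [|m]; [ring|].
  rewrite <- (jacobi_weight_sqrt beta m Hb), <- jacobi_weight_sqr by exact Hb. ring.
Qed.

(** With A = B + 3 + beta one has A - B = beta + 3, the coefficient found in the matrix. What
    remains is A l - B/l = l + 1/l, which is the hypothesis on l and B multiplied out. *)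
Lemma tri_eigen_iff (beta l B : R) (a : nat -> R) : -1 < beta -> 0 < l ->
  l ^ 2 * (B + beta + 2) = B + 1 ->
  (forall n, tri (jacobi_weight beta) (fun k => a k * sqrt (bergman beta (S k))) n
    = (l + / l) * (a n * sqrt (bergman beta (S n)))) <->
  two_point_rec (B + 3 + beta) B l a.
Proof.
  intros Hb Hl HB.
  assert (Ht : (B + 3 + beta) * l - B / l = l + / l).
  { apply Rmult_eq_reg_l with l; [|lra]. field_simplify; [|lra..]. nra. }
  assert (Hs : forall n, 0 < sqrt (bergman beta n)).
  { intros n. now apply sqrt_lt_R0, bergman_pos. }
  split.
  - intros H. split.
    + specialize (H 0%nat). rewrite (tri_weighted beta) in H by exact Hb.
      rewrite Ht. apply Rmult_eq_reg_l with (sqrt (bergman beta 1)); [|apply Rgt_not_eq, Hs].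
      lra.
    + intros n. specialize (H (S n)). rewrite (tri_weighted beta) in H by exact Hb.
      assert (Hn := pos_INR n).
      apply Rmult_eq_reg_l with (sqrt (bergman beta (S (S n)))); [|apply Rgt_not_eq, Hs].
      replace ((l + / l) * (INR n + 1) + (B + 3 + beta) * l - B / l)
        with ((l + / l) * (INR n + 2)) by lra.
      transitivity ((INR n + 2) * (sqrt (bergman beta (S (S n))) *
       (a (S (S n)) + (INR n + beta + 3) / (INR n + 2) * a n))
        - (INR n + beta + 3) * a n * sqrt (bergman beta (S (S n)))); [field; lra|].
      rewrite H. ring.
  - intros [H0 H] n. rewrite (tri_weighted beta) by exact Hb.
    destruct n as [|n]; [rewrite H0, Ht; ring|].
    specialize (H n). assert (Hn := pos_INR n).
    replace ((l + / l) * (INR n + 1) + (B + 3 + beta) * l - B / l)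
        with ((l + / l) * (INR n + 2)) in H by lra.
    replace (a (S (S n))) with ((l + / l) * a (S n) - (INR n + beta + 3) / (INR n + 2) * a n).
    + ring.
    + apply Rmult_eq_reg_l with (INR n + 2); [|lra]. rewrite H. field. split; lra.
Qed.

(** * Square-summable solutions and membership of t_m in the spectrum *)

Lemma two_point_rec_base (A l : R) : 0 < l < 1 -> 0 < A ->
  exists a, two_point_rec A 0 l a /\ a 0%nat = 1 /\ ex_series (fun n => a n ^ 2).
Proof.
  intros Hl HA.
  set (a := fix a (n : nat) : R :=
    match n with O => 1 | S k => l * (INR k + A) / (INR k + 1) * a k end).
  assert (HaS : forall n, a (S n) = l * (INR n + A) / (INR n + 1) * a n) by reflexivity.
  assert (Hpos : forall n, 0 < a n).
  { induction n as [|n IH]; [simpl; lra|]. rewrite HaS. assert (Hn := pos_INR n).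
    apply Rmult_lt_0_compat; [|exact IH]. apply Rdiv_lt_0_compat; [|lra].
    apply Rmult_lt_0_compat; lra. }
  exists a. split; [split|split; [reflexivity|]].
  - simpl. field. lra.
  - intros n. rewrite !HaS, S_INR. assert (Hn := pos_INR n). field. lra.
  - apply ex_series_of_ratio with (l ^ 2); [nra|intros n; apply pow_lt, Hpos|].
    assert (H := is_lim_seq_INR_ratio A 1).
    apply is_lim_seq_ext with (fun n => l ^ 2 * ((INR n + A) / (INR n + 1) * ((INR n + A) / (INR n + 1)))).
    + intros n. rewrite HaS. specialize (Hpos n). assert (Hn := pos_INR n). field. lra.
    + replace (l ^ 2) with (l ^ 2 * (1 * 1)) at 1 by ring.
      apply is_lim_seq_mult'; [apply is_lim_seq_const|]. now apply is_lim_seq_mult'.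
Qed.

Lemma ex_series_R_le (a b : nat -> R) : (forall n, 0 <= a n <= b n) -> ex_series b -> ex_series a.
Proof.
  intros H Hb. apply (@ex_series_le R_AbsRing R_CompleteNormedModule a b); [|exact Hb].
  intros n. change (Rabs (a n) <= b n). rewrite Rabs_pos_eq; apply H.
Qed.

Lemma ex_series_shift (f : nat -> R) :
  ex_series f -> ex_series (fun n => match n with O => 0 | S m => f m end).
Proof.
  intros H. apply ex_series_incr_1. exact H.
Qed.

(** Starting from (1 - l z)^(-A), the case B = 0, each multiplication by 1 - z/l raises B by one and
    keeps the coefficients square-summable. *)
Lemma two_point_rec_l2 (A l : R) (m : nat) : 0 < l < 1 -> 0 < A ->
  exists a, two_point_rec A (INR m) l a /\ a 0%nat = 1 /\ ex_series (fun n => a n ^ 2).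
Proof.
  intros Hl HA. induction m as [|m (b & Hb & Hb0 & Hbs)].
  - now apply two_point_rec_base.
  - set (a := fun n => match n with O => b 0%nat | S k => b (S k) - b k / l end).
    exists a. split; [|split; [exact Hb0|]].
    + rewrite S_INR. now apply two_point_rec_mul_factor with b.
    + apply ex_series_R_le with
        (fun n => 2 * b n ^ 2 + (2 / l ^ 2) * match n with O => 0 | S k => b k ^ 2 end).
      * intros n. split; [apply pow2_ge_0|]. destruct n as [|k]; unfold a.
        -- assert (H := pow2_ge_0 (b 0%nat)). lra.
        -- assert (H := pow2_ge_0 (b (S k) + b k / l)).
           replace (2 / l ^ 2 * b k ^ 2) with (2 * (b k / l) ^ 2) by (field; lra). nra.
      * apply (ex_series_plus (V := R_NormedModule)).
        -- apply (ex_series_scal_l 2 (fun n => b n ^ 2)), Hbs.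
        -- apply (ex_series_scal_l (2 / l ^ 2) (fun n => match n with O => 0 | S k => b k ^ 2 end)).
           exact (ex_series_shift (fun k => b k ^ 2) Hbs).
Qed.

(** The parametrisation that turns t_m into the pair l, B = m of [tri_eigen_iff]. *)
Lemma t_eq (beta : R) (m : nat) : -1 < beta ->
  exists l, 0 < l < 1 /\ l = sqrt (INR m + 1) / sqrt (INR m + beta + 2) /\
    l ^ 2 * (INR m + beta + 2) = INR m + 1 /\ t_ beta m = l + / l.
Proof.
  intros Hb. assert (Hm := pos_INR m).
  assert (H1 : 0 < sqrt (INR m + 1)) by (apply sqrt_lt_R0; lra).
  assert (H2 : 0 < sqrt (INR m + beta + 2)) by (apply sqrt_lt_R0; lra).
  assert (H3 : sqrt (INR m + 1) ^ 2 = INR m + 1) by (apply pow2_sqrt; lra).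
  assert (H4 : sqrt (INR m + beta + 2) ^ 2 = INR m + beta + 2) by (apply pow2_sqrt; lra).
  eexists. split; [|split; [reflexivity|split]].
  - split; [now apply Rdiv_lt_0_compat|].
    apply Rmult_lt_reg_r with (sqrt (INR m + beta + 2)); [exact H2|].
    unfold Rdiv. rewrite Rmult_assoc, Rinv_l, Rmult_1_r, Rmult_1_l by lra.
    apply sqrt_lt_1_alt. lra.
  - rewrite <- H4 at 2. rewrite <- H3 at 2. field. lra.
  - unfold t_. rewrite sqrt_mult by lra.
    replace (2 * INR m + beta + 3) with ((INR m + 1) + (INR m + beta + 2)) by ring.
    rewrite <- H4 at 1. rewrite <- H3 at 1. field. lra.
Qed.

Lemma t_gt_2 (beta : R) (m : nat) : -1 < beta -> 2 < t_ beta m.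
Proof.
  intros Hb. destruct (t_eq beta m Hb) as (l & Hl & _ & _ & ->).
  apply Rlt_0_minus. replace (l + / l - 2) with ((1 - l) ^ 2 / l) by (field; lra).
  apply Rdiv_lt_0_compat; [apply pow_lt|]; lra.
Qed.

Lemma Cmod_sqr (z : C) : Cmod z ^ 2 = Re z ^ 2 + Im z ^ 2.
Proof. apply Cmod2_alt. Qed.

Lemma in_l2_iff (x : nat -> C) :
  in_l2 x <-> ex_series (fun n => Re (x n) ^ 2) /\ ex_series (fun n => Im (x n) ^ 2).
Proof.
  unfold in_l2. split.
  - intros H. split; apply ex_series_R_le with (2 := H); intros n; rewrite Cmod_sqr;
      assert (H1 := pow2_ge_0 (Re (x n))); assert (H2 := pow2_ge_0 (Im (x n))); lra.
  - intros [H1 H2]. apply ex_series_ext with (fun n => Re (x n) ^ 2 + Im (x n) ^ 2).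
    + intros n. now rewrite Cmod_sqr.
    + now apply (ex_series_plus (V := R_NormedModule)).
Qed.

Lemma l2norm_eq (x : nat -> C) : in_l2 x ->
  l2norm x = sqrt (Series (fun n => Re (x n) ^ 2) + Series (fun n => Im (x n) ^ 2)).
Proof.
  intros H. apply in_l2_iff in H. destruct H as [H1 H2]. unfold l2norm. f_equal.
  rewrite <- Series_plus by assumption. apply Series_ext. intros n. apply Cmod_sqr.
Qed.

Lemma t_in_spectrum (beta : R) (m : nat) : -1 < beta ->
  spectrum (jacobi (bergman beta)) (RtoC (t_ beta m)).
Proof.
  intros Hb (Inv & (_ & _ & Hscal & _) & Hleft & _).
  destruct (t_eq beta m Hb) as (l & Hl & _ & Hl2 & Ht). rewrite Ht in *.
  assert (Hm := pos_INR m).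
  destruct (two_point_rec_l2 (INR m + 3 + beta) l m Hl ltac:(lra)) as (a & Ha & Ha0 & Has).
  assert (Hv := proj2 (tri_eigen_iff beta l (INR m) a Hb (proj1 Hl) Hl2) Ha). clear Ha.
  set (v := fun k => a k * sqrt (bergman beta (S k))) in *.
  set (x := fun k => RtoC (v k)).
  assert (Hx : in_l2 x).
  { apply in_l2_iff. split.
    - apply ex_series_R_le with (2 := Has). intros n. split; [apply pow2_ge_0|].
      unfold x, v. rewrite re_RtoC, Rpow_mult_distr, pow2_sqrt
        by (now apply Rlt_le, bergman_pos).
      assert (H := bergman_le_1 beta (S n) Hb). assert (H' := pow2_ge_0 (a n)). nra.
    - apply ex_series_R_le with (2 := Has). intros n. unfold x. rewrite im_RtoC.
      assert (H := pow2_ge_0 (a n)). lra. }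
  (* The zero vector is presented as 0 times [x], so that homogeneity of the supposed inverse
     evaluates it. Equality as functions is required because the inverse is an arbitrary map on
     sequences. *)
  assert (E : (fun k => jacobi (bergman beta) x k - RtoC (l + / l) * x k)%C = (fun k => 0 * x k)%C).
  { apply functional_extensionality. intros k. rewrite Cmult_0_l.
    assert (E1 : jacobi (bergman beta) x k = RtoC ((l + / l) * v k)).
    { apply injective_projections.
      - change (Re (jacobi (bergman beta) x k) = (l + / l) * v k).
        rewrite Re_jacobi by exact Hb. apply Hv.
      - change (Im (jacobi (bergman beta) x k) = 0).
        rewrite Im_jacobi by exact Hb. unfold x, tri. rewrite !im_RtoC.
        destruct k; [|rewrite im_RtoC]; ring. }
    rewrite E1, RtoC_mult. unfold x. ring. }
  assert (H := Hleft x Hx 0%nat). rewrite E, Hscal, Cmult_0_l in H by exact Hx.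
  unfold x, v in H. rewrite Ha0 in H. apply (f_equal Re) in H.
  rewrite !re_RtoC in H. assert (0 < sqrt (bergman beta 1)).
  { now apply sqrt_lt_R0, bergman_pos. } lra.
Qed.

(** * Points above 2 outside the sequence t_m *)

Lemma jacobi_weight_eventually_le (beta C : R) : -1 < beta -> 1 < C ->
  exists N, forall n, (N <= n)%nat -> jacobi_weight beta n <= C.
Proof.
  intros Hb HC.
  assert (H := is_lim_seq_INR_ratio (beta + 3) 2). apply is_lim_seq_spec in H.
  assert (He : 0 < C ^ 2 - 1) by nra.
  destruct (H (mkposreal _ He)) as [N HN]. exists N. intros n Hn.
  specialize (HN n Hn). simpl in HN. apply Rabs_def2 in HN.
  unfold jacobi_weight. rewrite <- (sqrt_pow2 C) by lra. apply sqrt_le_1_alt.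
  replace (INR n + beta + 3) with (INR n + (beta + 3)) by ring.
  simpl. lra.
Qed.

Lemma eventually_nonincreasing_bounded (a : nat -> R) (N : nat) :
  (forall n, (N <= n)%nat -> Rabs (a (S n)) <= Rabs (a n)) ->
  exists M, forall n, Rabs (a n) <= M.
Proof.
  intros H. destruct (bounded_initial a N) as (D & HD0 & HD). exists D. intros n.
  destruct (le_lt_dec n N) as [Hn|Hn]; [now apply HD|].
  replace n with (N + (n - N))%nat by lia. induction (n - N)%nat as [|k IH].
  - apply HD. lia.
  - rewrite Nat.add_succ_r. eapply Rle_trans; [apply H; lia|exact IH].
Qed.

Lemma root_of_t (t : R) : 2 < t -> exists l, 0 < l < 1 /\ t = l + / l.
Proof.
  intros Ht. assert (Hd : 0 < t ^ 2 - 4) by nra.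
  assert (Hs : 0 < sqrt (t ^ 2 - 4)) by now apply sqrt_lt_R0.
  assert (Hs2 : sqrt (t ^ 2 - 4) ^ 2 = t ^ 2 - 4) by (apply pow2_sqrt; lra).
  set (s := sqrt (t ^ 2 - 4)) in *. clearbody s.
  assert (Hst : s < t) by nra.
  assert (Hst2 : t - s < 2) by nra.
  exists ((t - s) / 2). split; [split; lra|].
  apply Rmult_eq_reg_r with ((t - s) / 2); [|lra].
  rewrite Rmult_plus_distr_r, Rinv_l by lra. nra.
Qed.

(** Decay of the eigenvector is converted into boundedness of the Taylor coefficients, to which the
    divisibility argument applies; the natural exponent found then determines l, hence t. *)
Lemma decaying_sol_t (beta t C : R) (N : nat) : -1 < beta -> 2 < t ->
  (forall n, (N <= n)%nat -> jacobi_weight beta n <= C) ->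
  (forall n, (N < n)%nat ->
     C * Rabs (regular_sol (jacobi_weight beta) t (S n))
       <= Rabs (regular_sol (jacobi_weight beta) t n)) ->
  exists m, t = t_ beta m.
Proof.
  intros Hb Ht HC Hv. set (v := regular_sol (jacobi_weight beta) t) in *.
  assert (Hc1 := fun n => jacobi_weight_ge_1 beta n Hb).
  assert (Hc : forall n, 0 < jacobi_weight beta n) by (intros n; specialize (Hc1 n); lra).
  assert (Hs : forall n, 0 < sqrt (bergman beta n)).
  { intros n. now apply sqrt_lt_R0, bergman_pos. }
  destruct (root_of_t t Ht) as (l & Hl & Htl).
  (* Solves l^2 (B + beta + 2) = B + 1 for B. *)
  set (B := (l ^ 2 * (beta + 2) - 1) / (1 - l ^ 2)).
  assert (Hl2 : 0 < 1 - l ^ 2) by nra.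
  assert (HB : l ^ 2 * (B + beta + 2) = B + 1).
  { unfold B. field. lra. }
  assert (HB1 : -1 < B).
  { assert (0 < l ^ 2 * (beta + 1)) by (apply Rmult_lt_0_compat; [apply pow_lt|]; lra).
    assert (E : (1 - l ^ 2) * (B + 1) = l ^ 2 * (beta + 1)) by (unfold B; field; lra).
    destruct (Rlt_le_dec (-1) B) as [|H0]; [assumption|].
    assert ((1 - l ^ 2) * (B + 1) <= 0); [|lra].
    rewrite <- (Rmult_0_r (1 - l ^ 2)). apply Rmult_le_compat_l; lra. }
  set (a := fun n => v n / (sqrt (bergman beta (S n)) )).
  assert (Hav : forall n, a n * sqrt (bergman beta (S n)) = v n).
  { intros n. unfold a. specialize (Hs (S n)). field. lra. }
  set (r := a 0%nat).
  assert (Hr : 0 < r).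
  { unfold r, a. apply Rdiv_lt_0_compat; [unfold v, regular_sol; simpl; lra|apply Hs]. }
  assert (Ha : two_point_rec (B + 3 + beta) B l a).
  { apply tri_eigen_iff; [exact Hb|lra|exact HB|]. intros n.
    assert (Hvn := tri_regular_sol _ t n Hc). fold v in Hvn.
    rewrite <- Htl, Hav, <- Hvn. unfold tri. destruct n; now rewrite !Hav. }
  (* Undoing the square roots of the weights costs the factor [jacobi_weight beta n] <= C at each
     step, which the decay of [v] by the factor C covers. *)
  assert (Hdec : forall n, (S N <= n)%nat -> Rabs (a (S n)) <= Rabs (a n)).
  { intros n Hn. unfold a, Rdiv. rewrite !Rabs_mult, !Rabs_inv.
    rewrite (Rabs_pos_eq (sqrt (bergman beta (S n)))) by apply Rlt_le, Hs.
    rewrite (Rabs_pos_eq (sqrt (bergman beta (S (S n))))) by apply Rlt_le, Hs.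
    rewrite <- (jacobi_weight_sqrt beta n Hb). specialize (Hc n).
    assert (Hsn := Hs (S (S n))).
    rewrite Rinv_mult, <- Rmult_assoc.
    apply Rmult_le_compat_r; [apply Rlt_le, Rinv_0_lt_compat, Hsn|].
    apply Rmult_le_reg_r with (jacobi_weight beta n); [exact Hc|].
    rewrite Rmult_assoc, Rinv_l, Rmult_1_r by lra.
    specialize (Hv n ltac:(lia)). specialize (HC n ltac:(lia)).
    assert (0 <= Rabs (v (S n))) by apply Rabs_pos. nra. }
  destruct (eventually_nonincreasing_bounded a (S N) Hdec) as [M HM].
  set (a' := fun n => a n / r).
  assert (Ha' : two_point_rec (B + 3 + beta) B l a').
  { destruct Ha as [H0 H]. unfold a'. split.
    - rewrite H0. field. lra.
    - intros n.
      transitivity ((INR n + 2) * a (S (S n)) / r); [field; lra|]. rewrite H. field. lra. }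
  assert (HM' : forall n, Rabs (a' n) <= M / r).
  { intros n. unfold a', Rdiv. rewrite Rabs_mult, Rabs_inv, (Rabs_pos_eq r) by lra.
    apply Rmult_le_compat_r; [apply Rlt_le, Rinv_0_lt_compat; lra|apply HM]. }
  assert (Ha0' : a' 0%nat = 1) by (unfold a'; fold r; field; lra).
  (* Only some natural number above B is wanted; B > -1 makes the argument of the floor
     nonnegative. *)
  destruct (nfloor_ex (B + 1)) as [k Hk]; [lra|].
  destruct (two_point_rec_bounded_exponent (B + 3 + beta) l (S k) Hl ltac:(lra)
    B (M / r) a' ltac:(rewrite S_INR; lra) Ha' Ha0' HM') as [m Hm].
  exists m. destruct (t_eq beta m Hb) as (l' & Hl' & _ & Hl2' & ->).
  rewrite Htl. rewrite Hm in HB.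
  assert (E : l = l'); [|now rewrite E].
  assert (Hm0 := pos_INR m).
  assert (E2 : l ^ 2 = l' ^ 2).
  { apply Rmult_eq_reg_r with (INR m + beta + 2); [lra|lra]. }
  assert (E3 : (l - l') * (l + l') = 0) by lra.
  apply Rmult_integral in E3. lra.
Qed.

Lemma growing_not_l2 (v : nat -> R) (C : R) (M : nat) : 1 < C -> v M <> 0 ->
  (forall n, (M <= n)%nat -> C * Rabs (v n) <= Rabs (v (S n))) ->
  ~ ex_series (fun n => v n ^ 2).
Proof.
  intros HC HM Hg Hex. apply ex_series_lim_0, is_lim_seq_spec in Hex.
  assert (Hp := Rabs_pos_lt _ HM).
  assert (He : 0 < Rabs (v M) ^ 2) by now apply pow_lt.
  destruct (Hex (mkposreal _ He)) as [N HN]. simpl pos in HN.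
  specialize (HN (M + N)%nat ltac:(lia)). rewrite Rminus_0_r in HN.
  rewrite Rabs_pos_eq in HN by apply pow2_ge_0.
  assert (H := pow_growth C v M HC Hg M N (Nat.le_refl M)).
  assert (HCN : 1 <= C ^ N) by (apply pow_R1_Rle; lra).
  rewrite <- (pow2_abs (v (M + N)%nat)) in HN.
  assert (H1 : Rabs (v M) <= Rabs (v (M + N)%nat)) by nra.
  assert (H2 : Rabs (v M) ^ 2 <= Rabs (v (M + N)%nat) ^ 2) by (apply pow_incr; lra). lra.
Qed.

Lemma tri_shift_l2 (c x : nat -> R) (t D : R) : (forall n, 0 <= c n <= D) ->
  ex_series (fun n => x n ^ 2) -> ex_series (fun n => (tri c x n - t * x n) ^ 2).
Proof.
  intros Hc Hx.
  apply ex_series_R_le with (fun n => 3 * D ^ 2 * x (S n) ^ 2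
    + (3 * D ^ 2 * match n with O => 0 | S m => x m ^ 2 end + 3 * t ^ 2 * x n ^ 2)).
  - intros n. split; [apply pow2_ge_0|]. unfold tri.
    assert (Hsq : forall p q s : R, (p + q - s) ^ 2 <= 3 * p ^ 2 + 3 * q ^ 2 + 3 * s ^ 2).
    { intros p q s. assert (H1 := pow2_ge_0 (p - q)). assert (H2 := pow2_ge_0 (p + s)).
      assert (H3 := pow2_ge_0 (q + s)). lra. }
    assert (Hcx : forall k j, (c k * x j) ^ 2 <= D ^ 2 * x j ^ 2).
    { intros k j. rewrite Rpow_mult_distr. apply Rmult_le_compat_r; [apply pow2_ge_0|].
      apply pow_incr, Hc. }
    eapply Rle_trans; [apply Hsq|]. rewrite (Rpow_mult_distr t).
    assert (H1 := Hcx n (S n)). destruct n as [|m]; [lra|].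
    assert (H2 := Hcx m m). lra.
  - apply (ex_series_plus (V := R_NormedModule)).
    + apply (ex_series_scal_l (3 * D ^ 2) (fun n => x (S n) ^ 2)).
      now apply (ex_series_incr_1 (fun n => x n ^ 2)).
    + apply (ex_series_plus (V := R_NormedModule)).
      * apply (ex_series_scal_l (3 * D ^ 2) (fun n => match n with O => 0 | S m => x m ^ 2 end)).
        now apply (ex_series_shift (fun n => x n ^ 2)).
      * now apply (ex_series_scal_l (3 * t ^ 2) (fun n => x n ^ 2)).
Qed.

(** The Green kernel is a bounded right inverse. It is also a left inverse because [v] grows, so
    that J - t has no nonzero square-summable kernel. *)
Lemma green_not_spectrum (beta t K th C : R) (u : nat -> R) (M : nat) : -1 < beta ->
  1 < C -> regular_sol (jacobi_weight beta) t M <> 0 ->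
  (forall n, (M <= n)%nat -> C * Rabs (regular_sol (jacobi_weight beta) t n)
     <= Rabs (regular_sol (jacobi_weight beta) t (S n))) ->
  green_pair (jacobi_weight beta) t K th u (regular_sol (jacobi_weight beta) t) ->
  ~ spectrum (jacobi (bergman beta)) (RtoC t).
Proof.
  intros Hb HC HM Hg Hp Hspec. apply Hspec.
  set (v := regular_sol (jacobi_weight beta) t) in *.
  assert (Hc1 := fun n => jacobi_weight_ge_1 beta n Hb).
  assert (Hc : forall n, 0 < jacobi_weight beta n) by (intros n; specialize (Hc1 n); lra).
  assert (HcD : forall n, 0 <= jacobi_weight beta n <= beta + 3).
  { intros n. split; [now apply Rlt_le|].
    assert (H := jacobi_weight_sqr beta n Hb). assert (Hn := pos_INR n).
    assert (H1 : (INR n + beta + 3) / (INR n + 2) <= beta + 3).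
    { apply Rmult_le_reg_r with (INR n + 2); [lra|].
      unfold Rdiv. rewrite Rmult_assoc, Rinv_l by lra. nra. }
    specialize (Hc1 n). nra. }
  destruct (green_bounded _ t K th u v Hp) as (B & HB0 & HB).
  set (G := green u v) in *.
  (* The kernel is real, so it acts on real and imaginary parts separately. *)
  exists (fun x n => (G (fun k => Re (x k)) n, G (fun k => Im (x k)) n)).
  assert (Hl2 : forall x, in_l2 x -> in_l2 (fun n => (G (fun k => Re (x k)) n, G (fun k => Im (x k)) n))).
  { intros x Hx. apply in_l2_iff in Hx. apply in_l2_iff. split; now apply HB. }
  split; [split; [exact Hl2|split; [|split]]|split].
  - intros x y Hx Hy n. apply in_l2_iff in Hx. apply in_l2_iff in Hy.
    apply injective_projections; simpl.
    + apply (green_plus _ t K th u v (fun k => Re (x k)) (fun k => Re (y k)) n Hp); cbv beta; tauto.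
    + apply (green_plus _ t K th u v (fun k => Im (x k)) (fun k => Im (y k)) n Hp); cbv beta; tauto.
  - intros a x Hx n. apply in_l2_iff in Hx. destruct Hx as [Hx1 Hx2].
    assert (Hs : forall (r : R) y, ex_series (fun n => y n ^ 2) ->
      ex_series (fun n => (r * y n) ^ 2)).
    { intros r y Hy. apply ex_series_ext with (fun n => r ^ 2 * y n ^ 2).
      - intros k. symmetry. apply Rpow_mult_distr.
      - now apply (ex_series_scal_l (r ^ 2) (fun n => y n ^ 2)). }
    apply injective_projections; simpl.
    + transitivity (G (fun k => fst a * Re (x k) + - snd a * Im (x k)) n).
      { f_equal. apply functional_extensionality. intros k. unfold Re, Im. ring. }
      unfold G. rewrite (green_plus _ t K th u v (fun k => fst a * Re (x k)) (fun k => - snd a * Im (x k)) n Hp)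
        by now apply Hs.
      rewrite !green_scal. ring.
    + transitivity (G (fun k => fst a * Im (x k) + snd a * Re (x k)) n).
      { f_equal. }
      unfold G. rewrite (green_plus _ t K th u v (fun k => fst a * Im (x k)) (fun k => snd a * Re (x k)) n Hp)
        by now apply Hs.
      rewrite !green_scal. ring.
  - exists (sqrt B). intros x Hx.
    rewrite (l2norm_eq _ (Hl2 x Hx)), (l2norm_eq x Hx), <- sqrt_mult_alt by exact HB0.
    apply sqrt_le_1_alt. apply in_l2_iff in Hx. destruct Hx as [Hx1 Hx2].
    destruct (HB _ Hx1) as [_ H1]. destruct (HB _ Hx2) as [_ H2].
    rewrite Rmult_plus_distr_l. now apply Rplus_le_compat.
  - intros x Hx n. apply in_l2_iff in Hx. destruct Hx as [Hx1 Hx2].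
    (* For z = (J - t) y, the difference G z - y is a square-summable eigenvector, hence a multiple
       of the growing [v], hence zero. *)
    assert (Hinv : forall y n, ex_series (fun n => y n ^ 2) ->
      G (fun k => tri (jacobi_weight beta) y k - t * y k) n = y n).
    { intros y m Hy.
      assert (Hz := tri_shift_l2 _ y t (beta + 3) HcD Hy).
      set (z := fun k => tri (jacobi_weight beta) y k - t * y k) in *.
      assert (HGz : ex_series (fun n => G z n ^ 2)) by now apply HB.
      set (w := fun k => G z k - y k).
      assert (Hw : forall k, tri (jacobi_weight beta) w k = t * w k).
      { intros k. assert (E := green_solves _ t K th u v z k Hp Hz).
        fold G in E.
        assert (Ez : z k = tri (jacobi_weight beta) y k - t * y k) by reflexivity. unfold w.
        assert (Ew : tri (jacobi_weight beta) (fun k => G z k - y k) k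
          = tri (jacobi_weight beta) (G z) k - tri (jacobi_weight beta) y k).
        { unfold tri. destruct k; ring. }
        rewrite Ew. lra. }
      assert (Hws : ex_series (fun n => w n ^ 2)).
      { apply ex_series_R_le with (fun n => 2 * G z n ^ 2 + 2 * y n ^ 2).
        - intros k. split; [apply pow2_ge_0|]. unfold w.
          assert (H := pow2_ge_0 (G z k + y k)). lra.
        - apply (ex_series_plus (V := R_NormedModule)).
          + now apply (ex_series_scal_l 2 (fun n => G z n ^ 2)).
          + now apply (ex_series_scal_l 2 (fun n => y n ^ 2)). }
      assert (Hwv : forall k, w k = w 0%nat * v k) by (intros k; now apply (tri_eigen_unique _ t)).
      destruct (Req_dec (w 0%nat) 0) as [E0|E0].
      - specialize (Hwv m). rewrite E0, Rmult_0_l in Hwv. unfold w in Hwv. lra.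
      - exfalso. apply (growing_not_l2 w C M HC); [| |exact Hws].
        + rewrite Hwv. now apply Rmult_integral_contrapositive.
        + intros k Hk. rewrite (Hwv k), (Hwv (S k)), !Rabs_mult.
          specialize (Hg k Hk). assert (H0 := Rabs_pos (w 0%nat)). nra. }
    apply injective_projections; simpl.
    + rewrite <- (Hinv (fun k => Re (x k)) n Hx1) at 1. f_equal.
      apply functional_extensionality. intros k.
      rewrite <- (Re_jacobi beta x k Hb). unfold Re. simpl. ring.
    + rewrite <- (Hinv (fun k => Im (x k)) n Hx2) at 1. f_equal.
      apply functional_extensionality. intros k.
      rewrite <- (Im_jacobi beta x k Hb). unfold Im. simpl. ring.
  - intros x Hx n. apply in_l2_iff in Hx. destruct Hx as [Hx1 Hx2].
    assert (E1 := green_solves _ t K th u v _ n Hp Hx1).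
    assert (E2 := green_solves _ t K th u v _ n Hp Hx2).
    fold G in E1, E2.
    set (y := fun n => (G (fun k => Re (x k)) n, G (fun k => Im (x k)) n)) in *.
    assert (J1 : Re (jacobi (bergman beta) y n) = tri (jacobi_weight beta) (G (fun k => Re (x k))) n)
      by exact (Re_jacobi beta y n Hb).
    assert (J2 : Im (jacobi (bergman beta) y n) = tri (jacobi_weight beta) (G (fun k => Im (x k))) n)
      by exact (Im_jacobi beta y n Hb).
    rewrite <- J1 in E1. rewrite <- J2 in E2.
    apply injective_projections.
    + change (fst (x n)) with (Re (x n)). rewrite <- E1.
      unfold Re, y. simpl. ring.
    + change (snd (x n)) with (Im (x n)). rewrite <- E2.
      unfold Im, y. simpl. ring.
Qed.

Lemma spectrum_above_2 (beta t : R) : -1 < beta ->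
  (spectrum (jacobi (bergman beta)) (RtoC t) /\ 2 < t) <-> (exists m : nat, t = t_ beta m).
Proof.
  intros Hb. split.
  - intros [Hspec Ht].
    (* With C = 1 + e and e <= 1, C^2 + C = 2 + 3 e + e^2 <= 2 + 4 e, which e <= (t - 2) / 4 keeps
       below t. *)
    set (C := 1 + Rmin 1 ((t - 2) / 4)).
    assert (HC : 1 < C /\ C ^ 2 + C <= t).
    { assert (H1 := Rmin_l 1 ((t - 2) / 4)). assert (H2 := Rmin_r 1 ((t - 2) / 4)).
      assert (H3 : 0 < Rmin 1 ((t - 2) / 4)) by (apply Rmin_pos; lra).
      unfold C. set (e := Rmin 1 ((t - 2) / 4)) in *. clearbody e. split; nra. }
    destruct (jacobi_weight_eventually_le beta C Hb (proj1 HC)) as [N HN].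
    destruct (growth_alternative (jacobi_weight beta) t C N
      (fun n => jacobi_weight_ge_1 beta n Hb) (proj1 HC) (proj2 HC) HN) as [(M & HM & Hg)|Hd].
    + destruct (green_pair_of_growth (jacobi_weight beta) t C M
        (fun n => jacobi_weight_ge_1 beta n Hb) (proj1 HC) HM Hg) as (K & u & Hp).
      exfalso. now apply (green_not_spectrum beta t K (/ C) C u M Hb (proj1 HC) HM Hg Hp).
    + now apply (decaying_sol_t beta t C N Hb Ht HN).
  - intros [m ->]. split; [now apply t_in_spectrum|now apply t_gt_2].
Qed.

(** * Complex exponential, logarithm and powers *)

(* Complex differentiability with the increment written out; Coquelicot's
   [is_derive] hides it behind two different uniform structures on [C]. *)
Definition Cderiv (f : C -> C) (z l : C) : Prop :=
  forall eps, 0 < eps -> exists delta, 0 < delta /\ forall h : C, Cmod h < delta ->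
    Cmod (f (z + h) - f z - h * l)%C <= eps * Cmod h.

Lemma Cderiv_iff (f : C -> C) (z l : C) :
  Cderiv f z l <-> @is_derive C_AbsRing C_NormedModule f z l.
Proof.
  split.
  - intros H. split.
    + apply is_linear_scal_l.
    + intros x Hx. apply (@is_filter_lim_locally_unique C_AbsRing (AbsRing_NormedModule C_AbsRing)) in Hx. subst x.
      intros eps. destruct (H eps (cond_pos eps)) as (d & Hd & Hf).
      exists (mkposreal d Hd). intros y Hy.
      specialize (Hf (y - z)%C Hy).
      assert (E : forall u v : C, (u + (v - u))%C = v) by (intros; ring).
      rewrite E in Hf. exact Hf.
  - intros [_ H] eps Heps.
    destruct (H z (fun P HP => HP) (mkposreal eps Heps)) as [d Hd].
    exists d. split; [apply cond_pos|]. intros h Hh.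
    assert (E : (z + h - z)%C = h) by ring.
    specialize (Hd (z + h)%C). unfold ball in Hd. simpl in Hd. unfold AbsRing_ball in Hd.
    change (abs (minus (z + h)%C z)) with (Cmod (z + h - z)%C) in Hd.
    rewrite E in Hd. specialize (Hd Hh).
    change (Cmod (f (z + h) - f z - (z + h - z) * l)%C <= eps * Cmod (z + h - z)%C) in Hd.
    now rewrite E in Hd.
Qed.

(* [C] carries two normed module structures over itself, and [is_derive_mult] and
   [is_derive_comp] speak about this one. *)
Lemma Cderiv_iff_AbsRing (f : C -> C) (z l : C) :
  Cderiv f z l <-> @is_derive C_AbsRing (AbsRing_NormedModule C_AbsRing) f z l.
Proof.
  split.
  - intros H. split.
    + apply is_linear_scal_l.
    + intros x Hx. apply (@is_filter_lim_locally_unique C_AbsRing (AbsRing_NormedModule C_AbsRing)) in Hx. subst x.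
      intros eps. destruct (H eps (cond_pos eps)) as (d & Hd & Hf).
      exists (mkposreal d Hd). intros y Hy.
      specialize (Hf (y - z)%C Hy).
      assert (E : forall u v : C, (u + (v - u))%C = v) by (intros; ring).
      rewrite E in Hf. exact Hf.
  - intros [_ H] eps Heps.
    destruct (H z (fun P HP => HP) (mkposreal eps Heps)) as [d Hd].
    exists d. split; [apply cond_pos|]. intros h Hh.
    assert (E : (z + h - z)%C = h) by ring.
    specialize (Hd (z + h)%C). unfold ball in Hd. simpl in Hd. unfold AbsRing_ball in Hd.
    change (abs (minus (z + h)%C z)) with (Cmod (z + h - z)%C) in Hd.
    rewrite E in Hd. specialize (Hd Hh).
    change (Cmod (f (z + h) - f z - (z + h - z) * l)%C <= eps * Cmod (z + h - z)%C) in Hd.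
    now rewrite E in Hd.
Qed.

Lemma Rabs_Im_le (z : C) : Rabs (Im z) <= Cmod z.
Proof. eapply Rle_trans; [apply Rmax_r|apply Rmax_Cmod]. Qed.

Lemma Cmod_le_Rabs_plus (z : C) : Cmod z <= Rabs (Re z) + Rabs (Im z).
Proof.
  assert (H := Cmod2_alt z). assert (H1 := Rabs_pos (Re z)). assert (H2 := Rabs_pos (Im z)).
  rewrite <- (pow2_abs (Re z)), <- (pow2_abs (Im z)) in H.
  assert (H3 := Cmod_ge_0 z). nra.
Qed.

Lemma Cexp_plus (z w : C) : Cexp (z + w) = (Cexp z * Cexp w)%C.
Proof.
  unfold Cexp. apply injective_projections; simpl; unfold Re, Im; simpl;
    rewrite exp_plus, ?cos_plus, ?sin_plus; ring.
Qed.

Lemma Cexp_0 : Cexp 0 = 1%C.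
Proof.
  unfold Cexp. apply injective_projections; simpl; rewrite exp_0, ?cos_0, ?sin_0; ring.
Qed.

Lemma Cexp_neq_0 (z : C) : Cexp z <> 0%C.
Proof.
  intros E. apply C1_nz. rewrite <- Cexp_0.
  replace (RtoC 0) with (z + - z)%C by ring. rewrite Cexp_plus, E. ring.
Qed.

Lemma increment_at_0 (f : R -> R) (l eps : R) : is_derive f 0 l -> 0 < eps ->
  exists d, 0 < d /\ forall x, Rabs x < d -> Rabs (f x - f 0 - x * l) <= eps * Rabs x.
Proof.
  intros [_ H] Heps. destruct (H 0 (fun P HP => HP) (mkposreal eps Heps)) as [d Hd].
  exists d. split; [apply cond_pos|]. intros x Hx.
  assert (Hb : ball 0 d x).
  { change (Rabs (x - 0) < d). now rewrite Rminus_0_r. }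
  specialize (Hd x Hb).
  change (Rabs (f x - f 0 - (x - 0) * l) <= eps * Rabs (x - 0)) in Hd.
  now rewrite Rminus_0_r in Hd.
Qed.

Lemma Cexp_deriv_0 : Cderiv Cexp 0 1.
Proof.
  intros eps Heps.
  (* The four error terms below add up to at most 8 e |h|, so a tenth of eps suffices; e <= 1 keeps
     |h| < 1 in the products. *)
  set (e := Rmin (eps / 10) 1).
  assert (He : 0 < e) by (apply Rmin_pos; lra).
  assert (He1 : e <= eps / 10) by apply Rmin_l. assert (He2 : e <= 1) by apply Rmin_r.
  destruct (increment_at_0 exp 1 e) as (d1 & Hd1 & H1); [|exact He|].
  { replace 1 with (exp 0) at 1 by apply exp_0. apply is_derive_exp. }
  destruct (increment_at_0 cos 0 e) as (d2 & Hd2 & H2); [|exact He|].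
  { replace 0 with (- sin 0) at 2 by (rewrite sin_0; ring). apply is_derive_cos. }
  destruct (increment_at_0 sin 1 e) as (d3 & Hd3 & H3); [|exact He|].
  { replace 1 with (cos 0) by apply cos_0. apply is_derive_sin. }
  rewrite exp_0 in H1. rewrite cos_0 in H2. rewrite sin_0 in H3.
  exists (Rmin (Rmin d1 d2) (Rmin d3 e)).
  split; [repeat apply Rmin_pos; lra|]. intros h Hh.
  assert (Hmin : Cmod h < d1 /\ Cmod h < d2 /\ Cmod h < d3 /\ Cmod h < e).
  { repeat split; (eapply Rlt_le_trans; [exact Hh|]).
    - eapply Rle_trans; apply Rmin_l.
    - eapply Rle_trans; [apply Rmin_l|apply Rmin_r].
    - eapply Rle_trans; [apply Rmin_r|apply Rmin_l].
    - eapply Rle_trans; apply Rmin_r. }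
  destruct Hmin as (K1 & K2 & K3 & K4).
  assert (Ha := re_le_Cmod h). assert (Hb := Rabs_Im_le h).
  set (a := Re h) in *. set (b := Im h) in *. set (r := Cmod h) in *.
  assert (Hr : 0 <= r) by apply Cmod_ge_0.
  specialize (H1 a ltac:(lra)). specialize (H2 b ltac:(lra)). specialize (H3 b ltac:(lra)).
  rewrite Rmult_1_r in H1, H3. rewrite Rmult_0_r, Rminus_0_r in H2. rewrite Rminus_0_r in H3.
  rewrite Cplus_0_l, Cexp_0.
  eapply Rle_trans; [apply Cmod_le_Rabs_plus|].
  assert (E1 : Re (Cexp h - 1 - h * 1)%C = (exp a - 1 - a) * cos b + (1 + a) * (cos b - 1)).
  { unfold a, b, Re, Im. simpl. unfold Re, Im. ring. }
  assert (E2 : Im (Cexp h - 1 - h * 1)%C = ((exp a - 1 - a) + a) * sin b + (sin b - b)).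
  { unfold a, b, Re, Im. simpl. unfold Re, Im. ring. }
  rewrite E1, E2.
  assert (Hc : Rabs (cos b) <= 1) by (apply Rabs_le, COS_bound).
  assert (Hs : Rabs (sin b) <= 2 * r).
  { replace (sin b) with ((sin b - b) + b) by ring. eapply Rle_trans; [apply Rabs_triang|].
    assert (Hb0 := Rabs_pos b). nra. }
  assert (Ha0 := Rabs_pos a). assert (Hb0 := Rabs_pos b).
  assert (X1 : Rabs ((exp a - 1 - a) * cos b) <= e * r).
  { rewrite Rabs_mult. assert (0 <= Rabs (exp a - 1 - a)) by apply Rabs_pos.
    assert (0 <= Rabs (cos b)) by apply Rabs_pos. nra. }
  assert (X2 : Rabs ((1 + a) * (cos b - 1)) <= 2 * (e * r)).
  { rewrite Rabs_mult. assert (Rabs (1 + a) <= 2).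
    { eapply Rle_trans; [apply Rabs_triang|]. rewrite Rabs_R1. lra. }
    apply Rmult_le_compat; try apply Rabs_pos; [assumption|nra]. }
  assert (X3 : Rabs (((exp a - 1 - a) + a) * sin b) <= 4 * (e * r)).
  { rewrite Rabs_mult. assert (Rabs (exp a - 1 - a + a) <= 2 * e).
    { eapply Rle_trans; [apply Rabs_triang|]. nra. }
    replace (4 * (e * r)) with (2 * e * (2 * r)) by ring.
    apply Rmult_le_compat; try apply Rabs_pos; assumption. }
  assert (X4 : Rabs (sin b - b) <= e * r) by nra.
  assert (Y1 := Rabs_triang ((exp a - 1 - a) * cos b) ((1 + a) * (cos b - 1))).
  assert (Y2 := Rabs_triang (((exp a - 1 - a) + a) * sin b) (sin b - b)).
  assert (e * r <= eps / 10 * r) by (apply Rmult_le_compat_r; lra).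
  assert (0 <= eps * r) by (apply Rmult_le_pos; lra).
  lra.
Qed.

Lemma Cexp_deriv (z : C) : Cderiv Cexp z (Cexp z).
Proof.
  intros eps Heps. assert (Hz : 0 < Cmod (Cexp z)) by apply Cmod_gt_0, Cexp_neq_0.
  destruct (Cexp_deriv_0 (eps / Cmod (Cexp z))) as (d & Hd & H); [now apply Rdiv_lt_0_compat|].
  exists d. split; [exact Hd|]. intros h Hh. specialize (H h Hh).
  rewrite Cplus_0_l, Cexp_0 in H. rewrite Cexp_plus.
  replace (Cexp z * Cexp h - Cexp z - h * Cexp z)%C with (Cexp z * (Cexp h - 1 - h * 1))%C by ring.
  rewrite Cmod_mult.
  apply Rle_trans with (Cmod (Cexp z) * (eps / Cmod (Cexp z) * Cmod h)).
  - apply Rmult_le_compat_l; lra.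
  - apply Req_le. field. lra.
Qed.

(** Expanding F at L w along k = L (w + h) - L w gives h = k d + o(k); continuity of L makes k
    small, and d nonzero makes k comparable with h. *)
Lemma Cderiv_inverse (F L : C -> C) (w d : C) : d <> 0%C -> Cderiv F (L w) d ->
  (forall eps, 0 < eps -> exists delta, 0 < delta /\ forall h, Cmod h < delta ->
     Cmod (L (w + h) - L w)%C < eps) ->
  (exists delta, 0 < delta /\ forall h, Cmod h < delta -> F (L (w + h)%C) = (w + h)%C) ->
  Cderiv L w (/ d).
Proof.
  intros Hd HF HL (d0 & Hd0 & Hinv) eps Heps.
  assert (Hdm : 0 < Cmod d) by now apply Cmod_gt_0.
  (* The first bound yields |d| |k| <= 2 |h|; the second turns the error eta |k| / |d| into eps
     |h|. *)
  set (eta := Rmin (Cmod d / 2) (eps * (Cmod d) ^ 2 / 2)).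
  assert (Heta : 0 < eta).
  { apply Rmin_pos; [lra|]. apply Rdiv_lt_0_compat; [|lra].
    apply Rmult_lt_0_compat; [lra|now apply pow_lt]. }
  assert (Heta1 : eta <= Cmod d / 2) by apply Rmin_l.
  assert (Heta2 : eta <= eps * (Cmod d) ^ 2 / 2) by apply Rmin_r.
  destruct (HF eta Heta) as (d1 & Hd1 & H1). destruct (HL d1 Hd1) as (d2 & Hd2 & H2).
  exists (Rmin d0 d2). split; [now apply Rmin_pos|]. intros h Hh.
  assert (Hh0 : Cmod h < d0) by (eapply Rlt_le_trans; [exact Hh|apply Rmin_l]).
  assert (Hh2 : Cmod h < d2) by (eapply Rlt_le_trans; [exact Hh|apply Rmin_r]).
  set (k := (L (w + h) - L w)%C). specialize (H1 k (H2 h Hh2)).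
  replace (L w + k)%C with (L (w + h)%C) in H1 by (unfold k; ring).
  rewrite (Hinv h Hh0) in H1.
  assert (Hw : F (L w) = w).
  { specialize (Hinv 0%C). rewrite Cplus_0_r in Hinv. apply Hinv. now rewrite Cmod_0. }
  rewrite Hw in H1. replace (w + h - w - k * d)%C with (h - k * d)%C in H1 by ring.
  assert (Hk : Cmod d * Cmod k <= 2 * Cmod h).
  { assert (H3 := Cmod_triangle h (k * d - h)%C). replace (h + (k * d - h))%C with (k * d)%C in H3 by ring.
    replace (k * d - h)%C with (- (h - k * d))%C in H3 by ring. rewrite Cmod_opp, Cmod_mult in H3.
    assert (H4 := Cmod_ge_0 k). nra. }
  replace (k - h * / d)%C with (- ((h - k * d) * / d))%C by (field; exact Hd).
  rewrite Cmod_opp, Cmod_mult, Cmod_inv by exact Hd.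
  apply Rmult_le_reg_r with (Cmod d); [exact Hdm|].
  rewrite Rmult_assoc, Rinv_l, Rmult_1_r by lra.
  eapply Rle_trans; [exact H1|].
  assert (H5 := Cmod_ge_0 k).
  apply Rle_trans with (eps * (Cmod d) ^ 2 / 2 * Cmod k); [apply Rmult_le_compat_r; lra|].
  replace (eps * Cmod d ^ 2 / 2 * Cmod k) with (eps * Cmod d / 2 * (Cmod d * Cmod k)) by field.
  replace (eps * Cmod h * Cmod d) with (eps * Cmod d / 2 * (2 * Cmod h)) by field.
  apply Rmult_le_compat_l; [|exact Hk]. nra.
Qed.

Lemma Carg_cos_sin (w : C) : w <> 0%C ->
  Cmod w * cos (Carg w) = Re w /\ Cmod w * sin (Carg w) = Im w.
Proof.
  intros Hw. assert (Hm : 0 < Cmod w) by now apply Cmod_gt_0.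
  assert (Hx : -1 <= Re w / Cmod w <= 1).
  { assert (H := re_le_Cmod w). apply Rabs_le_between in H.
    split; apply Rmult_le_reg_r with (Cmod w); try exact Hm; unfold Rdiv;
      rewrite Rmult_assoc, Rinv_l; lra. }
  assert (Hs : Cmod w * sin (acos (Re w / Cmod w)) = Rabs (Im w)).
  { rewrite sin_acos by exact Hx.
    rewrite <- (sqrt_pow2 (Cmod w)) at 1 by lra.
    rewrite <- sqrt_mult_alt by apply pow2_ge_0.
    replace (Cmod w ^ 2 * (1 - (Re w / Cmod w)²)) with (Im w ^ 2).
    - rewrite <- pow2_abs. apply sqrt_pow2, Rabs_pos.
    - unfold Rsqr. assert (H := Cmod_sqr w).
      replace (Cmod w ^ 2 * (1 - Re w / Cmod w * (Re w / Cmod w))) with (Cmod w ^ 2 - Re w ^ 2) by (field; lra).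
      lra. }
  unfold Carg. destruct (Rle_dec 0 (Im w)) as [H|H].
  - rewrite cos_acos by exact Hx. split; [field; lra|]. rewrite Hs. apply Rabs_pos_eq, H.
  - rewrite cos_neg, sin_neg, cos_acos by exact Hx. split; [field; lra|].
    rewrite <- Ropp_mult_distr_r, Hs, Rabs_left; lra.
Qed.

Lemma Cexp_Clog (w : C) : w <> 0%C -> Cexp (Clog w) = w.
Proof.
  intros Hw. destruct (Carg_cos_sin w Hw) as [H1 H2].
  unfold Cexp, Clog. simpl. rewrite exp_ln by now apply Cmod_gt_0.
  rewrite H1, H2. now destruct w.
Qed.

Lemma Clog_1 : Clog 1 = 0%C.
Proof.
  unfold Clog, Carg. rewrite Cmod_1, ln_1. simpl.
  destruct (Rle_dec 0 0) as [_|H]; [|lra].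
  replace (1 / 1) with 1 by field. now rewrite acos_1.
Qed.

(** In the right half-plane this replaces the definition by cases on the sign of the imaginary part
    with one formula that is visibly continuous across the positive real axis. *)
Lemma Carg_atan (w : C) : 0 < Re w -> Carg w = atan (Im w / Re w).
Proof.
  intros Hw. assert (Hw0 : w <> 0%C) by (intros ->; simpl in Hw; lra).
  assert (Hm : 0 < Cmod w) by now apply Cmod_gt_0.
  destruct (Carg_cos_sin w Hw0) as [H1 H2].
  assert (Hcos : 0 < cos (Carg w)).
  { apply Rmult_lt_reg_l with (Cmod w); [exact Hm|]. lra. }
  assert (Hb : - (PI / 2) < Carg w < PI / 2).
  { assert (HA : - PI <= Carg w <= PI).
    { assert (Hac := acos_bound (Re w / Cmod w)). unfold Carg.
      destruct (Rle_dec 0 (Im w)); lra. }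
    split; apply Rnot_le_lt; intros Hle.
    - assert (cos (- Carg w) <= 0) by (apply cos_le_0; lra). rewrite cos_neg in *. lra.
    - assert (cos (Carg w) <= 0) by (apply cos_le_0; lra). lra. }
  rewrite <- (atan_tan (Carg w)) by exact Hb. f_equal. unfold tan.
  rewrite <- H1, <- H2. field. split; lra.
Qed.

Lemma Clog_continuous (w : C) : 0 < Re w ->
  forall eps, 0 < eps -> exists delta, 0 < delta /\ forall h, Cmod h < delta ->
     Cmod (Clog (w + h) - Clog w)%C < eps.
Proof.
  intros Hw eps Heps.
  set (G := fun w : C => (ln (fst w ^ 2 + snd w ^ 2) / 2, atan (snd w / fst w)) : C).
  assert (HG : forall v : C, 0 < Re v -> Clog v = G v).
  { intros v Hv. unfold Clog, G. rewrite Carg_atan by exact Hv. f_equal.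
    change (ln (Cmod v) = ln (Re v ^ 2 + Im v ^ 2) / 2). rewrite <- Cmod_sqr.
    assert (0 < Cmod v). { apply Cmod_gt_0. intros ->. simpl in Hv. lra. }
    simpl. rewrite Rmult_1_r, ln_mult by assumption. field. }
  assert (Hcont1 : @continuous (prod_UniformSpace R_UniformSpace R_UniformSpace) R_UniformSpace
     (fun w : R * R => ln (fst w ^ 2 + snd w ^ 2) / 2) w).
  { assert (Hp : 0 < fst w ^ 2 + snd w ^ 2).
    { unfold Re in Hw. assert (0 < fst w ^ 2) by now apply pow_lt.
      assert (Hsn := pow2_ge_0 (snd w)). lra. }
    apply (continuous_comp (fun w : R * R => fst w ^ 2 + snd w ^ 2) (fun x => ln x / 2)).
    - apply (continuous_plus (V := R_NormedModule) (fun w : R * R => fst w ^ 2) (fun w : R * R => snd w ^ 2)).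
      + apply (continuous_comp (@fst R R) (fun x => x ^ 2)); [apply continuous_fst|].
        apply (ex_derive_continuous (fun x => x ^ 2)). auto_derive. trivial.
      + apply (continuous_comp (@snd R R) (fun x => x ^ 2)); [apply continuous_snd|].
        apply (ex_derive_continuous (fun x => x ^ 2)). auto_derive. trivial.
    - apply (ex_derive_continuous (fun x => ln x / 2)). auto_derive. exact Hp. }
  assert (Hcont2 : @continuous (prod_UniformSpace R_UniformSpace R_UniformSpace) R_UniformSpace
     (fun w : R * R => atan (snd w / fst w)) w).
  { apply (continuous_comp (fun w : R * R => snd w / fst w) atan).
    - apply (continuous_mult (K := R_AbsRing) (fun w : R * R => snd w) (fun w : R * R => / fst w)).
      + apply continuous_snd.
      + apply (continuous_comp (@fst R R) Rinv); [apply continuous_fst|].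
        apply (ex_derive_continuous Rinv). unfold Re in Hw.
        apply (ex_derive_inv (fun x => x)); [apply ex_derive_id|lra].
    - apply (ex_derive_continuous atan). eexists. apply is_derive_atan. }
  assert (He2 : 0 < eps / 2) by lra.
  specialize (Hcont1 (ball _ (eps / 2)) (locally_ball _ (mkposreal _ He2))).
  specialize (Hcont2 (ball _ (eps / 2)) (locally_ball _ (mkposreal _ He2))).
  destruct Hcont1 as [d1 H1]. destruct Hcont2 as [d2 H2].
  exists (Rmin (Re w) (Rmin d1 d2)).
  split; [apply Rmin_pos; [exact Hw|apply Rmin_pos; apply cond_pos]|].
  intros h Hh.
  assert (K0 : Cmod h < Re w) by (eapply Rlt_le_trans; [exact Hh|apply Rmin_l]).
  assert (K1 : Cmod h < d1).
  { eapply Rlt_le_trans; [exact Hh|]. eapply Rle_trans; [apply Rmin_r|apply Rmin_l]. }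
  assert (K2 : Cmod h < d2).
  { eapply Rlt_le_trans; [exact Hh|]. eapply Rle_trans; [apply Rmin_r|apply Rmin_r]. }
  assert (Hr := re_le_Cmod h). assert (Hi := Rabs_Im_le h).
  assert (Hpos : 0 < Re (w + h)%C).
  { apply Rabs_le_between in Hr. change (0 < Re w + Re h). lra. }
  rewrite (HG w Hw), (HG (w + h)%C Hpos).
  assert (Hball : forall d, Cmod h < d -> @ball (prod_UniformSpace R_UniformSpace R_UniformSpace) w d (w + h)%C).
  { intros d Hd. split.
    - change (Rabs (fst w + fst h - fst w) < d).
      replace (fst w + fst h - fst w) with (Re h) by (unfold Re; ring). lra.
    - change (Rabs (snd w + snd h - snd w) < d).
      replace (snd w + snd h - snd w) with (Im h) by (unfold Im; ring). lra. }
  specialize (H1 _ (Hball d1 K1)). specialize (H2 _ (Hball d2 K2)).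
  eapply Rle_lt_trans; [apply Cmod_le_Rabs_plus|].
  assert (H1' : Rabs (Re (G (w + h)%C - G w)%C) < eps / 2) by exact H1.
  assert (H2' : Rabs (Im (G (w + h)%C - G w)%C) < eps / 2) by exact H2.
  lra.
Qed.

Lemma Clog_deriv (w : C) : 0 < Re w -> Cderiv Clog w (/ w).
Proof.
  intros Hw.
  assert (Hn : forall v : C, 0 < Re v -> v <> 0%C).
  { intros v Hv ->. simpl in Hv. lra. }
  apply (Cderiv_inverse Cexp).
  - now apply Hn.
  - rewrite <- (Cexp_Clog w) at 2 by now apply Hn. apply Cexp_deriv.
  - now apply Clog_continuous.
  - exists (Re w). split; [exact Hw|]. intros h Hh. apply Cexp_Clog, Hn.
    assert (Hr := re_le_Cmod h). apply Rabs_le_between in Hr.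
    change (0 < Re w + Re h). lra.
Qed.

(** * The differential equation *)

Lemma Cderiv_mult (f g : C -> C) (z df dg : C) : Cderiv f z df -> Cderiv g z dg ->
  Cderiv (fun z => f z * g z)%C z (df * g z + f z * dg)%C.
Proof.
  intros Hf Hg. apply Cderiv_iff_AbsRing in Hf. apply Cderiv_iff_AbsRing in Hg.
  apply Cderiv_iff_AbsRing. exact (@is_derive_mult C_AbsRing f g z df dg Hf Hg Cmult_comm).
Qed.

Lemma Cderiv_comp (f g : C -> C) (z df dg : C) : Cderiv f (g z) df -> Cderiv g z dg ->
  Cderiv (fun z => f (g z)) z (dg * df)%C.
Proof.
  intros Hf Hg. apply Cderiv_iff in Hf. apply Cderiv_iff_AbsRing in Hg. apply Cderiv_iff.
  exact (@is_derive_comp C_AbsRing C_NormedModule f g z df dg Hf Hg).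
Qed.

Lemma Cderiv_affine (a b z : C) : Cderiv (fun z => a + b * z)%C z b.
Proof.
  intros eps Heps. exists 1. split; [lra|]. intros h _.
  replace (a + b * (z + h) - (a + b * z) - h * b)%C with (RtoC 0) by ring.
  rewrite Cmod_0. apply Rmult_le_pos; [lra|apply Cmod_ge_0].
Qed.

Lemma Cderiv_ext (f g : C -> C) (z l : C) : (forall z, f z = g z) -> Cderiv f z l -> Cderiv g z l.
Proof.
  intros E H eps Heps. destruct (H eps Heps) as (d & Hd & Hh). exists d. split; [exact Hd|].
  intros h Hlt. rewrite <- !E. now apply Hh.
Qed.

Lemma Cderiv_pow (f : C -> C) (z df : C) (m : nat) : Cderiv f z df ->
  Cderiv (fun z => f z ^ m)%C z (RtoC (INR m) * f z ^ (pred m) * df)%C.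
Proof.
  intros Hf. induction m as [|m IH].
  - apply Cderiv_ext with (fun z => 1 + 0 * z)%C; [intros; simpl; ring|].
    simpl. replace (0 * 1 * df)%C with (RtoC 0) by ring. apply Cderiv_affine.
  - assert (H := Cderiv_mult _ _ _ _ _ Hf IH).
    replace (RtoC (INR (S m)) * f z ^ pred (S m) * df)%C
      with (df * f z ^ m + f z * (RtoC (INR m) * f z ^ pred m * df))%C; [exact H|].
    rewrite S_INR, RtoC_plus. destruct m as [|m]; simpl; ring.
Qed.

Lemma Cderiv_Cinv (z : C) : z <> 0%C -> Cderiv Cinv z (- / (z * z))%C.
Proof.
  intros Hz eps Heps. assert (Hm : 0 < Cmod z) by now apply Cmod_gt_0.
  assert (Hm3 : 0 < Cmod z ^ 3) by now apply pow_lt.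
  exists (Rmin (Cmod z / 2) (eps * Cmod z ^ 3 / 2)). split.
  { apply Rmin_pos; [lra|]. apply Rdiv_lt_0_compat; [|lra]. now apply Rmult_lt_0_compat. }
  intros h Hh.
  assert (H1 : Cmod h < Cmod z / 2) by (eapply Rlt_le_trans; [exact Hh|apply Rmin_l]).
  assert (H2 : Cmod h < eps * Cmod z ^ 3 / 2) by (eapply Rlt_le_trans; [exact Hh|apply Rmin_r]).
  assert (H3 : Cmod z / 2 < Cmod (z + h)).
  { assert (H := Cmod_triangle (z + h) (- h)). rewrite Cmod_opp in H.
    replace (z + h + - h)%C with z in H by ring. lra. }
  assert (Hzh : (z + h)%C <> 0%C) by (apply Cmod_gt_0; lra).
  replace (/ (z + h) - / z - h * - / (z * z))%C with (h * h * / ((z + h) * (z * z)))%C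
    by (field; split; assumption).
  assert (Hzz : ((z + h) * (z * z))%C <> 0%C) by (repeat apply Cmult_neq_0; assumption).
  rewrite !Cmod_mult, Cmod_inv by exact Hzz. rewrite !Cmod_mult.
  assert (Hh0 := Cmod_ge_0 h).
  assert (Hden : Cmod z ^ 3 / 2 <= Cmod (z + h) * (Cmod z * Cmod z)) by nra.
  apply Rmult_le_reg_r with (Cmod (z + h) * (Cmod z * Cmod z)); [nra|].
  rewrite Rmult_assoc, Rinv_l, Rmult_1_r by nra.
  apply Rle_trans with (eps * Cmod h * (Cmod z ^ 3 / 2)); [nra|].
  apply Rmult_le_compat_l; [|exact Hden]. apply Rmult_le_pos; lra.
Qed.

Lemma Cpower_neq_0 (w : C) (s : R) : Cpower w s <> 0%C.
Proof. apply Cexp_neq_0. Qed.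

Lemma Cpower_1 (s : R) : Cpower 1 s = 1%C.
Proof.
  unfold Cpower. rewrite Clog_1, Cmult_0_r. apply Cexp_0.
Qed.

Lemma Cpower_opp (w : C) (s : R) : (Cpower w s * Cpower w (- s))%C = 1%C.
Proof.
  unfold Cpower. rewrite <- Cexp_plus, RtoC_opp.
  replace (RtoC s * Clog w + - RtoC s * Clog w)%C with (RtoC 0) by ring. apply Cexp_0.
Qed.

Lemma Cpower_deriv (w : C) (s : R) : 0 < Re w ->
  Cderiv (fun w => Cpower w s) w (RtoC s * Cpower w s / w)%C.
Proof.
  intros Hw.
  assert (H1 := Clog_deriv w Hw).
  assert (H2 : Cderiv (fun v => RtoC s * v)%C (Clog w) (RtoC s)).
  { apply Cderiv_ext with (fun v => 0 + RtoC s * v)%C; [intros; ring|]. apply Cderiv_affine. }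
  assert (H3 := Cderiv_comp _ _ _ _ _ H2 H1).
  assert (H4 := Cderiv_comp Cexp _ _ _ _ (Cexp_deriv _) H3).
  replace (RtoC s * Cpower w s / w)%C with (/ w * RtoC s * Cpower w s)%C
    by (unfold Cdiv; ring). exact H4.
Qed.

Lemma Cderiv_continuous (f : C -> C) (z l : C) : Cderiv f z l ->
  forall eps, 0 < eps -> exists d, 0 < d /\ forall h, Cmod h < d ->
    Cmod (f (z + h) - f z)%C < eps.
Proof.
  intros H eps Heps. destruct (H 1 Rlt_0_1) as (d & Hd & Hf).
  assert (Hl := Cmod_ge_0 l).
  exists (Rmin d (eps / (2 + Cmod l))). split.
  { apply Rmin_pos; [exact Hd|]. apply Rdiv_lt_0_compat; lra. }
  intros h Hh.
  assert (H1 : Cmod h < d) by (eapply Rlt_le_trans; [exact Hh|apply Rmin_l]).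
  assert (H2 : Cmod h < eps / (2 + Cmod l)) by (eapply Rlt_le_trans; [exact Hh|apply Rmin_r]).
  specialize (Hf h H1).
  assert (H3 := Cmod_triangle (f (z + h) - f z - h * l)%C (h * l)%C).
  replace (f (z + h) - f z - h * l + h * l)%C with (f (z + h) - f z)%C in H3 by ring.
  rewrite Cmod_mult in H3.
  assert (H4 : Cmod h * (2 + Cmod l) < eps).
  { apply Rmult_lt_compat_r with (r := 2 + Cmod l) in H2; [|lra].
    unfold Rdiv in H2. rewrite Rmult_assoc, Rinv_l, Rmult_1_r in H2 by lra. exact H2. }
  assert (H5 := Cmod_ge_0 h). nra.
Qed.

(** * Complex-valued functions of a real variable, along rays *)

Lemma is_derive_of_increment (f : R -> R) (x l : R) :
  (forall eps, 0 < eps -> exists d, 0 < d /\ forall h, Rabs h < d ->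
    Rabs (f (x + h) - f x - h * l) <= eps * Rabs h) -> is_derive f x l.
Proof.
  intros H. apply is_derive_Reals. intros eps Heps.
  destruct (H (eps / 2)) as (d & Hd & Hf); [lra|].
  exists (mkposreal d Hd). intros h Hh0 Hh. specialize (Hf h Hh).
  assert (Hp := Rabs_pos_lt h Hh0).
  replace ((f (x + h) - f x) / h - l) with ((f (x + h) - f x - h * l) * / h) by (field; exact Hh0).
  rewrite Rabs_mult, Rabs_inv. apply Rmult_lt_reg_r with (Rabs h); [exact Hp|].
  rewrite Rmult_assoc, Rinv_l by lra. nra.
Qed.

(** Componentwise derivative: a function with zero derivative on a segment can then be shown
    constant by the real theorem applied to both components. *)
Definition RCderiv (h : R -> C) (r : R) (l : C) : Prop :=
  is_derive (fun r => Re (h r)) r (Re l) /\ is_derive (fun r => Im (h r)) r (Im l).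

Lemma RCderiv_ray (f : C -> C) (z l : C) (r : R) : Cderiv f (RtoC r * z)%C l ->
  RCderiv (fun r => f (RtoC r * z)%C) r (z * l)%C.
Proof.
  intros H.
  assert (Hinc : forall eps, 0 < eps -> exists d, 0 < d /\ forall h, Rabs h < d ->
    Cmod (f (RtoC (r + h) * z) - f (RtoC r * z) - RtoC h * (z * l))%C <= eps * Rabs h).
  { intros eps Heps. assert (Hz := Cmod_ge_0 z).
    destruct (H (eps / (1 + Cmod z))) as (d & Hd & Hf); [apply Rdiv_lt_0_compat; lra|].
    exists (d / (1 + Cmod z)). split; [apply Rdiv_lt_0_compat; lra|].
    intros h Hh. assert (Hh0 := Rabs_pos h).
    apply Rmult_lt_compat_r with (r := 1 + Cmod z) in Hh; [|lra].
    unfold Rdiv in Hh at 1. rewrite Rmult_assoc, Rinv_l, Rmult_1_r in Hh by lra.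
    specialize (Hf (RtoC h * z)%C). rewrite Cmod_mult, Cmod_R in Hf.
    assert (Hlt : Rabs h * Cmod z < d) by nra. specialize (Hf Hlt).
    replace (RtoC r * z + RtoC h * z)%C with (RtoC (r + h) * z)%C in Hf
      by (rewrite RtoC_plus; ring).
    replace (RtoC h * z * l)%C with (RtoC h * (z * l))%C in Hf by ring.
    eapply Rle_trans; [exact Hf|].
    replace (eps / (1 + Cmod z) * (Rabs h * Cmod z)) with (eps * Rabs h * (Cmod z / (1 + Cmod z))) by (field; lra).
    rewrite <- (Rmult_1_r (eps * Rabs h)) at 2. apply Rmult_le_compat_l; [nra|].
    apply Rmult_le_reg_r with (1 + Cmod z); [lra|].
    unfold Rdiv. rewrite Rmult_assoc, Rinv_l; lra. }
  split; apply is_derive_of_increment; intros eps Heps;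
    destruct (Hinc eps Heps) as (d & Hd & Hf); exists d; (split; [exact Hd|]);
    intros h Hh; specialize (Hf h Hh).
  - eapply Rle_trans; [|exact Hf]. eapply Rle_trans; [|apply re_le_Cmod].
    apply Req_le. f_equal. unfold Re. simpl. ring.
  - eapply Rle_trans; [|exact Hf]. eapply Rle_trans; [|apply Rabs_Im_le].
    apply Req_le. f_equal. unfold Im. simpl. ring.
Qed.

Lemma RCderiv_mult (f g : R -> C) (r : R) (df dg : C) : RCderiv f r df -> RCderiv g r dg ->
  RCderiv (fun r => f r * g r)%C r (df * g r + f r * dg)%C.
Proof.
  intros [Hf1 Hf2] [Hg1 Hg2].
  assert (M : forall (p q : R -> R) dp dq, is_derive p r dp -> is_derive q r dq ->
    is_derive (fun x => p x * q x) r (dp * q r + p r * dq)).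
  { intros p q dp dq Hp Hq. exact (is_derive_mult p q r dp dq Hp Hq Rmult_comm). }
  split.
  - assert (H := is_derive_minus _ _ _ _ _ (M _ _ _ _ Hf1 Hg1) (M _ _ _ _ Hf2 Hg2)).
    match goal with |- is_derive _ _ ?l => replace l with
      (minus (Re df * Re (g r) + Re (f r) * Re dg) (Im df * Im (g r) + Im (f r) * Im dg)) end.
    + exact H.
    + unfold minus, plus, opp, Re, Im. simpl. ring.
  - assert (H := is_derive_plus _ _ _ _ _ (M _ _ _ _ Hf1 Hg2) (M _ _ _ _ Hf2 Hg1)).
    match goal with |- is_derive _ _ ?l => replace l with
      (plus (Re df * Im (g r) + Re (f r) * Im dg) (Im df * Re (g r) + Im (f r) * Re dg)) end.
    + exact H.
    + unfold plus, Re, Im. simpl. ring.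
Qed.

Lemma RCderiv_zero_const (h : R -> C) (a b : R) : a < b ->
  (forall r, a <= r <= b -> RCderiv h r 0) -> h a = h b.
Proof.
  intros Hab H. apply injective_projections.
  - apply (eq_is_derive (V := R_NormedModule) (fun r => Re (h r)) a b); [|exact Hab].
    intros r Hr. apply (H r Hr).
  - apply (eq_is_derive (V := R_NormedModule) (fun r => Im (h r)) a b); [|exact Hab].
    intros r Hr. apply (H r Hr).
Qed.

Lemma Re_1_minus_pos (l : R) (z : C) : 0 <= l < 1 -> in_disk z -> 0 < Re (1 - RtoC l * z)%C.
Proof.
  intros Hl Hz. unfold in_disk in Hz. assert (H := re_le_Cmod z).
  apply Rabs_le_between in H.
  replace (Re (1 - RtoC l * z)%C) with (1 - l * Re z) by (unfold Re; simpl; ring). nra.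
Qed.

Lemma in_disk_scal (r : R) (z : C) : 0 <= r <= 1 -> in_disk z -> in_disk (RtoC r * z).
Proof.
  intros Hr Hz. unfold in_disk in *. rewrite Cmod_mult, Cmod_R, Rabs_pos_eq by lra.
  assert (H := Cmod_ge_0 z). nra.
Qed.

(** Brings [f_] into the parameter l, with both bases written literally as affine maps a + b z for
    differentiation. *)
Lemma f_factor (beta : R) (m : nat) : -1 < beta ->
  exists l, 0 < l < 1 /\ l ^ 2 * (INR m + beta + 2) = INR m + 1 /\ t_ beta m = l + / l /\
  forall z, f_ beta m z =
   ((1 + - / RtoC l * z) ^ m * Cpower (1 + - RtoC l * z) (- (INR m + 3 + beta)))%C.
Proof.
  intros Hb. destruct (t_eq beta m Hb) as (l & Hl & Hleq & Hl2 & Ht).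
  exists l. split; [exact Hl|]. split; [exact Hl2|]. split; [exact Ht|]. intros z.
  assert (Hm := pos_INR m).
  assert (H1 : 0 < sqrt (INR m + 1)) by (apply sqrt_lt_R0; lra).
  assert (H2 : 0 < sqrt (INR m + beta + 2)) by (apply sqrt_lt_R0; lra).
  assert (Hn : forall x : R, 0 < x -> RtoC x <> 0%C).
  { intros x Hx E. apply RtoC_inj in E. lra. }
  unfold f_. rewrite Hleq, RtoC_div by lra. f_equal.
  - f_equal. field. split; apply Hn; assumption.
  - f_equal; [|ring]. field. apply Hn; assumption.
Qed.

Lemma Cquadratic_factor (l : R) (z : C) : 0 < l ->
  (1 - RtoC (l + / l) * z + z ^ 2)%C = ((1 + - / RtoC l * z) * (1 + - RtoC l * z))%C.
Proof.
  intros Hl. rewrite RtoC_plus, RtoC_inv by lra.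
  assert (RtoC l <> 0%C) by (intros E; apply RtoC_inj in E; lra).
  field. assumption.
Qed.

Lemma f_deriv (beta l : R) (m : nat) (z : C) : 0 < l < 1 -> in_disk z ->
  Cderiv (fun z => (1 + - / RtoC l * z) ^ m * Cpower (1 + - RtoC l * z) (- (INR m + 3 + beta)))%C z
    (RtoC (INR m) * (1 + - / RtoC l * z) ^ pred m * - / RtoC l
       * Cpower (1 + - RtoC l * z) (- (INR m + 3 + beta))
     + (1 + - / RtoC l * z) ^ m * (- RtoC l * (RtoC (- (INR m + 3 + beta))
        * Cpower (1 + - RtoC l * z) (- (INR m + 3 + beta)) / (1 + - RtoC l * z))))%C.
Proof.
  intros Hl Hz.
  apply (Cderiv_mult (fun z => (1 + - / RtoC l * z) ^ m)%C
    (fun z => Cpower (1 + - RtoC l * z) (- (INR m + 3 + beta)))).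
  - apply (Cderiv_pow (fun z => 1 + - / RtoC l * z)%C), Cderiv_affine.
  - apply (Cderiv_comp (fun w => Cpower w (- (INR m + 3 + beta)))); [|apply Cderiv_affine].
    apply Cpower_deriv.
    replace (1 + - RtoC l * z)%C with (1 - RtoC l * z)%C by ring.
    apply Re_1_minus_pos; [lra|exact Hz].
Qed.

Lemma f_solves_ode (beta : R) (m : nat) : -1 < beta -> solves_ode beta (t_ beta m) (f_ beta m).
Proof.
  intros Hb. destruct (f_factor beta m Hb) as (l & Hl & Hl2 & Ht & Hf).
  assert (HD : forall z, in_disk z -> exists d, is_derive (K := C_AbsRing) (V := C_NormedModule) (f_ beta m) z d /\
    ((1 - RtoC (t_ beta m) * z + z ^ 2)%C <> 0%C -> f_ beta m z <> 0%C /\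
      (d / f_ beta m z)%C =
     ((RtoC (t_ beta m) - RtoC (3 + beta) * z) / (1 - RtoC (t_ beta m) * z + z^2))%C)).
  { intros z Hz. eexists. split.
    - apply Cderiv_iff.
      apply Cderiv_ext with (2 := f_deriv beta l m z Hl Hz). intros w. symmetry. apply Hf.
    - rewrite Ht, Hf, Cquadratic_factor by lra. intros Hq.
      assert (H1 : (1 + - / RtoC l * z)%C <> 0%C).
      { intros E. apply Hq. rewrite E. ring. }
      assert (H2 : (1 + - RtoC l * z)%C <> 0%C).
      { intros E. apply Hq. rewrite E. ring. }
      assert (HP := Cpower_neq_0 (1 + - RtoC l * z) (- (INR m + 3 + beta))).
      assert (Hpm := Cpow_nz _ m H1).
      split; [now apply Cmult_neq_0|].
      (* Rewrites m P^(m-1) as m P^m / P, so that a single power remains; for m = 0 both sides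
         vanish. *)
      assert (Hpred : (RtoC (INR m) * (1 + - / RtoC l * z) ^ pred m)%C
        = (RtoC (INR m) * (1 + - / RtoC l * z) ^ m / (1 + - / RtoC l * z))%C).
      { destruct m as [|k]; [simpl; unfold Cdiv; ring|]. simpl pred.
        change ((1 + - / RtoC l * z) ^ S k)%C with ((1 + - / RtoC l * z) * (1 + - / RtoC l * z) ^ k)%C.
        unfold Cdiv. rewrite (Cmult_comm (1 + _)%C), Cmult_assoc, <- Cmult_assoc, Cinv_r by exact H1.
        ring. }
      rewrite Hpred.
      assert (HL : RtoC l <> 0%C) by (intros E; apply RtoC_inj in E; lra).
      (* Eliminating beta through l^2 (m + beta + 2) = m + 1 leaves a rational identity in l, m and
         z. *)
      assert (Hbeta : beta = (INR m + 1) / (l * l) - INR m - 2).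
      { apply Rmult_eq_reg_l with (l ^ 2); [|nra]. field_simplify; [|lra]. lra. }
      assert (Hs : (INR m + 3 + beta) = (INR m + 1) / (l * l) + 1) by lra.
      assert (H3b : 3 + beta = (INR m + 1) / (l * l) - INR m + 1) by lra.
      set (Q := Cpower (1 + - RtoC l * z) (- (INR m + 3 + beta))) in *.
      assert (Hll : l * l <> 0) by nra.
      rewrite Hs, H3b. set (M := INR m) in *. clearbody M.
      rewrite RtoC_opp, !RtoC_plus, !RtoC_minus, RtoC_div by exact Hll.
      rewrite RtoC_plus, RtoC_mult, RtoC_inv by lra.
      set (P := ((1 + - / RtoC l * z) ^ m)%C) in *.
      clearbody P Q.
      assert (H1' : (RtoC l - z)%C <> 0%C).
      { intros E. apply H1. replace (1 + - / RtoC l * z)%C with (/ RtoC l * (RtoC l - z))%C by (field; exact HL).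
        rewrite E. ring. }
      field. repeat split; try assumption.
      + intros E. apply H1'. rewrite <- E. ring. }
  split.
  - intros z Hz. destruct (HD z Hz) as (d & Hd & _). now exists d.
  - intros z Hz Hq. destruct (HD z Hz) as (d & Hd & H). destruct (H Hq) as [H1 H2].
    split; [exact H1|]. rewrite (is_C_derive_unique _ _ _ Hd). exact H2.
Qed.

Lemma f_at_0 (beta : R) (m : nat) : -1 < beta -> f_ beta m 0%C = 1%C.
Proof.
  intros Hb. destruct (f_factor beta m Hb) as (l & _ & _ & _ & Hf). rewrite Hf.
  replace (1 + - / RtoC l * 0)%C with (RtoC 1) by ring.
  replace (1 + - RtoC l * 0)%C with (RtoC 1) by ring.
  rewrite Cpower_1, Cpow_1_l. ring.
Qed.

(** The zeros l and 1/l of the quadratic are real, so the ray from 0 to a non-real z avoids them.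
    Along it g / f has derivative zero and starts at 1. *)
Lemma ode_unique_off_axis (beta t l : R) (f g : C -> C) (z : C) : 0 < l -> t = l + / l ->
  solves_ode beta t f -> solves_ode beta t g -> f 0%C = 1%C -> g 0%C = 1%C ->
  in_disk z -> Im z <> 0 -> g z = f z.
Proof.
  intros Hl Ht [Hf1 Hf2] [Hg1 Hg2] Hf0 Hg0 Hz Him.
  assert (HL : RtoC l <> 0%C) by (intros E; apply RtoC_inj in E; lra).
  assert (Hq : forall r, 0 <= r <= 1 ->
    (1 - RtoC t * (RtoC r * z) + (RtoC r * z) ^ 2)%C <> 0%C).
  { intros r Hr E. rewrite Ht, Cquadratic_factor in E by exact Hl.
    assert (Hlin : forall x : R, (1 + - RtoC x * (RtoC r * z))%C <> 0%C).
    { intros x Ex. assert (E1 := f_equal Im Ex). assert (E2 := f_equal Re Ex).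
      destruct z as [a b]. unfold Re, Im in *. simpl in *.
      assert (E3 : x * r * b = 0) by lra. assert (E4 : x * r * a = 1) by lra.
      apply Rmult_integral in E3. destruct E3 as [E3|E3]; [|contradiction].
      rewrite E3 in E4. lra. }
    revert E. apply Cmult_neq_0; [|apply Hlin]. rewrite <- RtoC_inv by lra. apply Hlin. }
  set (k := fun w => (g w * / f w)%C).
  assert (Hk : forall r, 0 <= r <= 1 -> Cderiv k (RtoC r * z) 0).
  { intros r Hr. assert (Hrz := in_disk_scal r z Hr Hz).
    destruct (Hf2 _ Hrz (Hq r Hr)) as [Nf Ef]. destruct (Hg2 _ Hrz (Hq r Hr)) as [Ng Eg].
    destruct (Hf1 _ Hrz) as [df Df]. destruct (Hg1 _ Hrz) as [dg Dg].
    rewrite (is_C_derive_unique _ _ _ Df) in Ef. rewrite (is_C_derive_unique _ _ _ Dg) in Eg.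
    rewrite <- Ef in Eg. apply Cderiv_iff in Df. apply Cderiv_iff in Dg.
    set (w := (RtoC r * z)%C) in *.
    assert (H1 := Cderiv_comp Cinv f w _ _ (Cderiv_Cinv _ Nf) Df).
    assert (H2 := Cderiv_mult _ _ _ _ _ Dg H1).
    cbv beta in H2.
    match type of H2 with Cderiv _ _ ?d => assert (E : d = 0%C) end.
    { replace dg with (df / f w * g w)%C.
      - field. exact Nf.
      - rewrite <- Eg. field. exact Ng. }
    rewrite E in H2. exact H2. }
  assert (E : k (RtoC 0 * z)%C = k (RtoC 1 * z)%C).
  { apply (RCderiv_zero_const (fun r => k (RtoC r * z)%C) 0 1); [lra|].
    intros r Hr. assert (H := RCderiv_ray k z 0 r (Hk r Hr)).
    now rewrite Cmult_0_r in H. }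
  unfold k in E. rewrite Cmult_0_l, Cmult_1_l, Hf0, Hg0 in E.
  assert (Nf : f z <> 0%C).
  { destruct (Hf2 z Hz) as [Nf _]; [|exact Nf].
    assert (H := Hq 1 ltac:(lra)). now rewrite Cmult_1_l in H. }
  rewrite <- (Cmult_1_l (f z)). replace (RtoC 1) with (1 * / 1)%C by (field; apply C1_nz).
  rewrite E. field. exact Nf.
Qed.

(** On the real axis the segment from 0 may cross l, where the equation says nothing. Real points
    are reached as limits of z + i e, by continuity of both solutions. *)
Lemma ode_unique (beta t l : R) (f g : C -> C) (z : C) : 0 < l -> t = l + / l ->
  solves_ode beta t f -> solves_ode beta t g -> f 0%C = 1%C -> g 0%C = 1%C ->
  in_disk z -> g z = f z.
Proof.
  intros Hl Ht Hf Hg Hf0 Hg0 Hz.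
  destruct (Req_dec (Im z) 0) as [Him|Him];
    [|now apply (ode_unique_off_axis beta t l)].
  destruct (classic (g z = f z)) as [|Hne]; [assumption|exfalso].
  assert (He : 0 < Cmod (g z - f z)%C).
  { apply Cmod_gt_0. intros E. apply Hne. apply Ceq_minus. exact E. }
  assert (He2 : 0 < Cmod (g z - f z)%C / 2) by lra.
  destruct (proj1 Hf z Hz) as [df Df]. destruct (proj1 Hg z Hz) as [dg Dg].
  apply Cderiv_iff in Df. apply Cderiv_iff in Dg.
  destruct (Cderiv_continuous _ _ _ Df _ He2) as (d1 & Hd1 & H1).
  destruct (Cderiv_continuous _ _ _ Dg _ He2) as (d2 & Hd2 & H2).
  set (e := Rmin (Rmin d1 d2) (1 - Cmod z) / 2).
  assert (He0 : 0 < Rmin (Rmin d1 d2) (1 - Cmod z)).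
  { unfold in_disk in Hz. repeat apply Rmin_pos; lra. }
  assert (B1 := Rmin_l (Rmin d1 d2) (1 - Cmod z)). assert (B2 := Rmin_r (Rmin d1 d2) (1 - Cmod z)).
  assert (B3 := Rmin_l d1 d2). assert (B4 := Rmin_r d1 d2).
  set (h := (Ci * RtoC e)%C).
  assert (Hh : Cmod h = e).
  { unfold h. rewrite Cmod_mult, Cmod_Ci, Cmod_R, Rabs_pos_eq; unfold e; lra. }
  assert (Heq : g (z + h)%C = f (z + h)%C).
  { apply (ode_unique_off_axis beta t l); try assumption.
    - unfold in_disk. eapply Rle_lt_trans; [apply Cmod_triangle|]. rewrite Hh. unfold e. lra.
    - unfold h. replace (Im (z + Ci * RtoC e)%C) with (Im z + e) by (unfold Im; simpl; ring).
      rewrite Him. unfold e. lra. }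
  specialize (H1 h ltac:(rewrite Hh; unfold e; lra)).
  specialize (H2 h ltac:(rewrite Hh; unfold e; lra)). rewrite Heq in H2.
  assert (H3 := Cmod_triangle (f (z + h) - f z)%C (- (f (z + h) - g z))%C).
  rewrite Cmod_opp in H3.
  replace (f (z + h) - f z + - (f (z + h) - g z))%C with (g z - f z)%C in H3 by ring. lra.
Qed.

Lemma ode_part (beta : R) (m : nat) : -1 < beta ->
  solves_ode beta (t_ beta m) (f_ beta m) /\ f_ beta m 0%C = 1%C /\
  (forall g : C -> C, solves_ode beta (t_ beta m) g -> g 0%C = 1%C ->
        forall z : C, in_disk z -> g z = f_ beta m z).
Proof.
  intros Hb. split; [now apply f_solves_ode|]. split; [now apply f_at_0|].
  intros g Hg Hg0 z Hz. destruct (t_eq beta m Hb) as (l & Hl & _ & _ & Ht).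
  apply (ode_unique beta (t_ beta m) l); try assumption; [lra|now apply f_solves_ode|now apply f_at_0].
Qed.

(** * Taylor series in the disk *)

Lemma Re_sum_n (a : nat -> C) (n : nat) :
  Re (@sum_n C_AbelianMonoid a n) = sum_n (fun k => Re (a k)) n.
Proof.
  induction n as [|n IH]; [now rewrite !sum_O|].
  rewrite sum_Sn, sum_n_SR, <- IH. reflexivity.
Qed.

Lemma Im_sum_n (a : nat -> C) (n : nat) :
  Im (@sum_n C_AbelianMonoid a n) = sum_n (fun k => Im (a k)) n.
Proof.
  induction n as [|n IH]; [now rewrite !sum_O|].
  rewrite sum_Sn, sum_n_SR, <- IH. reflexivity.
Qed.

Lemma is_series_C_iff (a : nat -> C) (l : C) :
  @is_series C_AbsRing C_NormedModule a l <->
  is_series (fun n => Re (a n)) (Re l) /\ is_series (fun n => Im (a n)) (Im l).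
Proof.
  split.
  - intros H. split.
    + apply filterlim_ext with (fun n => fst (@sum_n C_AbelianMonoid a n)); [apply Re_sum_n|].
      apply (filterlim_comp _ _ _ _ (@fst R R) _ _ _ H).
      apply (continuous_fst (U := R_UniformSpace) (V := R_UniformSpace)).
    + apply filterlim_ext with (fun n => snd (@sum_n C_AbelianMonoid a n)); [apply Im_sum_n|].
      apply (filterlim_comp _ _ _ _ (@snd R R) _ _ _ H).
      apply (continuous_snd (U := R_UniformSpace) (V := R_UniformSpace)).
  - intros [H1 H2] P [eps HP].
    destruct (H1 _ (locally_ball _ eps)) as [N1 K1].
    destruct (H2 _ (locally_ball _ eps)) as [N2 K2].
    exists (Nat.max N1 N2). intros n Hn. apply HP. split.
    + specialize (K1 n ltac:(lia)). rewrite <- Re_sum_n in K1. exact K1.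
    + specialize (K2 n ltac:(lia)). rewrite <- Im_sum_n in K2. exact K2.
Qed.

Lemma pow_n_Cpow (z : C) (n : nat) : @pow_n C_Ring z n = (z ^ n)%C.
Proof. induction n as [|n IH]; [reflexivity|]. simpl. now rewrite IH. Qed.

Lemma is_pseries_C_iff (a : nat -> C) (z l : C) :
  @is_pseries C_AbsRing C_NormedModule a z l <->
  is_series (fun n => Re (z ^ n * a n)%C) (Re l) /\ is_series (fun n => Im (z ^ n * a n)%C) (Im l).
Proof.
  unfold is_pseries. rewrite is_series_C_iff.
  split; intros [H1 H2]; split.
  - apply is_series_ext with (2 := H1). intros n. rewrite <- pow_n_Cpow. reflexivity.
  - apply is_series_ext with (2 := H2). intros n. rewrite <- pow_n_Cpow. reflexivity.
  - apply is_series_ext with (2 := H1). intros n. rewrite <- pow_n_Cpow. reflexivity.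
  - apply is_series_ext with (2 := H2). intros n. rewrite <- pow_n_Cpow. reflexivity.
Qed.

Lemma CV_radius_ge_of_ex_pseries (a : nat -> R) (x : R) : ex_pseries a x ->
  Rbar_le (Rabs x) (CV_radius a).
Proof.
  intros H. apply Rbar_not_lt_le. intros Hlt.
  apply (CV_disk_outside a x Hlt).
  apply ex_series_lim_0. apply ex_series_ext with (2 := H).
  intros n. change (scal (pow_n x n) (a n)) with (pow_n x n * a n).
  rewrite pow_n_pow. apply Rmult_comm.
Qed.

Lemma is_series_lin (p q x y : R) (a b : nat -> R) : is_series a x -> is_series b y ->
  is_series (fun n => p * a n + q * b n) (p * x + q * y).
Proof.
  intros Ha Hb.
  exact (is_series_plus _ _ _ _ (is_series_scal_l p a x Ha) (is_series_scal_l q b y Hb)).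
Qed.

Lemma is_series_R_eq (a b : nat -> R) (x y : R) : is_series a x -> is_series b y ->
  (forall n, a n = b n) -> x = y.
Proof.
  intros Ha Hb E. rewrite <- (is_series_unique a x Ha), <- (is_series_unique b y Hb).
  now apply Series_ext.
Qed.

(** Restricting to real points and separating real and imaginary parts reduces the claim to
    uniqueness for real power series near 0. *)
Lemma has_taylor_unique (f : C -> C) (a b : nat -> C) (n : nat) :
  has_taylor f a -> has_taylor f b -> a n = b n.
Proof.
  intros Ha Hb.
  assert (Hdisk : forall x, Rabs x < 1 -> in_disk (RtoC x)).
  { intros x Hx. unfold in_disk. now rewrite Cmod_R. }
  assert (Hreal : forall (c : nat -> C) x, Rabs x < 1 -> has_taylor f c ->
    is_pseries (fun n => Re (c n)) x (Re (f (RtoC x))) /\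
    is_pseries (fun n => Im (c n)) x (Im (f (RtoC x)))).
  { intros c x Hx Hc. destruct (proj1 (is_pseries_C_iff _ _ _) (Hc _ (Hdisk x Hx))) as [H1 H2].
    split; apply is_pseries_R.
    - apply is_series_ext with (2 := H1). intros k. rewrite <- RtoC_pow, re_scal_l. apply Rmult_comm.
    - apply is_series_ext with (2 := H2). intros k. rewrite <- RtoC_pow, im_scal_l. apply Rmult_comm. }
  assert (Hrad : forall c, has_taylor f c ->
    Rbar_lt 0 (CV_radius (fun n => Re (c n))) /\ Rbar_lt 0 (CV_radius (fun n => Im (c n)))).
  (* Convergence at 1/2, or at any other point of (0, 1), gives a positive radius. *)
  { intros c Hc. assert (H2 : Rabs (/ 2) < 1) by (rewrite Rabs_pos_eq; lra).
    destruct (Hreal c (/ 2) H2 Hc) as [K1 K2].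
    assert (H0 : Rbar_lt 0 (Rabs (/ 2))) by (simpl; rewrite Rabs_pos_eq; lra).
    split; (eapply Rbar_lt_le_trans; [exact H0|]); apply CV_radius_ge_of_ex_pseries; eexists; eassumption. }
  assert (Hloc : locally 0 (fun x : R => Rabs x < 1)).
  { exists (mkposreal 1 Rlt_0_1). intros y Hy. change (Rabs (y - 0) < 1) in Hy.
    now rewrite Rminus_0_r in Hy. }
  apply injective_projections.
  - assert (E := PSeries_ext_recip (fun n => Re (a n)) (fun n => Re (b n)) n
      (proj1 (Hrad a Ha)) (proj1 (Hrad b Hb))).
    apply E. apply filter_imp with (2 := Hloc). intros x Hx.
    rewrite (is_pseries_unique _ _ _ (proj1 (Hreal a x Hx Ha))).
    now rewrite (is_pseries_unique _ _ _ (proj1 (Hreal b x Hx Hb))).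
  - assert (E := PSeries_ext_recip (fun n => Im (a n)) (fun n => Im (b n)) n
      (proj2 (Hrad a Ha)) (proj2 (Hrad b Hb))).
    apply E. apply filter_imp with (2 := Hloc). intros x Hx.
    rewrite (is_pseries_unique _ _ _ (proj2 (Hreal a x Hx Ha))).
    now rewrite (is_pseries_unique _ _ _ (proj2 (Hreal b x Hx Hb))).
Qed.

Lemma has_taylor_ext (f g : C -> C) (a b : nat -> C) :
  (forall z, in_disk z -> f z = g z) -> (forall n, a n = b n) ->
  has_taylor f a -> has_taylor g b.
Proof.
  intros Hfg Hab H z Hz. rewrite <- Hfg by exact Hz.
  apply is_pseries_ext with (2 := H z Hz). exact Hab.
Qed.

Lemma has_taylor_plus (f g : C -> C) (a b : nat -> C) : has_taylor f a -> has_taylor g b ->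
  has_taylor (fun z => f z + g z)%C (fun n => a n + b n)%C.
Proof. intros Ha Hb z Hz. exact (is_pseries_plus a b z _ _ (Ha z Hz) (Hb z Hz)). Qed.

Lemma has_taylor_scal (c : C) (f : C -> C) (a : nat -> C) : has_taylor f a ->
  has_taylor (fun z => c * f z)%C (fun n => c * a n)%C.
Proof. intros Ha z Hz. exact (is_pseries_scal c a z _ (Cmult_comm z c) (Ha z Hz)). Qed.

Definition shift (a : nat -> C) (n : nat) : C :=
  match n with O => 0%C | S k => a k end.

Lemma has_taylor_shift (f : C -> C) (a : nat -> C) : has_taylor f a ->
  has_taylor (fun z => z * f z)%C (shift a).
Proof.
  intros Ha z Hz.
  apply is_pseries_ext with (2 := is_pseries_incr_1 a z _ (Ha z Hz)). now intros [|n].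
Qed.

Definition unit_seq (n : nat) : C := match n with O => 1%C | S _ => 0%C end.

Lemma is_series_first_term (u : nat -> R) : (forall n, u (S n) = 0) -> is_series u (u 0%nat).
Proof.
  intros Hu. apply is_series_Reals. intros eps Heps. exists 0%nat. intros n _.
  replace (sum_f_R0 u n) with (u 0%nat).
  - unfold R_dist. now rewrite Rminus_diag, Rabs_R0.
  - induction n as [|n IH]; [reflexivity|]. simpl. rewrite <- IH, Hu. ring.
Qed.

Lemma has_taylor_1 : has_taylor (fun _ => 1%C) unit_seq.
Proof.
  intros z _. apply is_pseries_C_iff.
  split.
  - replace (Re 1) with (Re (z ^ 0 * unit_seq 0)%C) by (simpl; ring).
    apply (is_series_first_term (fun n => Re (z ^ n * unit_seq n)%C)). intros n. cbn [unit_seq].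
    rewrite Cmult_0_r. reflexivity.
  - replace (Im 1) with (Im (z ^ 0 * unit_seq 0)%C) by (simpl; ring).
    apply (is_series_first_term (fun n => Im (z ^ n * unit_seq n)%C)). intros n. cbn [unit_seq].
    rewrite Cmult_0_r. reflexivity.
Qed.

Lemma has_taylor_at_0 (f : C -> C) (a : nat -> C) : has_taylor f a -> f 0%C = a 0%nat.
Proof.
  intros H. assert (H0 : in_disk 0) by (unfold in_disk; rewrite Cmod_0; lra).
  assert (H1 := is_pseries_0 (K := C_AbsRing) (V := C_NormedModule) a).
  apply is_pseries_C_iff in H1. destruct H1 as [H1 H2].
  destruct (proj1 (is_pseries_C_iff _ _ _) (H _ H0)) as [K1 K2].
  apply injective_projections.
  - change (Re (f 0%C) = Re (a 0%nat)).
    now rewrite <- (is_series_unique _ _ H1), <- (is_series_unique _ _ K1).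
  - change (Im (f 0%C) = Im (a 0%nat)).
    now rewrite <- (is_series_unique _ _ H2), <- (is_series_unique _ _ K2).
Qed.

(** The closed form is binom(n + beta + 2, n) (beta + 2)^(-n/2), the binomial series of [fstar]. *)
Fixpoint fstar_coef (beta : R) (n : nat) : R :=
  match n with
  | O => 1
  | S k => (INR k + beta + 3) / (sqrt (beta + 2) * (INR k + 1)) * fstar_coef beta k
  end.

Lemma fstar_coef_S (beta : R) (n : nat) : fstar_coef beta (S n) =
  (INR n + beta + 3) / (sqrt (beta + 2) * (INR n + 1)) * fstar_coef beta n.
Proof. reflexivity. Qed.

Lemma sqrt_beta_gt_1 (beta : R) : -1 < beta -> 1 < sqrt (beta + 2).
Proof. intros Hb. rewrite <- sqrt_1. apply sqrt_lt_1_alt. lra. Qed.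

Lemma fstar_coef_pos (beta : R) (n : nat) : -1 < beta -> 0 < fstar_coef beta n.
Proof.
  intros Hb. assert (Hs := sqrt_beta_gt_1 beta Hb).
  induction n as [|n IH]; [simpl; lra|]. rewrite fstar_coef_S. assert (Hn := pos_INR n).
  apply Rmult_lt_0_compat; [|exact IH]. apply Rdiv_lt_0_compat; [lra|].
  apply Rmult_lt_0_compat; lra.
Qed.

Lemma fstar_coef_ratio (beta : R) : -1 < beta ->
  is_lim_seq (fun n => fstar_coef beta (S n) / fstar_coef beta n) (/ sqrt (beta + 2)).
Proof.
  intros Hb. assert (Hs := sqrt_beta_gt_1 beta Hb).
  assert (H := is_lim_seq_INR_ratio (beta + 3) 1).
  apply (is_lim_seq_scal_l _ (/ sqrt (beta + 2))) in H. simpl in H. rewrite Rmult_1_r in H.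
  apply is_lim_seq_ext with (2 := H). intros n. rewrite fstar_coef_S.
  assert (Hp := fstar_coef_pos beta n Hb). assert (Hn := pos_INR n). field. lra.
Qed.

Lemma inv_sqrt_beta_lt_1 (beta : R) : -1 < beta -> 0 < / sqrt (beta + 2) < 1.
Proof.
  intros Hb. assert (Hs := sqrt_beta_gt_1 beta Hb). split; [apply Rinv_0_lt_compat; lra|].
  rewrite <- Rinv_1. apply Rinv_lt_contravar; lra.
Qed.

Lemma fstar_coef_bounded (beta : R) : -1 < beta -> exists M, forall n, fstar_coef beta n <= M.
Proof.
  intros Hb. exists (Series (fstar_coef beta)). intros n.
  apply (term_le_Series (fstar_coef beta)); [intros k; now apply Rlt_le, fstar_coef_pos|].
  apply ex_series_of_ratio with (/ sqrt (beta + 2)); [now apply inv_sqrt_beta_lt_1| |now apply fstar_coef_ratio].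
  intros k. now apply fstar_coef_pos.
Qed.

Lemma PSeries_derive_shift (a : nat -> R) (r : R) : Rbar_lt (Rabs r) (CV_radius a) ->
  is_pseries (fun n => INR n * a n) r (r * Derive (PSeries a) r).
Proof.
  intros H. assert (H1 := is_pseries_incr_1 _ _ _ (is_pseries_derive a r H)).
  apply is_pseries_ext with (2 := H1). intros [|n]; [simpl; now rewrite Rmult_0_l|reflexivity].
Qed.

(* Along the ray through [z] the Taylor series [P] of [fstar] satisfies
   [P' (1 - r z s) = (beta + 3) s z P], so [P * (1 - r z s)^(beta+3)] is constant. *)
Lemma fstar_taylor (beta : R) : -1 < beta ->
  has_taylor (fstar beta) (fun n => RtoC (fstar_coef beta n)).
Proof.
  intros Hb z Hz. assert (Hs1 := inv_sqrt_beta_lt_1 beta Hb).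
  assert (Hsq := sqrt_beta_gt_1 beta Hb).
  set (s := / sqrt (beta + 2)) in *.
  assert (HA : forall n, fstar_coef beta (S n) = s * (INR n + beta + 3) / (INR n + 1) * fstar_coef beta n).
  { intros n. rewrite fstar_coef_S. unfold s. assert (Hn := pos_INR n). field. lra. }
  destruct (fstar_coef_bounded beta Hb) as [M HM].
  set (A := fstar_coef beta) in *.
  assert (HA0 : forall n, 0 < A n) by (intros n; now apply fstar_coef_pos).
  (* The coefficients of the restriction to the ray, a power series in the real variable r, whose
     components [dR] and [dI] are real series. *)
  set (d := fun n => (z ^ n * RtoC (A n))%C).
  set (dR := fun n => Re (d n)). set (dI := fun n => Im (d n)).
  assert (HdS : forall n, (RtoC (INR n + 1) * d (S n))%C = (RtoC (s * (INR n + beta + 3)) * (z * d n))%C).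
  { intros n. unfold d. rewrite HA. assert (Hn := pos_INR n).
    change (z ^ S n)%C with (z * z ^ n)%C.
    replace (RtoC (s * (INR n + beta + 3) / (INR n + 1) * A n))
      with (RtoC (s * (INR n + beta + 3)) / RtoC (INR n + 1) * RtoC (A n))%C
      by (rewrite <- RtoC_div, <- RtoC_mult by lra; reflexivity).
    field. intros E. apply RtoC_inj in E. lra. }
  assert (HdR : forall n, (INR n + 1) * dR (S n) = s * (INR n + beta + 3) * (Re z * dR n - Im z * dI n)).
  { intros n. assert (E := f_equal Re (HdS n)). rewrite !re_scal_l in E. exact E. }
  assert (HdI : forall n, (INR n + 1) * dI (S n) = s * (INR n + beta + 3) * (Re z * dI n + Im z * dR n)).
  { intros n. assert (E := f_equal Im (HdS n)). rewrite !im_scal_l in E.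
    unfold dI, dR. rewrite E. f_equal. }
  (* A radius above 1 with |z| r0 <= 1: the series along the ray converges beyond r = 1, so it can
     be differentiated on all of [0, 1]. *)
  set (r0 := 2 / (1 + Cmod z)).
  assert (Hz0 := Cmod_ge_0 z). unfold in_disk in Hz.
  assert (Hr0 : 1 < r0).
  { unfold r0. apply Rmult_lt_reg_r with (1 + Cmod z); [lra|].
    unfold Rdiv. rewrite Rmult_assoc, Rinv_l; lra. }
  assert (Hr0z : Cmod z * r0 <= 1).
  { unfold r0. apply Rmult_le_reg_r with (1 + Cmod z); [lra|].
    unfold Rdiv. rewrite !Rmult_assoc, Rinv_l; lra. }
  assert (Hdb : forall n, Cmod (d n) * r0 ^ n <= M).
  { intros n. unfold d. rewrite Cmod_mult, Cmod_pow, Cmod_R, Rabs_pos_eq by (apply Rlt_le, HA0).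
    replace (Cmod z ^ n * A n * r0 ^ n) with ((Cmod z * r0) ^ n * A n)
      by (rewrite Rpow_mult_distr; ring).
    assert (0 <= (Cmod z * r0) ^ n <= 1).
    { split; [apply pow_le, Rmult_le_pos; lra|]. rewrite <- (pow1 n).
      apply pow_incr. split; [apply Rmult_le_pos; lra|exact Hr0z]. }
    specialize (HM n). specialize (HA0 n). nra. }
  assert (Hrad : forall a : nat -> R, (forall n, Rabs (a n) <= Cmod (d n)) ->
    forall r, 0 <= r <= 1 -> Rbar_lt (Rabs r) (CV_radius a)).
  { intros a Ha r Hr. apply Rbar_lt_le_trans with r0; [simpl; rewrite Rabs_pos_eq; lra|].
    apply (proj1 (CV_radius_bounded a)). exists M. intros n.
    rewrite Rabs_mult, (Rabs_pos_eq (r0 ^ n)) by (apply pow_le; lra).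
    eapply Rle_trans; [|apply Hdb]. apply Rmult_le_compat_r; [apply pow_le; lra|apply Ha]. }
  assert (HradR := Hrad dR (fun n => re_le_Cmod (d n))).
  assert (HradI := Hrad dI (fun n => Rabs_Im_le (d n))).
  set (P := fun r => (PSeries dR r, PSeries dI r) : C).
  set (P' := fun r => (Derive (PSeries dR) r, Derive (PSeries dI) r) : C).
  assert (HP : forall r, 0 <= r <= 1 -> RCderiv P r (P' r)).
  { intros r Hr. split; unfold P, P'; simpl.
    - apply Derive_correct. eexists. apply is_derive_PSeries. now apply HradR.
    - apply Derive_correct. eexists. apply is_derive_PSeries. now apply HradI. }
  assert (HPode : forall r, 0 <= r <= 1 ->
    (P' r * (1 - RtoC s * (RtoC r * z)) = RtoC (s * (beta + 3)) * z * P r)%C).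
  { intros r Hr.
    assert (D1 := is_pseries_derive dR r (HradR r Hr)).
    assert (D2 := is_pseries_derive dI r (HradI r Hr)).
    assert (S1 := PSeries_derive_shift dR r (HradR r Hr)).
    assert (S2 := PSeries_derive_shift dI r (HradI r Hr)).
    assert (T1 := PSeries_correct dR r (CV_radius_inside dR r (HradR r Hr))).
    assert (T2 := PSeries_correct dI r (CV_radius_inside dI r (HradI r Hr))).
    (* The sums r P' + (beta + 3) P have coefficients (n + beta + 3) d n; multiplied by s z these
       are the coefficients of P', by the recursion [HdS]. *)
    assert (K1 := is_series_lin 1 (beta + 3) _ _ _ _
      (proj1 (is_pseries_R _ _ _) S1) (proj1 (is_pseries_R _ _ _) T1)).
    assert (K2 := is_series_lin 1 (beta + 3) _ _ _ _
      (proj1 (is_pseries_R _ _ _) S2) (proj1 (is_pseries_R _ _ _) T2)).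
    assert (E1 := is_series_R_eq _ _ _ _ (proj1 (is_pseries_R _ _ _) D1)
      (is_series_lin (s * Re z) (- (s * Im z)) _ _ _ _ K1 K2)).
    assert (E2 := is_series_R_eq _ _ _ _ (proj1 (is_pseries_R _ _ _) D2)
      (is_series_lin (s * Re z) (s * Im z) _ _ _ _ K2 K1)).
    cbv beta in E1, E2.
    specialize (E1 ltac:(intros n; unfold PS_derive; rewrite S_INR, HdR; ring)).
    specialize (E2 ltac:(intros n; unfold PS_derive; rewrite S_INR, HdI; ring)).
    unfold P, P'. set (p1 := Derive (PSeries dR) r) in *. set (p2 := Derive (PSeries dI) r) in *.
    set (q1 := PSeries dR r) in *. set (q2 := PSeries dI r) in *.
    apply injective_projections; unfold Re, Im in *; simpl; lra. }
  set (Q := fun r : R => Cpower (1 + - RtoC s * (RtoC r * z)) (beta + 3)).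
  assert (HQ : forall r, 0 <= r <= 1 -> RCderiv Q r
    (z * (- RtoC s * (RtoC (beta + 3) * Q r / (1 + - RtoC s * (RtoC r * z)))))%C).
  { intros r Hr. apply (RCderiv_ray (fun w => Cpower (1 + - RtoC s * w) (beta + 3))).
    apply (Cderiv_comp (fun w => Cpower w (beta + 3))); [|apply Cderiv_affine].
    apply Cpower_deriv.
    replace (1 + - RtoC s * (RtoC r * z))%C with (1 - RtoC s * (RtoC r * z))%C by ring.
    apply Re_1_minus_pos; [lra|]. now apply in_disk_scal. }
  assert (HPQ : (P 0 * Q 0 = P 1 * Q 1)%C).
  { apply (RCderiv_zero_const (fun r => P r * Q r)%C 0 1); [lra|].
    intros r Hr. assert (H := RCderiv_mult P Q r _ _ (HP r Hr) (HQ r Hr)).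
    match type of H with RCderiv _ _ ?d => replace (RtoC 0) with d; [exact H|] end.
    assert (Hd : (1 + - RtoC s * (RtoC r * z))%C <> 0%C).
    { intros E. assert (H0 := Re_1_minus_pos s (RtoC r * z)%C ltac:(lra) (in_disk_scal r z Hr Hz)).
      replace (1 - RtoC s * (RtoC r * z))%C with (1 + - RtoC s * (RtoC r * z))%C in H0 by ring.
      rewrite E in H0. simpl in H0. lra. }
    assert (Ho := HPode r Hr).
    replace (P' r) with (RtoC (s * (beta + 3)) * z * P r / (1 + - RtoC s * (RtoC r * z)))%C.
    - rewrite RtoC_mult. field. exact Hd.
    - rewrite <- Ho. field. exact Hd. }
  assert (HP0 : P 0 = 1%C).
  { assert (Hd0 : d 0%nat = 1%C) by (unfold d; change (A 0%nat) with 1; simpl; ring).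
    unfold P. rewrite !PSeries_0. unfold dR, dI. now rewrite Hd0. }
  assert (HQ0 : Q 0 = 1%C).
  { unfold Q. replace (1 + - RtoC s * (RtoC 0 * z))%C with (RtoC 1) by ring. apply Cpower_1. }
  assert (HP1 : P 1 = fstar beta z).
  { unfold fstar. assert (E : (1 - z / RtoC (sqrt (beta + 2)))%C = (1 + - RtoC s * (RtoC 1 * z))%C).
    { unfold s. rewrite RtoC_inv by lra. unfold Cdiv. ring. }
    rewrite E.
    assert (Hinv := Cpower_opp (1 + - RtoC s * (RtoC 1 * z)) (beta + 3)). fold (Q 1) in Hinv.
    set (Q' := Cpower (1 + - RtoC s * (RtoC 1 * z)) (- (beta + 3))) in *.
    transitivity (P 1 * (Q 1 * Q'))%C; [rewrite Hinv; ring|].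
    rewrite Cmult_assoc, <- HPQ, HP0, HQ0. ring. }
  rewrite <- HP1. apply is_pseries_C_iff.
  assert (H1 : 0 <= 1 <= 1) by lra.
  assert (T1 := PSeries_correct dR 1 (CV_radius_inside dR 1 (HradR 1 H1))).
  assert (T2 := PSeries_correct dI 1 (CV_radius_inside dI 1 (HradI 1 H1))).
  assert (T1' := proj1 (is_pseries_R _ _ _) T1). assert (T2' := proj1 (is_pseries_R _ _ _) T2). split.
  - apply is_series_ext with (2 := T1'). intros n. rewrite pow1. apply Rmult_1_r.
  - apply is_series_ext with (2 := T2'). intros n. rewrite pow1. apply Rmult_1_r.
Qed.

(** * Lower bound for the zeros *)

Definition wsum (beta : R) (a : nat -> C) (n : nat) : R := Cmod (a n) ^ 2 * bergman beta n.

Lemma wsum_nonneg (beta : R) (a : nat -> C) (n : nat) : -1 < beta -> 0 <= wsum beta a n.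
Proof.
  intros Hb. apply Rmult_le_pos; [apply pow2_ge_0|now apply Rlt_le, bergman_pos].
Qed.

Lemma Cmod_lin_sqr (p q u v : C) :
  Cmod (p * u + q * v) ^ 2 <= 2 * Cmod p ^ 2 * Cmod u ^ 2 + 2 * Cmod q ^ 2 * Cmod v ^ 2.
Proof.
  assert (H := Cmod_triangle (p * u) (q * v)). rewrite !Cmod_mult in H.
  assert (H0 := Cmod_ge_0 (p * u + q * v)).
  apply Rle_trans with ((Cmod p * Cmod u + Cmod q * Cmod v) ^ 2); [apply pow_incr; lra|].
  assert (H1 := pow2_ge_0 (Cmod p * Cmod u - Cmod q * Cmod v)). nra.
Qed.

Lemma wsum_lin (beta : R) (p q : C) (a b : nat -> C) : -1 < beta ->
  ex_series (wsum beta a) -> ex_series (wsum beta b) ->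
  ex_series (wsum beta (fun n => p * a n + q * b n)%C).
Proof.
  intros Hb Ha Hbs.
  apply ex_series_R_le with (fun n => 2 * Cmod p ^ 2 * wsum beta a n + 2 * Cmod q ^ 2 * wsum beta b n).
  - intros n. split; [now apply wsum_nonneg|]. unfold wsum.
    assert (H := Cmod_lin_sqr p q (a n) (b n)). assert (Hw := bergman_pos beta n Hb).
    apply Rmult_le_compat_r with (r := bergman beta n) in H; [|lra]. lra.
  - apply (ex_series_plus (V := R_NormedModule)).
    + exact (ex_series_scal_l (2 * Cmod p ^ 2) (wsum beta a) Ha).
    + exact (ex_series_scal_l (2 * Cmod q ^ 2) (wsum beta b) Hbs).
Qed.

Lemma wsum_shift_le (beta : R) (a : nat -> C) (n : nat) : -1 < beta ->
  0 <= wsum beta (shift a) (S n) <= wsum beta a n.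
Proof.
  intros Hb. split; [now apply wsum_nonneg|]. unfold wsum. simpl shift.
  apply Rmult_le_compat_l; [apply pow2_ge_0|now apply bergman_S_le].
Qed.

Lemma wsum_shift (beta : R) (a : nat -> C) : -1 < beta ->
  ex_series (wsum beta a) -> ex_series (wsum beta (shift a)).
Proof.
  intros Hb Ha. apply ex_series_incr_1. apply ex_series_R_le with (2 := Ha).
  intros n. now apply wsum_shift_le.
Qed.

Lemma wsum_unit (beta : R) : ex_series (wsum beta unit_seq).
Proof.
  eexists. apply is_series_first_term. intros n. unfold wsum. simpl unit_seq.
  rewrite Cmod_0. ring.
Qed.

(** * Polynomials and their products with Taylor series *)

Lemma is_poly_ext (n : nat) (p q : C -> C) : (forall z, p z = q z) -> is_poly n p -> is_poly n q.
Proof. intros E [c Hc]. exists c. intros z. now rewrite <- E. Qed.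

Lemma is_poly_0 (c : C) : is_poly 0 (fun _ => c).
Proof. exists (fun _ => c). intros z. rewrite sum_O. simpl. ring. Qed.

Lemma is_poly_widen (n : nat) (p : C -> C) : is_poly n p -> is_poly (S n) p.
Proof.
  intros [c Hc]. exists (fun k => if le_lt_dec k n then c k else 0%C). intros z.
  rewrite Hc, sum_Sn.
  assert (E : forall m, (m <= n)%nat ->
    @sum_n C_AbelianMonoid (fun k => c k * z ^ k)%C m
    = @sum_n C_AbelianMonoid (fun k => (if le_lt_dec k n then c k else 0) * z ^ k)%C m).
  { intros m Hm. apply sum_n_ext_loc. intros k Hk. destruct (le_lt_dec k n); [easy|lia]. }
  rewrite <- (E n (Nat.le_refl n)). destruct (le_lt_dec (S n) n); [lia|].
  rewrite Cmult_0_l. symmetry. apply Cplus_0_r.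
Qed.

Lemma is_poly_lin (n : nat) (a b : C) (p q : C -> C) : is_poly n p -> is_poly n q ->
  is_poly n (fun z => a * p z + b * q z)%C.
Proof.
  intros [c Hc] [d Hd]. exists (fun k => a * c k + b * d k)%C. intros z. rewrite Hc, Hd.
  clear Hc Hd. induction n as [|n IH].
  - rewrite !sum_O. ring.
  - rewrite !sum_Sn, <- IH.
    change (a * (@sum_n C_AbelianMonoid (fun k => c k * z ^ k)%C n + c (S n) * z ^ S n)
      + b * (@sum_n C_AbelianMonoid (fun k => d k * z ^ k)%C n + d (S n) * z ^ S n)
      = a * @sum_n C_AbelianMonoid (fun k => c k * z ^ k)%C n
        + b * @sum_n C_AbelianMonoid (fun k => d k * z ^ k)%C n
        + (a * c (S n) + b * d (S n)) * z ^ S n)%C. ring.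
Qed.

Lemma poly_horner (n : nat) (c : nat -> C) (z : C) :
  @sum_n C_AbelianMonoid (fun k => c k * z ^ k)%C (S n)
  = (c 0%nat + z * @sum_n C_AbelianMonoid (fun k => c (S k) * z ^ k)%C n)%C.
Proof.
  induction n as [|n IH].
  - rewrite sum_Sn, !sum_O. change (c 0%nat * z ^ 0 + c 1%nat * z ^ 1 = c 0%nat + z * (c 1%nat * z ^ 0))%C.
    simpl. ring.
  - rewrite sum_Sn, IH, (sum_Sn (fun k => c (S k) * z ^ k)%C).
    change (c 0%nat + z * @sum_n C_AbelianMonoid (fun k => c (S k) * z ^ k)%C n + c (S (S n)) * z ^ S (S n)
      = c 0%nat + z * (@sum_n C_AbelianMonoid (fun k => c (S k) * z ^ k)%C n + c (S (S n)) * z ^ S n))%C.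
    simpl. ring.
Qed.

Lemma is_poly_mul_z (n : nat) (p : C -> C) : is_poly n p -> is_poly (S n) (fun z => z * p z)%C.
Proof.
  intros [c Hc]. exists (shift c). intros z. rewrite poly_horner, Hc. simpl shift. ring.
Qed.

Lemma is_poly_S_inv (n : nat) (p : C -> C) : is_poly (S n) p ->
  exists c q, is_poly n q /\ forall z, p z = (c + z * q z)%C.
Proof.
  intros [c Hc]. exists (c 0%nat), (fun z => @sum_n C_AbelianMonoid (fun k => c (S k) * z ^ k)%C n).
  split; [now exists (fun k => c (S k))|]. intros z. now rewrite Hc, poly_horner.
Qed.

Lemma poly_factor (n : nat) (p : C -> C) (z0 : C) : is_poly (S n) p ->
  exists q, is_poly n q /\ forall z, (p z - p z0)%C = ((z - z0) * q z)%C.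
Proof.
  revert p. induction n as [|n IH]; intros p Hp;
    destruct (is_poly_S_inv _ _ Hp) as (c & p' & Hp' & E).
  - exists p'. split; [exact Hp'|]. intros z. rewrite !E.
    destruct Hp' as [d Hd]. rewrite !Hd, !sum_O. simpl. ring.
  - destruct (IH p' Hp') as (q' & Hq' & E').
    exists (fun z => 1 * p' z + z0 * q' z)%C. split.
    + apply is_poly_lin; [exact Hp'|now apply is_poly_widen].
    + intros z. rewrite !E.
      replace (c + z * p' z - (c + z0 * p' z0))%C with ((z - z0) * p' z + z0 * (p' z - p' z0))%C by ring.
      rewrite E'. ring.
Qed.

(** Horner's scheme reduces this to multiplication by z, which preserves the space because the
    weights are nonincreasing. *)
Lemma taylor_poly_mul (beta : R) (n : nat) (q f : C -> C) (a : nat -> C) : -1 < beta ->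
  is_poly n q -> has_taylor f a -> ex_series (wsum beta a) ->
  exists b, has_taylor (fun z => q z * f z)%C b /\ ex_series (wsum beta b).
Proof.
  intros Hb Hq Hf Ha. revert q Hq. induction n as [|n IH]; intros q Hq.
  - destruct Hq as [c Hc].
    exists (fun n => c 0%nat * a n + 0 * a n)%C. split; [|now apply wsum_lin].
    apply has_taylor_ext with (3 := has_taylor_scal (c 0%nat) f a Hf).
    + intros z _. rewrite Hc, sum_O. simpl. ring.
    + intros k. ring.
  - destruct (is_poly_S_inv _ _ Hq) as (c & q' & Hq' & E).
    destruct (IH q' Hq') as (b & Htb & Hsb).
    exists (fun n => c * a n + 1 * shift b n)%C. split; [|now apply wsum_lin; [| |apply wsum_shift]].
    apply has_taylor_ext with (3 := has_taylor_plus _ _ _ _ (has_taylor_scal c f a Hf)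
       (has_taylor_shift _ _ Htb)).
    + intros z _. rewrite E. ring.
    + intros k. ring.
Qed.

Lemma has_taylor_minus_1 (f : C -> C) (a : nat -> C) : has_taylor f a ->
  has_taylor (fun z => f z - 1)%C (fun n => a n - unit_seq n)%C.
Proof.
  intros Hf. apply has_taylor_ext with
    (3 := has_taylor_plus _ _ _ _ Hf (has_taylor_scal (- 1) _ _ has_taylor_1)).
  - intros z _. ring.
  - intros n. ring.
Qed.

Lemma is_H2norm_Series (beta : R) (f : C -> C) (a : nat -> C) : -1 < beta ->
  has_taylor f a -> ex_series (wsum beta a) ->
  is_H2norm (bergman beta) f (sqrt (Series (wsum beta a))).
Proof.
  intros Hb Hf Ha. split; [apply sqrt_pos|]. exists a. split; [exact Hf|].
  rewrite pow2_sqrt; [exact (Series_correct _ Ha)|].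
  apply Rle_trans with (wsum beta a 0); [now apply wsum_nonneg|].
  apply term_le_Series; [intros; now apply wsum_nonneg|exact Ha].
Qed.

Lemma is_H2norm_eq (beta : R) (f : C -> C) (a : nat -> C) (N : R) :
  has_taylor f a -> is_H2norm (bergman beta) f N ->
  ex_series (wsum beta a) /\ N ^ 2 = Series (wsum beta a).
Proof.
  intros Hf (_ & b & Hb & Hs).
  assert (H : is_series (wsum beta a) (N ^ 2)).
  { apply is_series_ext with (2 := Hs). intros n. unfold wsum.
    now rewrite (has_taylor_unique f a b n Hf Hb). }
  split; [now exists (N ^ 2)|]. symmetry. now apply is_series_unique.
Qed.

Lemma optimal_le (beta : R) (f p q : C -> C) (n : nat) (c d : nat -> C) : -1 < beta ->
  is_optimal_approximant (bergman beta) f n p -> is_poly n q ->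
  has_taylor (fun z => p z * f z - 1)%C c -> has_taylor (fun z => q z * f z - 1)%C d ->
  ex_series (wsum beta d) -> ex_series (wsum beta c) /\ Series (wsum beta c) <= Series (wsum beta d).
Proof.
  intros Hb (_ & N & HN & Hmin) Hq Hc Hd Hds.
  destruct (is_H2norm_eq beta _ _ N Hc HN) as [Hcs E]. split; [exact Hcs|].
  assert (HM := is_H2norm_Series beta _ _ Hb Hd Hds).
  assert (Hle := Hmin q _ Hq HM). rewrite <- E.
  destruct HN as [HN0 _].
  apply Rle_trans with (sqrt (Series (wsum beta d)) ^ 2); [apply pow_incr; lra|].
  apply Req_le, pow2_sqrt.
  apply Rle_trans with (wsum beta d 0); [now apply wsum_nonneg|].
  apply term_le_Series; [intros; now apply wsum_nonneg|exact Hds].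
Qed.

(* AM-GM with the ratios of consecutive Taylor coefficients of [fstar], the
   positive eigenvector of the underlying Jacobi matrix. *)
Lemma cross_term_bound (beta : R) (x : nat -> R) (N : nat) : -1 < beta ->
  2 * sum_n (fun n => match n with O => 0 | S k => x (S k) * x k * bergman beta (S k) end) N
  <= (beta + 3) / sqrt (beta + 2) * sum_n (fun n => x n ^ 2 * bergman beta (S n)) N.
Proof.
  intros Hb. assert (Hs := sqrt_beta_gt_1 beta Hb).
  assert (Hs2 : sqrt (beta + 2) ^ 2 = beta + 2) by (apply pow2_sqrt; lra).
  set (s := sqrt (beta + 2)) in *.
  assert (Ht : 0 < (beta + 3) / s) by (apply Rdiv_lt_0_compat; lra).
  (* The induction carries a negative boundary term: it is the half of the next AM-GM inequality
     that falls on [x N]. *)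
  assert (H : 2 * sum_n (fun n => match n with O => 0 | S k => x (S k) * x k * bergman beta (S k) end) N
    <= (beta + 3) / s * sum_n (fun n => x n ^ 2 * bergman beta (S n)) N
      - x N ^ 2 * bergman beta (S N) * ((INR N + beta + 3) / (s * (INR N + 1)))).
  { induction N as [|N IH].
    - rewrite !sum_O. simpl INR. apply Req_le. field. lra.
    - rewrite !sum_n_SR, (Rmult_plus_distr_l 2), (Rmult_plus_distr_l ((beta + 3) / s)).
      assert (Hw := bergman_pos beta (S N) Hb). assert (HN := pos_INR N).
      (* The ratio of consecutive coefficients of [fstar], the weight for which AM-GM is sharp. *)
      set (r := (INR N + beta + 3) / (s * (INR N + 1))) in *.
      assert (Hr : 0 < r).
      { apply Rdiv_lt_0_compat; [lra|]. apply Rmult_lt_0_compat; lra. }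
      assert (Hag : 2 * (x (S N) * x N * bergman beta (S N))
        <= x N ^ 2 * bergman beta (S N) * r + x (S N) ^ 2 * bergman beta (S N) / r).
      { assert (E : x N ^ 2 * bergman beta (S N) * r + x (S N) ^ 2 * bergman beta (S N) / r
          - 2 * (x (S N) * x N * bergman beta (S N))
          = bergman beta (S N) / r * (r * x N - x (S N)) ^ 2) by (field; lra).
        assert (0 <= bergman beta (S N) / r * (r * x N - x (S N)) ^ 2); [|lra].
        apply Rmult_le_pos; [apply Rlt_le, Rdiv_lt_0_compat; lra|apply pow2_ge_0]. }
      (* The eigenvector equation for the coefficients of [fstar], divided by the middle
         coefficient. *)
      assert (E : x (S N) ^ 2 * bergman beta (S N) / r
        = (beta + 3) / s * (x (S N) ^ 2 * bergman beta (S (S N)))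
          - x (S N) ^ 2 * bergman beta (S (S N)) * ((INR (S N) + beta + 3) / (s * (INR (S N) + 1)))).
      { rewrite (bergman_S beta (S N) Hb), S_INR. unfold r.
        assert (Hbeta : beta = s ^ 2 - 2) by lra.
        apply Rmult_eq_reg_r with (s * (INR N + beta + 3)); [|apply Rmult_integral_contrapositive; split; lra].
        transitivity (x (S N) ^ 2 * bergman beta (S N) * (s ^ 2 * (INR N + 1))); [field; repeat split; lra|].
        rewrite Hs2. field. repeat split; lra. }
      lra. }
  assert (0 <= x N ^ 2 * bergman beta (S N) * ((INR N + beta + 3) / (s * (INR N + 1)))).
  { assert (Hw := bergman_pos beta (S N) Hb). assert (HN := pos_INR N).
    apply Rmult_le_pos; [apply Rmult_le_pos; [apply pow2_ge_0|lra]|].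
    apply Rlt_le, Rdiv_lt_0_compat; [lra|]. apply Rmult_lt_0_compat; lra. }
  lra.
Qed.

(** Expansion of the square, with Cauchy-Schwarz on the mixed term only. *)
Lemma Cmod_perturb (u v : C) (z0 : C) (e : R) : 0 <= e ->
  Cmod (RtoC (1 - e) * v - z0 * u) ^ 2
  <= Cmod (v - z0 * u) ^ 2 + (e ^ 2 - 2 * e) * Cmod v ^ 2 + 2 * e * Cmod z0 * (Cmod u * Cmod v).
Proof.
  intros He.
  set (w := (z0 * u)%C).
  assert (H : Re w * Re v + Im w * Im v <= Cmod w * Cmod v).
  { assert (H1 := re_le_Cmod (w * Cconj v)). rewrite Cmod_mult, Cmod_conj in H1.
    eapply Rle_trans; [|exact H1]. eapply Rle_trans; [|apply Rle_abs].
    apply Req_le. unfold Re, Im. simpl. ring. }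
  unfold w in H at 3. rewrite Cmod_mult in H. fold w.
  assert (E : Cmod (RtoC (1 - e) * v - w) ^ 2 = Cmod (v - w) ^ 2 + (e ^ 2 - 2 * e) * Cmod v ^ 2
     + 2 * e * (Re w * Re v + Im w * Im v)).
  { rewrite !Cmod_sqr. unfold Re, Im. simpl. ring. }
  rewrite E. nra.
Qed.

(** If p f vanished the residual would be -1, of norm 1, while the best constant multiple of f
    already comes strictly closer to 1. This guarantees g = q f nonzero in the lower bound. *)
Lemma optimal_not_zero (beta : R) (f p : C -> C) (n : nat) : -1 < beta ->
  in_H2 (bergman beta) f -> f 0%C <> 0%C ->
  is_optimal_approximant (bergman beta) f n p ->
  ~ (forall z, in_disk z -> (p z * f z)%C = 0%C).
Proof.
  intros Hb (a & Hf & Ha) Hf0 Hp Hz.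
  rewrite (has_taylor_at_0 f a Hf) in Hf0.
  change (ex_series (wsum beta a)) in Ha.
  assert (Hm : 0 < Cmod (a 0%nat)) by now apply Cmod_gt_0.
  set (H := Series (wsum beta a)).
  assert (HH : 0 < H).
  { apply Rlt_le_trans with (wsum beta a 0).
    - unfold wsum. rewrite bergman_0, Rmult_1_r. now apply pow_lt.
    - apply term_le_Series; [intros; now apply wsum_nonneg|exact Ha]. }
  (* The squared norm of the projection of 1 onto f; the constant [dl] below realises the projection
     and leaves the residual 1 - e. *)
  set (e := Cmod (a 0%nat) ^ 2 / H).
  assert (He : 0 < e) by (apply Rdiv_lt_0_compat; [now apply pow_lt|exact HH]).
  set (dl := (RtoC e / a 0%nat)%C).
  assert (Hq : is_poly n (fun _ => dl)).
  { induction n as [|n IH]; [apply is_poly_0|].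
    assert (H0 := is_poly_0 dl). clear -H0. induction (S n) as [|k IH]; [exact H0|now apply is_poly_widen]. }
  assert (Hc : has_taylor (fun z => p z * f z - 1)%C (fun n => - 1 * unit_seq n)%C).
  { apply has_taylor_ext with (3 := has_taylor_scal (- 1) _ _ has_taylor_1); [|reflexivity].
    intros z Hd. rewrite Hz by exact Hd. ring. }
  assert (Hd := has_taylor_minus_1 _ _ (has_taylor_scal dl f a Hf)).
  assert (Hds : ex_series (wsum beta (fun n => dl * a n - unit_seq n)%C)).
  { eapply ex_series_ext; [|apply (wsum_lin beta dl (- 1) a unit_seq Hb Ha (wsum_unit beta))].
    intros k. unfold wsum. now replace (dl * a k + - 1 * unit_seq k)%C with (dl * a k - unit_seq k)%C by ring. }
  destruct (optimal_le beta f p (fun _ => dl) n _ _ Hb Hp Hq Hc Hd Hds) as [Hcs Hle].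
  assert (H1 : 1 <= Series (wsum beta (fun n => - 1 * unit_seq n)%C)).
  { eapply Rle_trans; [|apply (term_le_Series _ 0); [intros; now apply wsum_nonneg|exact Hcs]].
    unfold wsum. rewrite bergman_0. simpl unit_seq.
    replace (- 1 * 1)%C with (- (1))%C by ring. rewrite Cmod_m1. lra. }
  assert (Hdm : Cmod dl ^ 2 * H = e).
  { unfold dl. rewrite Cmod_div by exact Hf0. rewrite Cmod_R, Rabs_pos_eq by lra.
    unfold e. field. split; lra. }
  assert (H2 : Series (wsum beta (fun n => dl * a n - unit_seq n)%C) = 1 - e).
  { rewrite (Series_incr_1 _ Hds).
    assert (Hsplit : Cmod dl ^ 2 * H = Cmod dl ^ 2 * wsum beta a 0
      + Series (fun n => Cmod dl ^ 2 * wsum beta a (S n))).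
    { unfold H. rewrite (Series_incr_1 _ Ha), Rmult_plus_distr_l, Series_scal_l. reflexivity. }
    assert (E0 : Cmod dl ^ 2 * wsum beta a 0 = e ^ 2).
    { unfold wsum, dl. rewrite bergman_0, Cmod_div by exact Hf0.
      rewrite Cmod_R, Rabs_pos_eq by lra. field. lra. }
    rewrite Hdm, E0 in Hsplit.
    assert (E1 : wsum beta (fun n => dl * a n - unit_seq n)%C 0 = (1 - e) ^ 2).
    { unfold wsum, dl. rewrite bergman_0. simpl unit_seq.
      replace (RtoC e / a 0%nat * a 0%nat - 1)%C with (RtoC (- (1 - e))).
      - rewrite Cmod_R, pow2_abs. ring.
      - rewrite RtoC_opp, RtoC_minus. field. exact Hf0. }
    rewrite E1. rewrite (Series_ext _ (fun n => Cmod dl ^ 2 * wsum beta a (S n))).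
    - lra.
    - intros k. unfold wsum. simpl unit_seq.
      replace (dl * a (S k) - 0)%C with (dl * a (S k))%C by ring.
      rewrite Cmod_mult, Rpow_mult_distr. ring. }
  lra.
Qed.

Lemma zero_modulus_ge (beta : R) (f p : C -> C) (n : nat) (z0 : C) : -1 < beta ->
  in_H2 (bergman beta) f -> f 0%C <> 0%C ->
  is_optimal_approximant (bergman beta) f n p -> p z0 = 0%C ->
  2 * sqrt (beta + 2) / (beta + 3) <= Cmod z0.
Proof.
  intros Hb Hf Hf0 Hp Hpz. apply Rnot_lt_le. intros Hlt.
  assert (Hnz := optimal_not_zero beta f p n Hb Hf Hf0 Hp).
  (* A constant polynomial with a zero is identically zero, which is already excluded. *)
  destruct n as [|n].
  { destruct (proj1 Hp) as [c Hc]. apply Hnz. intros z _.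
    rewrite Hc, sum_O in Hpz. rewrite Hc, sum_O. simpl in *.
    replace (c 0%nat) with (c 0%nat * 1)%C by ring. rewrite Hpz. ring. }
  destruct (poly_factor n p z0 (proj1 Hp)) as (q & Hq & Epq).
  assert (Ep : forall z, p z = ((z - z0) * q z)%C).
  { intros z. rewrite <- Epq, Hpz. ring. }
  destruct Hf as (a & Hfa & Ha). change (ex_series (wsum beta a)) in Ha.
  destruct (taylor_poly_mul beta n q f a Hb Hq Hfa Ha) as (b & Hgb & Hbs).
  set (Z := Series (wsum beta (shift b))).
  assert (Hsb := wsum_shift beta b Hb Hbs).
  assert (Hs := sqrt_beta_gt_1 beta Hb).
  set (t0 := (beta + 3) / sqrt (beta + 2)).
  assert (Ht0 : 0 < t0) by (apply Rdiv_lt_0_compat; lra).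
  (* The minimiser of (e^2 - 2 e) + e |z0| t0, the bound for the change of the squared norm divided
     by |z g|^2. It is positive exactly when |z0| < 2 / t0. *)
  set (e := 1 - Cmod z0 * t0 / 2).
  assert (He : 0 < e).
  { unfold e. assert (Cmod z0 * t0 < 2); [|lra].
    replace 2 with (2 * sqrt (beta + 2) / (beta + 3) * t0) by (unfold t0; field; lra).
    now apply Rmult_lt_compat_r. }
  assert (Hz0 := Cmod_ge_0 z0).
  assert (He1 : e <= 1) by (unfold e; nra).
  assert (HZ : 0 < Z).
  { destruct (classic (forall k, b k = 0%C)) as [Hb0|Hb0].
    - exfalso. apply Hnz. intros z Hz.
      assert (Eg : (q z * f z)%C = 0%C).
      { assert (H := Hgb z Hz). apply is_pseries_C_iff in H. destruct H as [H1 H2].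
        assert (H0 := is_series_first_term (fun _ => 0) (fun _ => eq_refl)).
        apply injective_projections.
        - refine (is_series_R_eq _ _ _ _ H1 H0 _). intros k. now rewrite Hb0, Cmult_0_r.
        - refine (is_series_R_eq _ _ _ _ H2 H0 _). intros k. now rewrite Hb0, Cmult_0_r. }
      rewrite Ep, <- Cmult_assoc, Eg. ring.
    - apply not_all_ex_not in Hb0. destruct Hb0 as [k Hk].
      apply Rlt_le_trans with (wsum beta (shift b) (S k)).
      + unfold wsum. simpl shift. apply Rmult_lt_0_compat; [|now apply bergman_pos].
        apply pow_lt. now apply Cmod_gt_0.
      + apply term_le_Series; [intros; now apply wsum_nonneg|exact Hsb]. }
  set (r := fun z => ((RtoC (1 - e) * z - z0) * q z)%C).
  assert (Hr : is_poly (S n) r).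
  { apply is_poly_ext with (fun z => RtoC (1 - e) * (z * q z) + - z0 * q z)%C.
    - intros z. unfold r. ring.
    - apply is_poly_lin; [now apply is_poly_mul_z|now apply is_poly_widen]. }
  assert (Htay : forall x : R, has_taylor (fun z => (RtoC x * z - z0) * q z * f z - 1)%C
     (fun k => RtoC x * shift b k - z0 * b k - unit_seq k)%C).
  { intros x.
    apply has_taylor_ext with (3 := has_taylor_minus_1 _ _ (has_taylor_plus _ _ _ _
      (has_taylor_scal (RtoC x) _ _ (has_taylor_shift _ _ Hgb)) (has_taylor_scal (- z0) _ _ Hgb))).
    - intros z _. ring.
    - intros k. ring. }
  assert (Hws : forall x : R, ex_series (wsum beta (fun k => RtoC x * shift b k - z0 * b k - unit_seq k)%C)).
  { intros x. eapply ex_series_ext; [|apply (wsum_lin beta 1 (- 1) (fun k => RtoC x * shift b k + - z0 * b k)%C unit_seq Hb);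
      [now apply wsum_lin|apply wsum_unit]].
    intros k. unfold wsum.
    now replace (1 * (RtoC x * shift b k + - z0 * b k) + - 1 * unit_seq k)%C
      with (RtoC x * shift b k - z0 * b k - unit_seq k)%C by ring. }
  set (X := wsum beta (fun k => RtoC 1 * shift b k - z0 * b k - unit_seq k)%C).
  set (Y := wsum beta (fun k => RtoC (1 - e) * shift b k - z0 * b k - unit_seq k)%C).
  assert (Hle : Series X <= Series Y).
  { apply (optimal_le beta f p r (S n) _ _ Hb Hp Hr).
    - apply has_taylor_ext with (3 := Htay 1); [|reflexivity].
      intros z _. rewrite Ep. ring.
    - exact (Htay (1 - e)).
    - apply Hws. }
  set (U := wsum beta (shift b)) in *.
  set (V := fun n => match n with O => 0 | S k => Cmod (b (S k)) * Cmod (b k) * bergman beta (S k) end).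
  (* V sums the moduli in the inner product of g and z g; the bound is kept for partial sums and
     enters the final limit in that form. *)
  assert (HV : forall N, 2 * sum_n V N <= t0 * Z).
  { intros N. eapply Rle_trans; [apply (cross_term_bound beta (fun k => Cmod (b k)) N Hb)|].
    apply Rmult_le_compat_l; [now apply Rlt_le|].
    apply Rle_trans with (Series (fun k => U (S k))).
    - change (sum_n (fun k => U (S k)) N <= Series (fun k => U (S k))).
      apply sum_n_nonneg_le_Series; [intros; now apply wsum_nonneg|].
      now apply (ex_series_incr_1 U).
    - unfold Z. rewrite (Series_incr_1 U Hsb). assert (0 <= U 0%nat) by now apply wsum_nonneg. lra. }
  assert (HYX : forall k, Y k <= X k + ((e ^ 2 - 2 * e) * U k + 2 * e * Cmod z0 * V k)).
  { intros [|k].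
    - unfold Y, X, U, V, wsum. simpl shift.
      replace (RtoC (1 - e) * 0 - z0 * b 0%nat - unit_seq 0)%C
        with (RtoC 1 * 0 - z0 * b 0%nat - unit_seq 0)%C by ring.
      rewrite Cmod_0. apply Req_le. ring.
    - unfold Y, X, U, V, wsum. simpl shift. simpl unit_seq.
      replace (RtoC (1 - e) * b k - z0 * b (S k) - 0)%C with (RtoC (1 - e) * b k - z0 * b (S k))%C by ring.
      replace (RtoC 1 * b k - z0 * b (S k) - 0)%C with (b k - z0 * b (S k))%C by ring.
      assert (Hc := Cmod_perturb (b (S k)) (b k) z0 e (Rlt_le _ _ He)).
      assert (Hw := bergman_pos beta (S k) Hb).
      apply Rmult_le_compat_r with (r := bergman beta (S k)) in Hc; [|lra]. lra. }
  assert (HU : forall N, (2 * e - e ^ 2) * sum_n U N <= sum_n X N - sum_n Y N + e * Cmod z0 * (t0 * Z)).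
  { intros N. assert (H := sum_n_le_R _ _ N HYX).
    rewrite !sum_n_plus_R, !sum_n_scal_R in H.
    assert (H1 : e * Cmod z0 * (2 * sum_n V N) <= e * Cmod z0 * (t0 * Z)).
    { apply Rmult_le_compat_l; [apply Rmult_le_pos; lra|apply HV]. }
    lra. }
  assert (Hlim : (2 * e - e ^ 2) * Z <= Series X - Series Y + e * Cmod z0 * (t0 * Z)).
  { refine (is_lim_seq_le _ _ ((2 * e - e ^ 2) * Z)
      (Series X - Series Y + e * Cmod z0 * (t0 * Z)) HU _ _).
    - apply is_lim_seq_mult'; [apply is_lim_seq_const|exact (Series_correct U Hsb)].
    - apply is_lim_seq_plus'; [|apply is_lim_seq_const].
      apply is_lim_seq_minus'; [exact (Series_correct X (Hws 1))|exact (Series_correct Y (Hws (1 - e)))]. }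
  assert (E : Cmod z0 * t0 = 2 * (1 - e)) by (unfold e; lra).
  replace (e * Cmod z0 * (t0 * Z)) with (e * (Cmod z0 * t0) * Z) in Hlim by ring.
  rewrite E in Hlim.
  assert (0 < e ^ 2 * Z) by (apply Rmult_lt_0_compat; [now apply pow_lt|exact HZ]).
  lra.
Qed.

(** * The extremal function *)

(** H, I and Z are the Gram entries of f and z f for f = [fstar]. The last relation is the equality
    case of [cross_term_bound], and makes Z / I equal to 2 / t_0. *)
Lemma fstar_gram (beta : R) : -1 < beta ->
  exists H I Z : R,
    is_series (fun n => fstar_coef beta n ^ 2 * bergman beta n) H /\
    is_series (fun n => match n with O => 0 | S k =>
      fstar_coef beta n * fstar_coef beta k * bergman beta n end) I /\
    is_series (fun n => match n with O => 0 | S k =>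
      fstar_coef beta k ^ 2 * bergman beta n end) Z /\
    0 < Z /\ 2 * I = (beta + 3) / sqrt (beta + 2) * Z.
Proof.
  intros Hb. set (A := fstar_coef beta).
  assert (HA0 : forall n, 0 < A n) by (intros n; now apply fstar_coef_pos).
  assert (Hw : forall n, 0 < bergman beta n) by (intros n; now apply bergman_pos).
  assert (Hs := sqrt_beta_gt_1 beta Hb).
  assert (Hs2 : sqrt (beta + 2) ^ 2 = beta + 2) by (apply pow2_sqrt; lra).
  assert (HAs : ex_series (fun n => A n ^ 2)).
  { assert (Hl := inv_sqrt_beta_lt_1 beta Hb).
    apply ex_series_of_ratio with (/ sqrt (beta + 2) * / sqrt (beta + 2)); [nra|intros; now apply pow_lt|].
    assert (Hr := fstar_coef_ratio beta Hb).
    apply is_lim_seq_ext with (2 := is_lim_seq_mult' _ _ _ _ Hr Hr).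
    intros n. fold A. specialize (HA0 n). field. lra. }
  assert (HH : ex_series (fun n => A n ^ 2 * bergman beta n)).
  { apply ex_series_R_le with (2 := HAs). intros n.
    assert (H1 := bergman_le_1 beta n Hb). assert (H2 := pow2_ge_0 (A n)). specialize (Hw n).
    split; [apply Rmult_le_pos; lra|]. rewrite <- (Rmult_1_r (A n ^ 2)) at 2.
    now apply Rmult_le_compat_l. }
  assert (HZ' : ex_series (fun n => A n ^ 2 * bergman beta (S n))).
  { apply ex_series_R_le with (2 := HH). intros n.
    assert (H1 := bergman_S_le beta n Hb). assert (H2 := pow2_ge_0 (A n)).
    specialize (Hw (S n)).
    split; [apply Rmult_le_pos; lra|now apply Rmult_le_compat_l]. }
  assert (HI' : ex_series (fun n => A (S n) * A n * bergman beta (S n))).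
  { apply ex_series_R_le with (fun n => A (S n) ^ 2 * bergman beta (S n) + A n ^ 2 * bergman beta (S n)).
    - intros n. assert (H1 := HA0 n). assert (H2 := HA0 (S n)). specialize (Hw (S n)).
      split; [apply Rmult_le_pos; [apply Rmult_le_pos|]; lra|].
      rewrite <- Rmult_plus_distr_r. apply Rmult_le_compat_r; [lra|].
      assert (H3 := pow2_ge_0 (A (S n) - A n)). nra.
    - apply (ex_series_plus (V := R_NormedModule)); [|exact HZ'].
      now apply (ex_series_incr_1 (fun n => A n ^ 2 * bergman beta n)). }
  set (fI := fun n => match n with O => 0 | S k => A n * A k * bergman beta n end).
  set (fZ := fun n => match n with O => 0 | S k => A k ^ 2 * bergman beta n end).
  assert (HI : ex_series fI) by (apply ex_series_incr_1; exact HI').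
  assert (HZ : ex_series fZ) by (apply ex_series_incr_1; exact HZ').
  exists (Series (fun n => A n ^ 2 * bergman beta n)), (Series fI), (Series fZ).
  split; [now apply Series_correct|]. split; [now apply Series_correct|].
  split; [now apply Series_correct|]. split.
  - apply Rlt_le_trans with (fZ 1%nat).
    + apply Rmult_lt_0_compat; [now apply pow_lt|apply Hw].
    + apply term_le_Series; [|exact HZ]. intros [|k]; unfold fZ; [lra|].
      apply Rmult_le_pos; [apply pow2_ge_0|now apply Rlt_le].
  (* The eigenvector equation multiplied by [A n] and summed: its two off-diagonal terms both sum to
     I, one through a shift of the index. *)
  - assert (E : Series (fun n => A (S n) * A n * bergman beta (S n)) + Series fI
      = (beta + 3) / sqrt (beta + 2) * Series (fun n => A n ^ 2 * bergman beta (S n))).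
    { rewrite <- Series_plus by assumption. rewrite <- Series_scal_l.
      apply Series_ext. intros n.
      set (s := sqrt (beta + 2)) in *.
      assert (HAn : forall n, A (S n) = (INR n + beta + 3) / (s * (INR n + 1)) * A n) by reflexivity.
      clearbody A.
      destruct n as [|k]; unfold fI.
      - rewrite HAn. simpl INR. field. lra.
      - rewrite (HAn (S k)), (HAn k), (bergman_S beta (S k) Hb), S_INR.
        assert (Hk := pos_INR k).
        assert (Hbeta : beta = s ^ 2 - 2) by lra.
        assert (Hd : INR k + 1 + beta + 2 <> 0) by lra.
        apply Rmult_eq_reg_r with (s ^ 2); [|nra].
        transitivity ((INR k + beta + 3) / (INR k + 1) * A k ^ 2 * bergman beta (S k) *
          ((INR k + beta + 4) / (s * (INR k + 1)) + s)).
        + field. repeat split; lra.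
        + transitivity ((INR k + beta + 3) / (INR k + 1) * A k ^ 2 * bergman beta (S k) *
            ((beta + 3) * (INR k + 2) / (s * (INR k + 1)))).
          * f_equal. replace ((INR k + beta + 4) / (s * (INR k + 1)) + s)
              with ((INR k + beta + 4 + s ^ 2 * (INR k + 1)) / (s * (INR k + 1))) by (field; lra).
            rewrite Hs2. field. lra.
          * field. repeat split; lra. }
    rewrite (Series_incr_1 fZ HZ). rewrite (Series_incr_1 fI HI) in E |- *.
    change (fI 0%nat) with 0 in *. change (fZ 0%nat) with 0.
    change (Series (fun k => fI (S k))) with (Series (fun n => A (S n) * A n * bergman beta (S n))) in *.
    change (Series (fun k => fZ (S k))) with (Series (fun n => A n ^ 2 * bergman beta (S n))).
    lra.
Qed.

(** For real x and y, the squared norm of x f + y z f in terms of the Gram entries. *)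
Definition quad (H I Z x y : R) : R := x ^ 2 * H + 2 * x * y * I + y ^ 2 * Z.

Lemma quad_pos_def (H I Z x y : R) : 0 < H -> 0 < H * Z - I ^ 2 ->
  0 <= quad H I Z x y /\ (quad H I Z x y <= 0 -> x = 0 /\ y = 0).
Proof.
  intros HH HD. unfold quad.
  assert (E : H * (x ^ 2 * H + 2 * x * y * I + y ^ 2 * Z) = (H * x + I * y) ^ 2 + (H * Z - I ^ 2) * y ^ 2)
    by ring.
  set (q := x ^ 2 * H + 2 * x * y * I + y ^ 2 * Z) in *.
  assert (H1 := pow2_ge_0 (H * x + I * y)). assert (H2 := pow2_ge_0 y).
  assert (H3 : 0 <= (H * Z - I ^ 2) * y ^ 2) by (apply Rmult_le_pos; lra).
  assert (H0 : 0 <= H * q) by lra.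
  split.
  - apply Rmult_le_reg_l with H; lra.
  - intros Hq. assert (Hq' : H * q <= 0) by nra.
    assert (Hy : y = 0).
    { destruct (Req_dec y 0) as [|Hne]; [assumption|].
      assert (0 < y ^ 2) by (rewrite <- pow2_abs; apply pow_lt; now apply Rabs_pos_lt).
      assert (0 < (H * Z - I ^ 2) * y ^ 2) by now apply Rmult_lt_0_compat. lra. }
    split; [|exact Hy]. rewrite Hy in H1, H3, E.
    destruct (Req_dec x 0) as [|Hne]; [assumption|].
    assert (0 < x ^ 2) by (rewrite <- pow2_abs; apply pow_lt; now apply Rabs_pos_lt).
    assert (0 < H ^ 2 * x ^ 2) by (apply Rmult_lt_0_compat; [now apply pow_lt|assumption]).
    nra.
Qed.

(* The squared norm of [(c0 + c1 z) f - 1] is a quadratic polynomial in [c0] and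
   [c1], since the Taylor coefficients of [f] are real. *)
Lemma fstar_residual_norm (beta H I Z : R) (c0 c1 : C) : -1 < beta ->
  is_series (fun n => fstar_coef beta n ^ 2 * bergman beta n) H ->
  is_series (fun n => match n with O => 0 | S k =>
      fstar_coef beta n * fstar_coef beta k * bergman beta n end) I ->
  is_series (fun n => match n with O => 0 | S k =>
      fstar_coef beta k ^ 2 * bergman beta n end) Z ->
  is_series (wsum beta (fun n => c0 * RtoC (fstar_coef beta n)
      + c1 * shift (fun n => RtoC (fstar_coef beta n)) n - unit_seq n)%C)
    (quad H I Z (Re c0) (Re c1) + quad H I Z (Im c0) (Im c1) - 2 * Re c0 + 1).
Proof.
  intros Hb HH HI HZ.
  assert (HU := is_series_first_term (fun n => match n with O => 1 | S _ => 0 end) (fun _ => eq_refl)).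
  assert (K := is_series_lin 1 1 _ _ _ _
    (is_series_lin (Re c0 ^ 2 + Im c0 ^ 2) (2 * (Re c0 * Re c1 + Im c0 * Im c1)) _ _ _ _ HH HI)
    (is_series_lin (Re c1 ^ 2 + Im c1 ^ 2) (1 - 2 * Re c0) _ _ _ _ HZ HU)).
  match type of K with is_series _ ?l =>
    replace (quad H I Z (Re c0) (Re c1) + quad H I Z (Im c0) (Im c1) - 2 * Re c0 + 1) with l
      by (unfold quad; ring) end.
  apply is_series_ext with (2 := K). intros n. unfold wsum. rewrite Cmod_sqr.
  match goal with |- ?x = ?y => change (@eq R x y) end.
  destruct n as [|k]; unfold shift, unit_seq.
  - rewrite bergman_0. simpl fstar_coef. unfold Re, Im. simpl. ring.
  - set (a := fstar_coef beta (S k)). set (b := fstar_coef beta k).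
    unfold Re, Im. simpl. ring.
Qed.

Lemma is_poly_1_inv (q : C -> C) : is_poly 1 q -> exists c0 c1, forall z, q z = (c0 + c1 * z)%C.
Proof.
  intros Hq. destruct (is_poly_S_inv _ _ Hq) as (c0 & q' & [d Hd] & E).
  exists c0, (d 0%nat). intros z. rewrite E, Hd, sum_O. simpl. ring.
Qed.

Lemma is_poly_1_affine (c0 c1 : C) : is_poly 1 (fun z => c0 + c1 * z)%C.
Proof.
  apply is_poly_ext with (fun z => 1 * c0 + 1 * (z * c1))%C; [intros z; ring|].
  apply is_poly_lin; [apply is_poly_widen, is_poly_0|apply is_poly_mul_z, is_poly_0].
Qed.

(** Stated through Taylor coefficients so that it covers both [fstar] and the rational closed form
    for beta = 0, which need only agree with it in the disk. *)
Lemma OA1_attains_of_taylor (beta : R) (f : C -> C) : -1 < beta ->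
  has_taylor f (fun n => RtoC (fstar_coef beta n)) ->
  OA1_attains (bergman beta) f (2 * sqrt (beta + 2) / (beta + 3)).
Proof.
  intros Hb Hf. set (a := fun n => RtoC (fstar_coef beta n)) in *.
  destruct (fstar_gram beta Hb) as (H & I & Z & HH & HI & HZ & HZ0 & HIZ).
  assert (Hs := sqrt_beta_gt_1 beta Hb).
  assert (HF := fun c0 c1 => fstar_residual_norm beta H I Z c0 c1 Hb HH HI HZ).
  fold a in HF.
  assert (HI0 : 0 < I).
  { assert (0 < (beta + 3) / sqrt (beta + 2)) by (apply Rdiv_lt_0_compat; lra). nra. }
  (* The constant coefficient of f + y z f is 1, whatever y. At y = - I / Z this bounds (H Z - I^2)
     / Z below by 1, giving strict Cauchy-Schwarz. *)
  assert (HD1 : 1 <= quad H I Z 1 (- I / Z)).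
  { set (y := - I / Z).
    assert (K := is_series_lin 1 1 _ _ _ _
      (is_series_lin 1 (2 * y) _ _ _ _ HH HI)
      (is_series_lin (y ^ 2) 0 _ _ _ _ HZ HZ)).
    set (g := fun n => (fstar_coef beta n
      + y * match n with O => 0 | S k => fstar_coef beta k end) ^ 2 * bergman beta n).
    assert (Hg : is_series g (quad H I Z 1 y)).
    { replace (quad H I Z 1 y) with (1 * (1 * H + 2 * y * I) + 1 * (y ^ 2 * Z + 0 * Z))
        by (unfold quad; ring).
      apply is_series_ext with (2 := K). intros n.
      match goal with |- ?x = ?y => change (@eq R x y) end.
      unfold g. destruct n; ring. }
    rewrite <- (is_series_unique _ _ Hg). apply Rle_trans with (g 0%nat).
    - unfold g. rewrite bergman_0. simpl. lra.
    - apply term_le_Series; [|eexists; exact Hg]. intros n.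
      apply Rmult_le_pos; [apply pow2_ge_0|now apply Rlt_le, bergman_pos]. }
  assert (HD : 0 < H * Z - I ^ 2).
  { assert (E : quad H I Z 1 (- I / Z) * Z = H * Z - I ^ 2) by (unfold quad; field; lra). nra. }
  assert (HH0 : 0 < H) by nra.
  set (D := H * Z - I ^ 2) in *.
  (* The solution of the normal equations [Eq1] and [Eq2]. *)
  set (alpha := Z / D). set (gamma := - I / D).
  assert (Eq1 : alpha * H + gamma * I = 1) by (unfold alpha, gamma, D in *; field; lra).
  assert (Eq2 : alpha * I + gamma * Z = 0) by (unfold alpha, gamma, D in *; field; lra).
  set (F := fun c0 c1 : C =>
    quad H I Z (Re c0) (Re c1) + quad H I Z (Im c0) (Im c1) - 2 * Re c0 + 1) in *.
  set (p := fun z : C => (RtoC alpha + RtoC gamma * z)%C).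
  (* At the solution of the normal equations the linear part cancels and the excess is a positive
     definite form; it yields both minimality and uniqueness. *)
  assert (HFmin : forall c0 c1, F c0 c1 = F (RtoC alpha) (RtoC gamma)
    + (quad H I Z (Re c0 - alpha) (Re c1 - gamma) + quad H I Z (Im c0) (Im c1))).
  { intros c0 c1. unfold F. rewrite !re_RtoC, !im_RtoC.
    assert (E : quad H I Z (Re c0) (Re c1) = quad H I Z alpha gamma
      + quad H I Z (Re c0 - alpha) (Re c1 - gamma)
      + 2 * ((Re c0 - alpha) * (alpha * H + gamma * I) + (Re c1 - gamma) * (alpha * I + gamma * Z)))
      by (unfold quad; ring).
    rewrite E, Eq1, Eq2. unfold quad. ring. }
  assert (Htay : forall q c0 c1, (forall z, q z = c0 + c1 * z)%C ->
    has_taylor (fun z => q z * f z - 1)%C (fun n => c0 * a n + c1 * shift a n - unit_seq n)%C).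
  { intros q c0 c1 E.
    apply has_taylor_ext with (3 := has_taylor_minus_1 _ _ (has_taylor_plus _ _ _ _
      (has_taylor_scal c0 _ _ Hf) (has_taylor_scal c1 _ _ (has_taylor_shift _ _ Hf)))).
    - intros z _. rewrite E. ring.
    - intros n. ring. }
  assert (HFS : forall c0 c1, ex_series (wsum beta (fun n => c0 * a n + c1 * shift a n - unit_seq n)%C)
    /\ Series (wsum beta (fun n => c0 * a n + c1 * shift a n - unit_seq n)%C) = F c0 c1).
  { intros c0 c1. split; [eexists; apply HF|]. apply is_series_unique, HF. }
  assert (Hp1 : is_poly 1 p) by apply is_poly_1_affine.
  assert (Hopt : is_optimal_approximant (bergman beta) f 1 p).
  { split; [exact Hp1|].
    exists (sqrt (Series (wsum beta (fun n => RtoC alpha * a n + RtoC gamma * shift a n - unit_seq n)%C))).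
    split.
    - apply is_H2norm_Series; [exact Hb|now apply Htay|apply HFS].
    - intros q M Hq HM. destruct (is_poly_1_inv q Hq) as (c0 & c1 & E).
      destruct (is_H2norm_eq beta _ _ M (Htay q c0 c1 E) HM) as [_ EM].
      destruct HM as [HM0 _]. rewrite <- (sqrt_pow2 M) by exact HM0. apply sqrt_le_1_alt.
      rewrite EM, !(proj2 (HFS _ _)), (HFmin c0 c1).
      assert (Q1 := proj1 (quad_pos_def H I Z (Re c0 - alpha) (Re c1 - gamma) HH0 HD)).
      assert (Q2 := proj1 (quad_pos_def H I Z (Im c0) (Im c1) HH0 HD)). lra. }
  assert (Ha : alpha <> 0).
  { unfold alpha. apply Rgt_not_eq. now apply Rdiv_lt_0_compat. }
  set (z0 := 2 * sqrt (beta + 2) / (beta + 3)).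
  assert (Hz0 : 0 < z0) by (apply Rdiv_lt_0_compat; lra).
  assert (Hpz0 : p (RtoC z0) = 0%C).
  { unfold p. rewrite <- RtoC_mult, <- RtoC_plus. f_equal.
    assert (EZ : Z = z0 * I).
    { assert (EI : I = (beta + 3) / sqrt (beta + 2) * Z / 2) by lra.
      rewrite EI. unfold z0. field. lra. }
    unfold alpha, gamma. rewrite EZ at 1. field. lra. }
  split; [|split].
  - exists a. split; [exact Hf|]. exists H. apply is_series_ext with (2 := HH).
    intros n. unfold a. rewrite Cmod_R, pow2_abs. reflexivity.
  - rewrite (has_taylor_at_0 f a Hf). unfold a. simpl. apply C1_nz.
  - exists p. split; [exact Hopt|]. split; [|split; [split; [exact Hp1|]|]].
    + intros q Hq z. assert (Hq1 := proj1 Hq).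
      destruct (is_poly_1_inv q Hq1) as (c0 & c1 & E).
      destruct (optimal_le beta f q p 1 _ _ Hb Hq Hp1 (Htay q c0 c1 E)
        (Htay p (RtoC alpha) (RtoC gamma) (fun _ => eq_refl)) (proj1 (HFS _ _))) as [_ Hle].
      rewrite !(proj2 (HFS _ _)), (HFmin c0 c1) in Hle.
      destruct (quad_pos_def H I Z (Re c0 - alpha) (Re c1 - gamma) HH0 HD) as [Q1 Q1'].
      destruct (quad_pos_def H I Z (Im c0) (Im c1) HH0 HD) as [Q2 Q2'].
      destruct (Q1' ltac:(lra)) as [X1 X2]. destruct (Q2' ltac:(lra)) as [X3 X4].
      rewrite E. unfold p.
      replace c0 with (RtoC alpha) by (apply injective_projections; unfold Re, Im in *; simpl; lra).
      replace c1 with (RtoC gamma) by (apply injective_projections; unfold Re, Im in *; simpl; lra).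
      reflexivity.
    (* A constant polynomial vanishing at z0 would vanish at 0, where p takes the nonzero value
       alpha. *)
    + intros [c Hc]. apply Ha. apply RtoC_inj.
      rewrite <- Hpz0, Hc, sum_O. simpl.
      replace (c 0%nat * 1)%C with (p 0%C) by (rewrite Hc, sum_O; reflexivity).
      unfold p. ring.
    + exists (RtoC z0). split; [exact Hpz0|]. rewrite Cmod_R. apply Rabs_pos_eq. lra.
Qed.

Lemma zero_modulus_minimum (beta : R) : -1 < beta ->
  is_minimum (OA_zero_modulus (bergman beta)) (2 * sqrt (beta + 2) / (beta + 3)).
Proof.
  intros Hb. split.
  - destruct (OA1_attains_of_taylor beta (fstar beta) Hb (fstar_taylor beta Hb))
      as (Hf & Hf0 & p & Hp & _ & _ & z & Hz & Hr).
    exists (fstar beta), 1%nat, p, z. repeat split; try assumption; try apply Hp. now symmetry.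
  - intros s (f & n & p & z & Hf & Hf0 & Hp & Hz & ->).
    now apply (zero_modulus_ge beta f p n).
Qed.

Lemma fstar_bergman (z : C) : in_disk z ->
  fstar 0 z = (RtoC (2 * sqrt 2) / (RtoC (sqrt 2) - z) ^ 3)%C.
Proof.
  intros Hz. unfold fstar. replace (0 + 2) with 2 by ring. replace (0 + 3) with 3 by ring.
  assert (Hs : 1 < sqrt 2) by (rewrite <- sqrt_1 at 1; apply sqrt_lt_1_alt; lra).
  assert (Hs2 : sqrt 2 * sqrt 2 = 2) by (apply sqrt_sqrt; lra).
  assert (HS : RtoC (sqrt 2) <> 0%C) by (intros E; apply RtoC_inj in E; lra).
  assert (Hsz : (RtoC (sqrt 2) - z)%C <> 0%C).
  { intros E. apply Ceq_minus in E. unfold in_disk in Hz. rewrite <- E, Cmod_R, Rabs_pos_eq in Hz; lra. }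
  set (w := (1 - z / RtoC (sqrt 2))%C).
  assert (Ew : w = ((RtoC (sqrt 2) - z) / RtoC (sqrt 2))%C) by (unfold w; field; exact HS).
  assert (Hw : w <> 0%C).
  { intros E. apply Hsz. rewrite E in Ew.
    replace (RtoC (sqrt 2) - z)%C with ((RtoC (sqrt 2) - z) / RtoC (sqrt 2) * RtoC (sqrt 2))%C by (field; exact HS).
    rewrite <- Ew. ring. }
  assert (H3 : Cpower w 3 = (w * w * w)%C).
  { unfold Cpower. replace (RtoC 3 * Clog w)%C with (Clog w + Clog w + Clog w)%C by ring.
    rewrite !Cexp_plus, Cexp_Clog by exact Hw. reflexivity. }
  assert (Hop := Cpower_opp w 3). rewrite H3 in Hop.
  transitivity (/ (w * w * w))%C.
  - rewrite <- (Cmult_1_r (/ _)%C), <- Hop. field. exact Hw.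
  - assert (E : RtoC (2 * sqrt 2) = (RtoC (sqrt 2) * RtoC (sqrt 2) * RtoC (sqrt 2))%C)
      by (rewrite <- !RtoC_mult, Hs2; reflexivity).
    rewrite Ew, E. field. split; assumption.
Qed.

Theorem theorem5p1 (beta : R) (hbeta : -1 < beta) :
  (is_minimum (OA_zero_modulus (bergman beta))
     (2 * sqrt (beta + 2) / (beta + 3)) /\
   OA1_attains (bergman beta) (fstar beta)
     (2 * sqrt (beta + 2) / (beta + 3))) /\
  (is_minimum (OA_zero_modulus (bergman 0)) (2 / 3 * sqrt 2) /\
   (forall z : C, in_disk z ->
      fstar 0 z = (RtoC (2 * sqrt 2) / (RtoC (sqrt 2) - z)^3)%C) /\
   OA1_attains (bergman 0)
     (fun z => RtoC (2 * sqrt 2) / (RtoC (sqrt 2) - z)^3)%C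
     (2 / 3 * sqrt 2)) /\
  (forall t : R,
     (spectrum (jacobi (bergman beta)) (RtoC t) /\ 2 < t) <->
     (exists m : nat, t = t_ beta m)) /\
  (forall m : nat,
     solves_ode beta (t_ beta m) (f_ beta m) /\
     f_ beta m 0%C = 1%C /\
     (forall g : C -> C,
        solves_ode beta (t_ beta m) g -> g 0%C = 1%C ->
        forall z : C, in_disk z -> g z = f_ beta m z)).
Proof.
  assert (h0 : -1 < 0) by lra.
  assert (E0 : 2 / 3 * sqrt 2 = 2 * sqrt (0 + 2) / (0 + 3)).
  { replace (0 + 2) with 2 by ring. field. }
  split; [split|split; [split; [|split]|split]].
  - now apply zero_modulus_minimum.
  - now apply OA1_attains_of_taylor, fstar_taylor.
  - rewrite E0. now apply zero_modulus_minimum.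
  - apply fstar_bergman.
  - rewrite E0. apply OA1_attains_of_taylor; [exact h0|].
    apply has_taylor_ext with (3 := fstar_taylor 0 h0); [apply fstar_bergman|reflexivity].
  - intros t. now apply spectrum_above_2.
  - intros m. now apply ode_part.
Qed.
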